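(* Let $p$ be a prime and $m\ge 1$ an integer. Let $F=\bigcup_{k=0}^{m-1}p^k\mathbb{Z}_p^\times$ (a fundamental domain of the Tate curve $\mathbb{Q}_p^\times/p^{m\mathbb{Z}}$), and let $D$ be the operator $$Du(x)=|x|_p\int_{F}\frac{u(z)-u(x)}{|z-x|_p^2}\,dz,\qquad x\in F,$$ acting on functions on $F$, considered on $L^2(F,\frac{dx}{|x|_p})$. Let $\boldsymbol{P}\in\mathbb{R}^{m\times m}$ have entries $P_{ij}=p^{-|i-j|}$ for $0\le i,j\le m-1$. Put $\boldsymbol{L}=\mathrm{diag}(\boldsymbol{P}\boldsymbol{1}_m)-\boldsymbol{P}$ and $\boldsymbol{R}=-(1-p^{-1})\boldsymbol{L}$. Let $\boldsymbol{Q}=(q_{k,l})_{0\le k,l\le m-1}$ be an orthogonal matrix with $\boldsymbol{Q}^{-1}\boldsymbol{R}\boldsymbol{Q}=\mathrm{diag}(\lambda_{0,0},\dots,\lambda_{0,m-1})$, where $\lambda_{0,0}=0$ and the $0$-th column of $\boldsymbol{Q}$ is $\frac{1}{\sqrt m}\boldsymbol{1}_m$. Then: (1) The eigenvalues of $D$ are the numbers $\lambda_{0,l}$, $0\le l\le m-1$ (the eigenvalues of $\boldsymbol{R}$, with $\lambda_{0,0}=0$), and, for $n\ge 1$ and $0\le l\le m-1$, $$\lambda_{n,l}=-p^{n-1}-p^{n-2}+\frac{p^{-l}+p^{l+1-m}}{p}.$$ The eigenfunction for $\lambda_{0,l}$ is $\phi_0^l(x)=\sum_{k=0}^{m-1}q_{k,l}\boldsymbol{1}_{p^k\mathbb{Z}_p^\times}(x)$,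 and the eigenfunctions for $\lambda_{n,l}$ ($n\ge1$) are the functions $\phi^l_\chi(x)=\chi(p^{-l}x)\boldsymbol{1}_{p^l\mathbb{Z}_p^\times}(x)$ where $\chi$ ranges over the characters of $\mathbb{Z}_p^\times$ of conductor $n$. The corresponding multiplicities (number of such eigenfunctions for a given index) are $m_{0,0}=1$, $m_{1,l}=p-2$, and $m_{n,l}=(p-1)^2p^{n-2}$ for $n\ge2$. (2) Let $G$ be the Green's function of $D$, i.e. $D_xG(x,y)=\delta_y(x)-\frac{1}{V}$ on $F$, where $V=m(1-p^{-1})$ is the total volume of $F$ for the measure $\frac{dx}{|x|_p}$ and $\delta_y$ is the Dirac mass at $y$ with respect to this measure. Then, up to an additive constant $C(|y|_p)$ depending only on $|y|_p$, for $x,y\in F$ with $v_p(x)=v_p(y)=l$ and $d(x,y)=p^{-M}$ (with $M\ge1$), $$G(x,y)=\frac{p^{M+1}}{p^{M+1}+p^{M}-(p^{-l}+p^{l+1-m})}-\sum_{n=1}^{M}\frac{(p-1)p^n}{p^{n}+p^{n-1}-(p^{-l}+p^{l+1-m})}+\sum_{k=1}^{m-1}\frac{q_{v_p(x),k}\,q_{v_p(y),k}}{(1-p^{-1})\lambda_{0,k}}.$$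
   Context: $|\cdot|_p$ is the $p$-adic absolute value, $v_p$ the $p$-adic valuation, and $dz$ the additive Haar measure on $\mathbb{Q}_p$ normalized so that $\int_{\mathbb{Z}_p}dz=1$. The inner product on functions on $F$ is $\langle f,g\rangle=\int_F f\bar g\,\frac{dx}{|x|_p}$. For $x,y\in F$, $d(x,y)=\frac{|x-y|_p}{\max\{|x|_p,|y|_p\}}$. A character of $\mathbb{Z}_p^\times$ is a continuous homomorphism $\chi:\mathbb{Z}_p^\times\to S^1$; the conductor of a nontrivial character $\chi$ is the least integer $n\ge1$ such that $\chi$ is trivial on $1+p^n\mathbb{Z}_p$ (the trivial character has conductor $0$).
   Formalization: Indices of multiplicity 0 (p=2, n=1) give no eigenvalue: for p=2, m=1, -1/2 is none. The equation fixes G only up to c(y), so the constant C(|y|_p) is proved for the mean-zero Green's function, and a constant c(y) for any other. *)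

(* Defs.v *)
From HB Require Import structures.
From mathcomp Require Import all_boot all_order all_algebra.
From mathcomp Require Import all_classical all_reals all_analysis.
From mathcomp Require Import fraction complex.

Set Implicit Arguments.
Unset Strict Implicit.
Unset Printing Implicit Defensive.

Import Order.TTheory GRing.Theory Num.Theory.
Import numFieldNormedType.Exports.

Local Open Scope classical_set_scope.
Local Open Scope complex_scope.
Local Open Scope ring_scope.

(* p-adic integers as the inverse limit of the rings Z/p^n: [zpres x n] is the
   representative in {0, ..., p^n - 1} of the residue of x modulo p^n.  The
   primality proof is a parameter of the type so that it can carry canonical
   ring structures. *)
Record padic_int (p : nat) (hp : prime p) := MkPadicInt {
  zpres : nat -> int;
  zpresP : forall n, (zpres n.+1 %% (p ^ n)%N%:Z)%Z = zpres n }.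

HB.instance Definition _ (p : nat) (hp : prime p) := gen_eqMixin (padic_int hp).
HB.instance Definition _ (p : nat) (hp : prime p) := gen_choiceMixin (padic_int hp).

Section PadicInt.
Variables (p : nat) (hp : prime p).
Local Notation Z := (padic_int hp).
Local Notation q n := ((p ^ n)%N%:Z).

Lemma zpinj (x y : Z) : zpres x =1 zpres y -> x = y.
Proof.
case: x y => [x hx] [y hy] /= /funext exy; subst y.
by congr MkPadicInt; exact: Prop_irrelevance.
Qed.

Lemma modz_pS (a : int) n : ((a %% q n.+1)%Z %% q n)%Z = (a %% q n)%Z.
Proof.
by rewrite [in RHS](divz_eq a (q n.+1)) -[in RHS]modzDml expnS PoszM mulrA modzMl add0r.
Qed.

Lemma zpres_mod (x : Z) n : (zpres x n %% q n)%Z = zpres x n.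
Proof. by rewrite -{2}(zpresP x) -[in LHS](zpresP x) modz_mod. Qed.

Definition zpmk (f : nat -> int)
  (hf : forall n, (f n.+1 = f n %[mod q n])%Z) : Z.
Proof.
exists (fun n => (f n %% q n)%Z) => n.
by rewrite modz_pS hf.
Defined.

Lemma zp_coh (x : Z) n : (zpres x n.+1 = zpres x n %[mod q n])%Z.
Proof. by rewrite zpresP zpres_mod. Qed.

Lemma zp0_subproof n : (0 = 0 %[mod q n])%Z. Proof. by []. Qed.
Lemma zp1_subproof n : (1 = 1 %[mod q n])%Z. Proof. by []. Qed.
Lemma zpD_subproof (x y : Z) n :
  (zpres x n.+1 + zpres y n.+1 = zpres x n + zpres y n %[mod q n])%Z.
Proof. by rewrite -modzDm !zp_coh modzDm. Qed.
Lemma zpN_subproof (x : Z) n :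
  (- zpres x n.+1 = - zpres x n %[mod q n])%Z.
Proof. by rewrite -modzNm zp_coh modzNm. Qed.
Lemma zpM_subproof (x y : Z) n :
  (zpres x n.+1 * zpres y n.+1 = zpres x n * zpres y n %[mod q n])%Z.
Proof. by rewrite -modzMm !zp_coh modzMm. Qed.

Definition zp0 : Z := zpmk (f := fun=> 0) zp0_subproof.
Definition zp1 : Z := zpmk (f := fun=> 1) zp1_subproof.
Definition zpD (x y : Z) : Z :=
  zpmk (f := fun n => zpres x n + zpres y n) (zpD_subproof x y).
Definition zpN (x : Z) : Z := zpmk (f := fun n => - zpres x n) (zpN_subproof x).
Definition zpM (x y : Z) : Z :=
  zpmk (f := fun n => zpres x n * zpres y n) (zpM_subproof x y).

Lemma zpDA : associative zpD.
Proof. by move=> x y z; apply: zpinj => n /=; rewrite modzDml modzDmr addrA. Qed.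
Lemma zpDC : commutative zpD.
Proof. by move=> x y; apply: zpinj => n /=; rewrite addrC. Qed.
Lemma zp0D : left_id zp0 zpD.
Proof. by move=> x; apply: zpinj => n /=; rewrite modzDml add0r zpres_mod. Qed.
Lemma zpND : left_inverse zp0 zpN zpD.
Proof. by move=> x; apply: zpinj => n /=; rewrite modzDml addNr. Qed.

HB.instance Definition _ := GRing.isZmodule.Build Z zpDA zpDC zp0D zpND.

Lemma zpMA : associative zpM.
Proof. by move=> x y z; apply: zpinj => n /=; rewrite modzMml modzMmr mulrA. Qed.
Lemma zpMC : commutative zpM.
Proof. by move=> x y; apply: zpinj => n /=; rewrite mulrC. Qed.
Lemma zp1M : left_id zp1 zpM.
Proof. by move=> x; apply: zpinj => n /=; rewrite modzMml mul1r zpres_mod. Qed.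
Lemma zpMD : left_distributive zpM zpD.
Proof.
by move=> x y z; apply: zpinj => n /=; rewrite modzMml modzDm mulrDl.
Qed.
Lemma zp1_neq0 : zp1 != zp0.
Proof.
apply/eqP => /(congr1 (fun x => zpres x 1)) /=.
by rewrite expn1 mod0z modz_small // ltz_nat prime_gt1.
Qed.

HB.instance Definition _ :=
  GRing.Zmodule_isComNzRing.Build Z zpMA zpMC zp1M zpMD zp1_neq0.

Definition zp_unit : {pred Z} := [pred x | `[< exists y : Z, y * x = 1 >]].
Definition zp_inv (x : Z) : Z := xget x [set y | y * x = 1].

Lemma zp_mulVx : {in zp_unit, left_inverse 1 zp_inv *%R}.
Proof.
move=> x /asboolW yx; exact: (xgetPex x (P := [set y | y * x = 1]) yx).
Qed.
Lemma zp_unitPl (x y : Z) : y * x = 1 -> zp_unit x.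
Proof. by move=> yx; apply/asboolP; exists y. Qed.
Lemma zp_invr_out : {in [predC zp_unit], zp_inv =1 id}.
Proof.
move=> x /asboolPn nx.
by apply: (@xgetPN _ x [set y | y * x = 1]) => y yx; apply: nx; exists y.
Qed.

HB.instance Definition _ :=
  GRing.ComNzRing_hasMulInverse.Build Z zp_mulVx zp_unitPl zp_invr_out.

Lemma zpres_le (x : Z) m n : (zpres x (m + n) %% q m)%Z = zpres x m.
Proof.
elim: n => [|n IHn]; first by rewrite addn0 zpres_mod.
have pow_dvd : (q m %| q (m + n))%Z by rewrite dvdzE /= dvdn_exp2l ?leq_addr.
rewrite addnS -{}IHn -[in RHS]zpresP; case/dvdzP: pow_dvd => c ->.
by rewrite [in LHS](divz_eq (zpres x _) (c * q m)) -modzDml mulrA modzMl add0r.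
Qed.

Lemma zp_idomain (x y : Z) : x * y = 0 -> (x == 0) || (y == 0).
Proof.
have nz_res (z : Z) : z != 0 -> exists a, forall n, ~~ (q a %| zpres z (a + n))%Z.
  move=> /eqP z0; apply: contrapT => /forallNP h; apply: z0; apply: zpinj => n.
  rewrite /= mod0z; apply/eqP; apply: contra_notT (h n) => zn k.
  by apply/negP => /dvdz_mod0P; rewrite zpres_le => z0; rewrite z0 in zn.
move=> xy0; apply: contraT => /norP[/nz_res[a ha] /nz_res[b hb]].
move/(congr1 (fun z => zpres z (a + b))): xy0 => /=.
rewrite mod0z => /dvdz_mod0P; rewrite dvdzE abszM /= => dv.
move: (ha b) (hb a); rewrite (addnC b a) !dvdzE /=.
have [->|X0] := posnP `|zpres x (a + b)|; first by rewrite dvdn0.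
have [->|Y0] := posnP `|zpres y (a + b)|; first by rewrite dvdn0.
move: dv; rewrite !pfactor_dvdn ?muln_gt0 ?X0 ?Y0 // lognM // -!ltnNge => le1 lt1 lt2.
by have := leq_add lt1 (ltnW lt2); rewrite addSn ltnNge le1.
Qed.

HB.instance Definition _ := GRing.ComUnitRing_isIntegral.Build Z zp_idomain.
End PadicInt.

Definition Qp (p : nat) (hp : prime p) : Type := {fraction padic_int hp}.
HB.instance Definition _ (p : nat) (hp : prime p) := GRing.Field.on (Qp hp).
HB.instance Definition _ (p : nat) (hp : prime p) :=
  isPointed.Build (Qp hp) (0 : Qp hp).

Section Padic.
Variables (p : nat) (hp : prime p).

Definition Zpset : set (Qp hp) := range (@FracField.tofrac (padic_int hp)).

Definition Zpunits : set (Qp hp) :=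
  [set FracField.tofrac u | u in [set u : padic_int hp | u \is a GRing.unit]].

(* p^k Z_p^* *)
Definition psphere (k : int) : set (Qp hp) :=
  [set p%:R ^ k * u | u in Zpunits].

(* The value at 0 is irrelevant: it is the default value of xget. *)
Definition vp (x : Qp hp) : int := xget 0 [set k | psphere k x].

Definition pabs (R : realType) (x : Qp hp) : R :=
  if x == 0 then 0 else p%:R ^ (- vp x).

(* a + p^n Z_p *)
Definition pcoset (an : Qp hp * nat) : set (Qp hp) :=
  [set an.1 + p%:R ^+ an.2 * z | z in Zpset].
End Padic.

(* the p-adic topology, generated by the cosets a + p^n Z_p, and its Borel
   sigma-algebra *)
HB.instance Definition _ (p : nat) (hp : prime p) :=
  isSubBaseTopological.Build (Qp hp) setT (@pcoset p hp).

HB.instance Definition _ (p : nat) (hp : prime p) :=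
  Measurable.copy (Qp hp) (g_sigma_algebraType (@open (Qp hp))).

(* Finiteness on compact sets and regularity follow from the two conditions. *)
Definition is_haar (R : realType) (p : nat) (hp : prime p)
    (mu : {measure set (Qp hp) -> \bar R}) : Prop :=
  (forall (a : Qp hp) (A : set (Qp hp)), measurable A ->
     mu [set a + x | x in A] = mu A) /\
  mu (@Zpset p hp) = 1%E.

Section ComplexIntegral.
Context d (T : measurableType d) (R : realType).
Variables (mu : {measure set T -> \bar R}) (A : set T).

Definition cmeasurable (f : T -> R[i]) : Prop :=
  measurable_fun A (fun x => complex.Re (f x)) /\
  measurable_fun A (fun x => complex.Im (f x)).

Definition cintegrable (f : T -> R[i]) : Prop :=
  mu.-integrable A (fun x => (complex.Re (f x))%:E) /\
  mu.-integrable A (fun x => (complex.Im (f x))%:E).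

Definition cintegral (f : T -> R[i]) : R[i] :=
  Complex (\int[mu]_(x in A) complex.Re (f x)) (\int[mu]_(x in A) complex.Im (f x)).
End ComplexIntegral.

Section Characters.
Variables (R : realType) (p : nat) (hp : prime p).

(* Characters of Z_p^*, extended by 0 to Q_p so that distinct characters are
   distinct functions. *)
Definition is_character (chi : Qp hp -> R[i]) : Prop :=
  [/\ forall u, ~ Zpunits u -> chi u = 0,
      forall u v, Zpunits u -> Zpunits v -> chi (u * v) = chi u * chi v,
      forall u, Zpunits u -> `|chi u| = 1 &
      {within @Zpunits p hp, continuous (chi : Qp hp -> R[i]^o)}].

Definition trivial_on (chi : Qp hp -> R[i]) (n : nat) : Prop :=
  forall u, pcoset (1, n) u -> chi u = 1.

Definition has_conductor (chi : Qp hp -> R[i]) (n : nat) : Prop :=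
  if n is 0 then forall u, Zpunits u -> chi u = 1
  else [/\ ~ (forall u, Zpunits u -> chi u = 1), trivial_on chi n &
           forall k, (0 < k < n)%N -> ~ trivial_on chi k].
End Characters.

Section TateOperator.
Variables (R : realType) (p : nat) (hp : prime p).
Variables (mu : {measure set (Qp hp) -> \bar R}) (m : nat).
Local Notation fn := (Qp hp -> R[i]).
Local Notation P := (p%:R : R).

Definition F : set (Qp hp) := \bigcup_(k in `I_m) psphere k%:Z.

Definition Dkernel (u : fn) (x z : Qp hp) : R[i] :=
  (u z - u x) / (pabs R (z - x) ^+ 2)%:C.

Definition Dop (u : fn) (x : Qp hp) : R[i] :=
  (pabs R x)%:C * cintegral mu F (Dkernel u x).

Definition Fint (f : fn) : R[i] :=
  cintegral mu F (fun x => f x / (pabs R x)%:C).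

Definition inner (f g : fn) : R[i] := Fint (fun x => f x * Num.conj (g x)).

Definition L2F (u : fn) : Prop :=
  cmeasurable F u /\
  (\int[mu]_(x in F) (complex.Re (`|u x| ^+ 2) / pabs R x)%:E < +oo)%E.

Definition eqF (u v : fn) : Prop := {ae mu, forall x, F x -> u x = v x}.

Definition locally_constant (phi : fn) : Prop :=
  forall x, F x -> \forall y \near x, phi y = phi x.

(* The graph of D as an unbounded operator on L^2(F, dx/|x|_p), with its
   maximal domain: f = D u when this holds in the sense of distributions,
   i.e. against all locally constant functions on F.  Since D is symmetric
   on those, this is the adjoint of D restricted to them.  (An almost
   everywhere pointwise equation would be too weak: differences of Green's
   functions satisfy D u = 0 almost everywhere.) *)
Definition DL2 (u f : fn) : Prop :=
  [/\ L2F u, L2F f &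
      forall phi, locally_constant phi -> inner u (Dop phi) = inner f phi].

Definition is_eigenfunction (lam : R[i]) (u : fn) : Prop :=
  DL2 u (fun x => lam * u x) /\ ~ eqF u (fun=> 0).

Definition is_eigenvalue (lam : R[i]) : Prop :=
  exists u, is_eigenfunction lam u.

Definition Pmx : 'M[R]_m :=
  \matrix_(i < m, j < m) P ^- `|(i : nat)%:Z - (j : nat)%:Z|%N.

Definition Lmx : 'M[R]_m := diag_mx (Pmx *m (const_mx 1 : 'cV_m))^T - Pmx.

Definition Rmx : 'M[R]_m := - (1 - P^-1) *: Lmx.

Definition bdry (l : nat) : R := P ^- l + P ^ (l%:Z + 1 - m%:Z).

(* used for 0 < n only *)
Definition lambda (n l : nat) : R :=
  - P ^ (n%:Z - 1) - P ^ (n%:Z - 2) + bdry l / P.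

(* number of characters of conductor n, for 0 < n *)
Definition mult (n : nat) : nat :=
  if n == 1 then (p - 2)%N else ((p - 1) ^ 2 * p ^ (n - 2))%N.

Definition phi0 (Q : 'M[R]_m) (l : 'I_m) : fn :=
  fun x => (\sum_(k < m) Q k l * \1_(psphere (k : nat)%:Z) x)%:C.

Definition phichi (chi : fn) (l : nat) : fn :=
  fun x => chi (p%:R ^- l * x) * (\1_(psphere l%:Z) x)%:C.

Definition listed (Q : 'M[R]_m) (lam0 : 'rV[R]_m) (lam : R[i]) (f : fn) : Prop :=
  (exists l : 'I_m, lam = (lam0 0 l)%:C /\ f = phi0 Q l) \/
  (exists (n : nat) (l : 'I_m) (chi : fn),
     [/\ (0 < n)%N, is_character chi, has_conductor chi n,
         lam = (lambda n l)%:C & f = phichi chi l]).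

Definition Fvol : R := m%:R * (1 - P^-1).

Definition pdist (x y : Qp hp) : R :=
  pabs R (x - y) / Num.max (pabs R x) (pabs R y).

(* D_x G(x, y) = delta_y(x) - 1/V in the sense of distributions, where delta_y
   is the Dirac mass with respect to dx/|x|_p.  Continuity off y selects the
   values of the function G(., y), which the equation only determines up to
   null sets. *)
Definition is_green (G : Qp hp -> Qp hp -> R[i]) : Prop :=
  forall y, F y ->
  [/\ L2F (G^~ y),
      forall x, F x -> x != y -> {for x, continuous (G^~ y : Qp hp -> R[i]^o)} &
      forall phi, locally_constant phi ->
        Fint (fun x => G x y * Dop phi x) = phi y - (Fvol^-1)%:C * Fint phi].

Definition green_formula (Q : 'M[R]_m) (lam0 : 'rV[R]_m) (l : 'I_m) (M : nat) : R :=
  P ^+ M.+1 / (P ^+ M.+1 + P ^+ M - bdry l)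
  - \sum_(1 <= n < M.+1) (P - 1) * P ^+ n / (P ^+ n + P ^+ n.-1 - bdry l)
  + \sum_(k < m | (0 < k)%N) Q l k * Q l k / ((1 - P^-1) * lam0 0 k).
End TateOperator.

(* Main.v *)
(* F is the disjoint union of the balls p^k (a + p^N Z_p), a ranging over the units
   modulo p^N, and a locally constant function is constant on the balls of some
   level N because F is compact.  On such functions D is a finite sum over balls,
   and the listed functions diagonalize it: the phi_0^l by the choice of Q, and the
   phi_chi by a layer-cake expansion of |z - x|^-2, in which the sum of chi over a
   coset of 1 + p^k Z_p vanishes for k below the conductor.  The characters of the
   finite group (Z/p^N)^* span all functions on it, so the listed functions span
   level N.

   If D u = lam u weakly, symmetry of D shows that the average of u over the balls of
   level N solves the same equation pointwise.  Since lambda_n tends to -oo, the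
   averages no longer change once N is large, hence u is locally constant, and it is a
   combination of listed functions with eigenvalue lam.

   The Green function with pole y is a combination of the phi_0^k minus
   sum_k d_k 1_{B_k}, where B_k are the balls around y inside its sphere and
   d_k = p^k (1/lambda_{k+1} - 1/lambda_k); the tail of the series has integral
   -p^-l/lambda_N by telescoping, which gives the weak equation against every listed
   function.  Two Green functions differ by a weak solution of D w = 0, that is, by a
   constant, and summation by parts turns the d_k into the stated formula. *)
Require Import Defs.
From mathcomp Require Import all_field.
From mathcomp Require Import all_boot all_order all_algebra.
From mathcomp Require Import all_classical all_reals all_analysis.
From mathcomp Require Import measurable_realfun fraction complex.
From mathcomp Require Import all_fingroup finmap.
From mathcomp Require Import zify ring lra.
Import Order.TTheory GRing.Theory Num.Theory.
Import numFieldNormedType.Exports.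

Set Implicit Arguments.
Unset Strict Implicit.
Unset Printing Implicit Defensive.

Local Open Scope classical_set_scope.
Local Open Scope complex_scope.
Local Open Scope card_scope.
Local Open Scope ring_scope.

(** * p-adic numbers *)

(** The coefficients d_k come from inverting D on the sphere of the pole. For k >= 1 let E_k be the
    averaging over balls of level k; with respect to dx/|x|_p its kernel is p^k 1_{B_k}. Let E_0 be
    the averaging over the sphere, with kernel 1_sphere / (1 - 1/p). The phi_chi of conductor n on
    this sphere span the range of E_n - E_{n-1}, so the inverse should be sum_n (E_n - E_{n-1}) /
    lambda_n, and Abel summation turns this into -E_0 / lambda_1 - sum_k d_k 1_{B_k}. This series is
    the only place where convergence is at stake: its coefficients are non-negative, so it can be
    integrated term by term. Elsewhere D acts through finite symmetric matrices, because it
    preserves each level; moving it onto the average of an arbitrary u replaces a weak equation by a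
    sequence of matrix equations. *)

Section PadicIntegers.
Variables (p : nat) (hp : prime p).
Local Notation Z := (padic_int hp).
Local Notation q n := ((p ^ n)%N%:Z).

Lemma zpres0n n : zpres (0 : Z) n = 0.
Proof. by rewrite /= mod0z. Qed.

Lemma zpresD (x y : Z) n : zpres (x + y) n = ((zpres x n + zpres y n) %% q n)%Z.
Proof. by []. Qed.

Lemma zpresM (x y : Z) n : zpres (x * y) n = ((zpres x n * zpres y n) %% q n)%Z.
Proof. by []. Qed.

Lemma zpresN (x : Z) n : zpres (- x) n = ((- zpres x n) %% q n)%Z.
Proof. by []. Qed.

Lemma zpres_nat (a n : nat) : zpres (a%:R : Z) n = (a%:Z %% q n)%Z.
Proof.
elim: a => [|a IHa]; first by rewrite zpres0n mod0z.
by rewrite -addn1 natrD zpresD IHa /= modzDm PoszD.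
Qed.

Lemma zpres_exp_p k n : zpres (p%:R ^+ k : Z) n = (q k %% q n)%Z.
Proof. by rewrite -natrX zpres_nat. Qed.

Lemma zpres_x0 (x : Z) : zpres x 0 = 0.
Proof. by rewrite -zpres_mod expn0 modz1. Qed.

Lemma dvdz_zpres (x : Z) n : (p%:Z %| zpres x n.+1)%Z = (p%:Z %| zpres x 1)%Z.
Proof.
rewrite -(zpres_le x 1 n) expn1 add1n.
by apply/dvdz_mod0P/dvdz_mod0P; rewrite modz_mod.
Qed.

(** Bezout inverts each residue separately; cancelling a residue prime to p shows that these
    inverses are compatible, so together they define a p-adic integer. *)
Lemma zp_unitE (x : Z) : (x \is a GRing.unit) = ~~ (p%:Z %| zpres x 1)%Z.
Proof.
apply/idP/idP => [/mulVr/(congr1 (fun z => zpres z 1%N)) /=|px].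
  rewrite expn1 => h; apply/negP => /dvdz_mod0P px0.
  by move: h; rewrite -modzMmr px0 mulr0 mod0z modz_small // ltz_nat prime_gt1.
have cop n : (0 < n)%N -> coprimez (q n) (zpres x n).
  case: n => // n _; rewrite /coprimez /gcdz eqz_nat -/(coprime _ _) absz_nat.
  by rewrite coprimeXl // prime_coprime //; move: px; rewrite -(dvdz_zpres x n) dvdzE.
have hex n : exists f : int, (f * zpres x n = 1 %[mod q n])%Z.
  case: n => [|n]; first by exists 0; rewrite expn0 !modz1.
  have /coprimezP[[u v] /= uv] := cop n.+1 isT.
  by exists v; rewrite -uv modzMDl.
have /choice[f hf] := hex.
have fS n : (f n.+1 = f n %[mod q n])%Z.
  case: n => [|n]; first by rewrite expn0 !modz1.
  have h1 : (f n.+2 * zpres x n.+1 = 1 %[mod q n.+1])%Z.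
    by rewrite -modzMmr -(zp_coh x) modzMmr -modz_pS hf modz_pS.
  have /eqP := etrans h1 (esym (hf n.+1)).
  rewrite eqz_mod_dvd -mulrBl Gauss_dvdzl; last exact: cop.
  by rewrite -eqz_mod_dvd => /eqP.
apply/asboolP; exists (zpmk hp fS); apply: zpinj => n.
by rewrite zpresM /= modzMml hf.
Qed.

(** The n-th residue of the quotient is read off the residue of x modulo p^(n+k): division by p^k
    costs k digits of precision. *)
Lemma zp_dvd_exp (x : Z) k : zpres x k = 0 -> exists z, x = p%:R ^+ k * z.
Proof.
move=> xk0; have q0 n : q n != 0 by rewrite eqz_nat -lt0n expn_gt0 prime_gt0.
have dv n : (q k %| zpres x (n + k))%Z.
  by apply/dvdz_mod0P; rewrite addnC zpres_le.
have zS n : ((zpres x (n.+1 + k) %/ q k)%Z = (zpres x (n + k) %/ q k)%Z %[mod q n])%Z.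
  have qq : q k * q n = q (n + k) by rewrite -PoszM -expnD addnC.
  apply/eqP; rewrite eqz_mod_dvd -(@dvdz_mul2l (q k)) ?q0 // mulrBr.
  rewrite ![q k * (_ %/ _)%Z]mulrC !divzK // qq -eqz_mod_dvd addSn.
  exact/eqP/zp_coh.
exists (zpmk hp zS); apply: zpinj => n.
rewrite zpresM zpres_exp_p modzMml /= modzMmr mulrC divzK //.
by rewrite zpres_le.
Qed.

Lemma zpres_expM (z : Z) k : zpres (p%:R ^+ k * z) k = 0.
Proof. by rewrite zpresM zpres_exp_p modzz mul0r mod0z. Qed.

Lemma zp_p_neq0 : p%:R != 0 :> Z.
Proof.
apply/eqP => /(congr1 (fun z : Z => zpres z 2)); rewrite zpres_nat zpres0n.
rewrite modz_small; first by move=> /eqP; rewrite eqz_nat eqn0Ngt prime_gt0.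
by rewrite ltz_nat /= -[ltnLHS]expn1 ltn_exp2l ?prime_gt1.
Qed.

Lemma zp_decomp (x : Z) : x != 0 ->
  exists k, exists2 u : Z, u \is a GRing.unit & x = p%:R ^+ k * u.
Proof.
move=> x0; have hex : exists n, zpres x n != 0.
  apply: contraNP x0 => /forallNP h; apply/eqP/zpinj => n.
  by rewrite zpres0n; apply/eqP; have /negP := h n; rewrite negbK.
case: (ex_minnP hex) => [[|k]]; rewrite ?zpres_x0 // => xk hmin.
have xk0 : zpres x k = 0.
  by apply/eqP; apply: contraTT (ltnSn k) => /hmin; rewrite -leqNgt.
have [u xu] := zp_dvd_exp xk0; exists k, u => //.
rewrite zp_unitE; apply: contra xk => /dvdz_mod0P.
have -> : (zpres u 1 %% p)%Z = zpres u 1 by rewrite -[RHS]zpres_mod expn1.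
move=> /zp_dvd_exp[w uw].
by rewrite xu uw mulrA -exprD addn1 zpres_expM.
Qed.

Lemma zp_unit_addM (u w : Z) k : u \is a GRing.unit -> (0 < k)%N ->
  u + p%:R ^+ k * w \is a GRing.unit.
Proof.
case: k => // k; rewrite !zp_unitE => hu _; apply: contra hu => /dvdz_mod0P.
rewrite zpresD zpresM zpres_exp_p expn1 modz_mod -modzDmr modz_mod modzMml.
by rewrite expnSr PoszM mulrAC modzMl addr0 => h; apply/dvdz_mod0P.
Qed.

Lemma zp_p_nunit k (w : Z) : (0 < k)%N -> p%:R ^+ k * w \isn't a GRing.unit.
Proof.
case: k => // k _; rewrite zp_unitE negbK; apply/dvdz_mod0P.
by rewrite zpresM zpres_exp_p expn1 modz_mod modzMml expnSr PoszM mulrAC modzMl.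
Qed.

End PadicIntegers.

Section Fractions.
Import FracField.
Lemma fraction_decomp (A : idomainType) (x : {fraction A}) :
  exists2 a : A * A, a.2 != 0 & x = tofrac a.1 / tofrac a.2.
Proof.
elim/quotW: x => -[[n d] /= d0]; exists (n, d) => //=.
unlock tofrac; rewrite -[X in _ = _ * X]pi_inv -[RHS]pi_mul.
apply/eqmodP; rewrite /= equivfE /mulf /invf /=.
by rewrite !numden_Ratio ?mulr1 ?mul1r ?oner_neq0 //= mulrC.
Qed.
End Fractions.

Section PadicNumbers.
Variables (p : nat) (hp : prime p).
Local Notation Z := (padic_int hp).
Local Notation K := (Qp hp).
Local Notation iota := (@FracField.tofrac (padic_int hp) : padic_int hp -> Qp hp).

Lemma iota_p k : iota (p%:R ^+ k) = p%:R ^+ k.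
Proof. by rewrite rmorphXn rmorph_nat. Qed.

Lemma qp_p_neq0 : p%:R != 0 :> K.
Proof. by rewrite -(rmorph_nat (@FracField.tofrac Z)) tofrac_eq0 zp_p_neq0. Qed.

Lemma iota_unit_neq0 (u : Z) : u \is a GRing.unit -> iota u != 0.
Proof. by move=> uu; rewrite tofrac_eq0; apply: contraTneq uu => ->; rewrite unitr0. Qed.

Lemma qp_decomp (x : K) : x != 0 ->
  exists k : int, exists2 u : Z, u \is a GRing.unit & x = p%:R ^ k * iota u.
Proof.
move=> x0; have [[a b] /= b0 xab] := fraction_decomp x.
have a0 : a != 0 by apply: contra_neq x0 => a0; rewrite xab a0 tofrac0 mul0r.
have [i [u uu au]] := zp_decomp a0; have [j [v uv bv]] := zp_decomp b0.
exists (i%:Z - j%:Z), (u / v); first by rewrite unitrM unitrV uu.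
rewrite expfzDr ?qp_p_neq0 // -exprz_inv -!exprnP xab au bv !rmorphM /= rmorphV //.
by rewrite -!/(iota _) !iota_p invfM mulrACA exprVn.
Qed.

Lemma psphereP (k : int) (x : K) :
  psphere k x <-> exists2 u : Z, u \is a GRing.unit & x = p%:R ^ k * iota u.
Proof.
split=> [[_ [u uu <-] <-]|[u uu ->]]; first by exists u.
by exists (iota u) => //; exists u.
Qed.

Lemma psphere_uniq (k l : int) (x : K) : psphere k x -> psphere l x -> k = l.
Proof.
move=> /psphereP[u uu xu] /psphereP[v uv xv].
wlog kl : k l u v uu uv xu xv / k <= l => [h|].
  have [kl|/ltW lk] := leP k l; first exact: (h k l u v).
  exact/esym/(h l k v u).
apply/eqP; move: kl; rewrite le_eqVlt => /orP[//|]; rewrite -subr_gt0 => kl.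
have : u = p%:R ^+ `|l - k|%N * v.
  apply/eqP; rewrite -tofrac_eq rmorphM /= -/(iota _) iota_p; apply/eqP.
  apply: (mulfI (x := (p%:R : K) ^ k)); first by rewrite expfz_neq0 ?qp_p_neq0.
  rewrite -xu xv mulrA exprnP gtz0_abs // -expfzDr ?qp_p_neq0 //.
  by rewrite [k + _]addrC subrK.
move=> uE; move: uu; rewrite uE (negPf (zp_p_nunit _ _)) //.
by rewrite absz_gt0 gt_eqF.
Qed.

Lemma vp_psphere (k : int) (x : K) : psphere k x -> vp x = k.
Proof.
move=> kx; apply: (psphere_uniq _ kx).
exact: (@xgetPex _ 0 [set k | psphere k x] (ex_intro _ k kx)).
Qed.

Lemma psphere_neq0 (k : int) (x : K) : psphere k x -> x != 0.
Proof.
by move=> /psphereP[u uu ->]; rewrite mulf_neq0 ?expfz_neq0 ?qp_p_neq0 ?iota_unit_neq0.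
Qed.

Lemma psphere_vp (x : K) : x != 0 -> psphere (vp x) x.
Proof.
move=> /qp_decomp[k [u uu xu]].
by rewrite (vp_psphere (k := k)); apply/psphereP; exists u.
Qed.

Lemma pabs_psphere (R : realType) (k : int) (x : K) : psphere k x ->
  pabs R x = p%:R ^ (- k).
Proof. by move=> kx; rewrite /pabs (negPf (psphere_neq0 kx)) (vp_psphere kx). Qed.

Lemma pabs_gt0 (R : realType) (x : K) : x != 0 -> 0 < pabs R x.
Proof. by move=> x0; rewrite /pabs (negPf x0) exprz_gt0 // ltr0n prime_gt0. Qed.

Lemma pabs0 (R : realType) : pabs R (0 : K) = 0.
Proof. by rewrite /pabs eqxx. Qed.

Lemma psphereN (k : int) (x : K) : psphere k x -> psphere k (- x).
Proof.
move=> /psphereP[u uu ->]; apply/psphereP; exists (- u); rewrite ?unitrN //.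
by rewrite rmorphN mulrN.
Qed.

Lemma psphereM (k l : int) (x y : K) : psphere k x -> psphere l y -> psphere (k + l) (x * y).
Proof.
move=> /psphereP[u uu ->] /psphereP[v uv ->]; apply/psphereP.
by exists (u * v); rewrite ?unitrM ?uu // rmorphM mulrACA expfzDr ?qp_p_neq0.
Qed.

Lemma pcosetP (a x : K) n : pcoset (a, n) x <-> exists z : Z, x = a + p%:R ^+ n * iota z.
Proof. by split=> [[_ [z _ <-] <-]|[z ->]]; [exists z|exists (iota z) => //; exists z]. Qed.

Lemma pcoset_refl (a : K) n : pcoset (a, n) a.
Proof. by apply/pcosetP; exists 0; rewrite rmorph0 mulr0 addr0. Qed.

Lemma pcoset_eq (a b : K) n : pcoset (a, n) b -> pcoset (a, n) = pcoset (b, n).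
Proof.
move=> /pcosetP[z ->]; apply/seteqP; split=> x /pcosetP[w ->]; apply/pcosetP.
  by exists (w - z); rewrite rmorphB mulrBr -addrA (addrC (_ * iota z)) subrK.
by exists (z + w); rewrite rmorphD mulrDr addrA.
Qed.

Lemma pcoset_sym (a b : K) n : pcoset (a, n) b -> pcoset (b, n) a.
Proof. by move=> /pcoset_eq <-; exact: pcoset_refl. Qed.

Lemma pcoset_le (a : K) m n : (m <= n)%N -> pcoset (a, n) `<=` pcoset (a, m).
Proof.
move=> mn x /pcosetP[z ->]; apply/pcosetP; exists (p%:R ^+ (n - m) * z).
by rewrite rmorphM /= -/(iota _) iota_p mulrA -exprD subnKC.
Qed.

Lemma pcoset_psphere (k : nat) (a x : K) n : (k < n)%N -> psphere k%:Z a ->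
  pcoset (a, n) x -> psphere k%:Z x.
Proof.
move=> kn /psphereP[u uu ->] /pcosetP[z ->]; apply/psphereP.
exists (u + p%:R ^+ (n - k) * z); first by rewrite zp_unit_addM ?subn_gt0.
by rewrite rmorphD rmorphM /= -/(iota _) iota_p mulrDr -exprnP mulrA -exprD subnKC // ltnW.
Qed.

Lemma pcosetB (x y : K) n (k : int) : psphere k (x - y) -> pcoset (y, n) x <-> n%:Z <= k.
Proof.
move=> kxy; split=> [/pcosetP[z xz]|nk]; last first.
  move: kxy => /psphereP[u uu xu]; apply/pcosetP; exists (p%:R ^+ `|k - n%:Z|%N * u).
  rewrite rmorphM /= -/(iota _) iota_p mulrA !exprnP gez0_abs ?subr_ge0 //.
  by rewrite -expfzDr ?qp_p_neq0 // (addrC n%:Z) subrK -xu addrC subrK.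
have z0 : z != 0.
  apply: contraPneq kxy => z0 /psphere_neq0/eqP; apply.
  by rewrite xz z0 rmorph0 mulr0 addr0 subrr.
have [j [u uu zu]] := zp_decomp z0.
rewrite (@psphere_uniq k (n + j)%N%:Z (x - y)) ?lez_nat ?leq_addr //.
apply/psphereP; exists u => //.
by rewrite xz zu rmorphM /= -/(iota _) iota_p mulrA -exprD addrC addKr.
Qed.

(** Ultrametric inequality: seen from a point outside a ball, all points of the ball are equally
    far. This makes the kernel of D constant on balls away from the diagonal. *)
Lemma pabs_pcoset (R : realType) (x z z' : K) n : pcoset (z, n) z' -> ~ pcoset (z, n) x ->
  pabs R (z' - x) = pabs R (z - x).
Proof.
move=> zz' zx; have zx0 : z - x != 0.
  by apply: contra_not_neq zx => /eqP; rewrite subr_eq0 => /eqP ->; exact: pcoset_refl.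
have sp := psphere_vp zx0; set k := vp _ in sp.
rewrite (pabs_psphere R sp) (@pabs_psphere R k (z' - x)) //.
have kn : k < n%:Z.
  by rewrite ltNge; apply/negP => /(pcosetB _ sp) /pcoset_sym.
move: zz' => /pcosetP[w ->]; move: sp => /psphereP[u uu zu]; apply/psphereP.
exists (u + p%:R ^+ `|n%:Z - k|%N * w).
  by rewrite zp_unit_addM // absz_gt0 subr_eq0 gt_eqF.
rewrite rmorphD rmorphM /= -/(iota _) iota_p mulrDr !exprnP mulrA gez0_abs; last first.
  by rewrite subr_ge0 ltW.
by rewrite -expfzDr ?qp_p_neq0 // (addrC k) subrK -zu addrAC.
Qed.

End PadicNumbers.

(** * The p-adic topology and its cosets *)

Section PadicTopology.
Variables (p : nat) (hp : prime p).
Local Notation Z := (padic_int hp).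
Local Notation K := (Qp hp).

(** Cosets through x are nested, so a finite intersection of subbasic sets around x contains the
    coset of x with the largest exponent involved. *)
Lemma nbhs_pcosetP (x : K) (A : set K) :
  nbhs x A <-> exists n, pcoset (x, n) `<=` A.
Proof.
split; rewrite nbhsE.
  move=> [B [[D' sD' eB] Bx] BA]; move: Bx; rewrite -eB => -[S D'S Sx].
  have [E _ eS] : finI_from setT (@pcoset p hp) S := sD' _ D'S.
  have xE i : i \in E -> pcoset i x.
    move=> iE; have : (\bigcap_(j in [set` E]) @pcoset p hp j) x by rewrite eS.
    by move=> /(_ i iE).
  exists (\max_(i <- enum_fset E) i.2)%N => y xy; apply: BA; rewrite -eB; exists S => //.
  have : (\bigcap_(j in [set` E]) @pcoset p hp j) y; last by rewrite eS.
  move=> i iE; have := xE i iE; case: i iE => a n iE /pcoset_eq ->.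
  apply: pcoset_le xy; exact: (@leq_bigmax_seq (K * nat)%type (enum_fset E) xpredT
    (fun i => i.2) (a, n)).
move=> [n nA]; exists (pcoset (x, n)) => //; split; last exact: pcoset_refl.
exists [set pcoset (x, n)]; last by rewrite bigcup_set1.
move=> _ ->; apply: (@finI_from1 _ _ setT (@pcoset p hp) (x, n)) => //.
Qed.

Lemma nbhs_pcoset (x : K) n : nbhs x (pcoset (x, n)).
Proof. by apply/nbhs_pcosetP; exists n. Qed.

Lemma open_pcoset (a : K) n : open (pcoset (a, n)).
Proof.
by rewrite openE => x /pcoset_eq ->; exact: nbhs_pcoset.
Qed.

Lemma measurable_open (A : set K) : open A -> measurable A.
Proof. exact: sub_sigma_algebra. Qed.

Lemma measurable_pcoset (a : K) n : measurable (pcoset (a, n)).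
Proof. by apply: (@measurable_open (pcoset (a, n))); exact: open_pcoset. Qed.

Lemma pcoset_split (a x : K) n : pcoset (a, n) x <->
  exists2 i : nat, (i < p)%N & pcoset (a + p%:R ^+ n * i%:R, n.+1) x.
Proof.
split=> [/pcosetP[z ->]|[i ip /pcosetP[z ->]]].
  have zp : (0 <= zpres z 1 < p%:Z).
    by rewrite -zpres_mod expn1 modz_ge0 ?ltz_pmod ?ltz_nat ?eqz_nat -?lt0n ?prime_gt0.
  have [|w zw] := @zp_dvd_exp p hp (z - (`|zpres z 1|%N)%:R) 1.
    rewrite zpresD zpresN zpres_nat modzDmr -modzDmr modzNm modzDmr gez0_abs; last by case/andP: zp.
    by rewrite subrr mod0z.
  exists `|zpres z 1|%N; first by rewrite -ltz_nat gez0_abs; case/andP: zp.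
  apply/pcosetP; exists w; rewrite -[in LHS](subrK (`|zpres z 1|%N)%:R z) zw.
  by rewrite rmorphD rmorphM /= expr1 !rmorph_nat exprSr mulrDr mulrA addrA addrAC.
apply/pcosetP; exists (i%:R + p%:R * z).
by rewrite rmorphD rmorphM /= !rmorph_nat exprSr mulrDr mulrA addrA.
Qed.

Lemma pcoset_split_disjoint (a x : K) n (i j : nat) : (i < p)%N -> (j < p)%N ->
  pcoset (a + p%:R ^+ n * i%:R, n.+1) x -> pcoset (a + p%:R ^+ n * j%:R, n.+1) x -> i = j.
Proof.
move=> ip jp /pcosetP[z ->] /pcosetP[w].
rewrite exprSr -!addrA => /addrI; rewrite -!mulrA -!mulrDr => /mulfI.
move=> /(_ (expf_neq0 _ (qp_p_neq0 hp))) h.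
have : i%:R + p%:R * z = j%:R + p%:R * w :> Z.
  apply/eqP; rewrite -tofrac_eq !rmorphD !rmorphM /= !rmorph_nat; exact/eqP.
move=> /(congr1 (fun t => zpres t 1)).
rewrite -(expr1 p%:R) !zpresD !zpresM !zpres_exp_p !zpres_nat expn1 modzz !mul0r mod0z !addr0.
by rewrite !modz_mod !modz_small // => -[].
Qed.

End PadicTopology.

(** * Haar measure of balls *)

Section Haar.
Variables (R : realType) (p : nat) (hp : prime p).
Variables (mu : {measure set (Qp hp) -> \bar R}) (hmu : is_haar mu).
Local Notation K := (Qp hp).
Local Notation P := (p%:R : R).

Lemma p_gt0 : 0 < P. Proof. by rewrite ltr0n prime_gt0. Qed.
Lemma p_neq0 : P != 0. Proof. by rewrite gt_eqF ?p_gt0. Qed.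
Lemma p_gt1 : 1 < P. Proof. by rewrite ltr1n prime_gt1. Qed.
Lemma p_ge2 : 2 <= P. Proof. by rewrite ler_nat prime_gt1. Qed.

Lemma haar_pcoset0 (a : K) n : mu (pcoset (a, n)) = mu (pcoset (0, n)).
Proof.
rewrite -[RHS](hmu.1 a); last exact: measurable_pcoset.
congr (mu _); apply/seteqP; split=> x.
  by move=> /pcosetP[z ->]; exists (p%:R ^+ n * FracField.tofrac z) => //; apply/pcosetP;
    exists z; rewrite add0r.
by move=> [y /pcosetP[z ->] <-]; apply/pcosetP; exists z; rewrite add0r.
Qed.

(** A coset of p^n Z_p is the disjoint union of p translates of p^(n+1) Z_p, so translation
    invariance divides the volume by p at each level. *)
Lemma haar_pcoset (a : K) n : mu (pcoset (a, n)) = (P ^- n)%:E.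
Proof.
rewrite haar_pcoset0; elim: n => [|n IHn].
  rewrite expr0 invr1 -hmu.2; congr (mu _); apply/seteqP; split=> x.
    by move=> /pcosetP[z ->]; exists z => //; rewrite add0r expr0 mul1r.
  by move=> [z _ <-]; apply/pcosetP; exists z; rewrite add0r expr0 mul1r.
have hU : pcoset (0 : K, n) =
    \big[setU/set0]_(i < p) pcoset ((0 : K) + p%:R ^+ n * (i : nat)%:R, n.+1).
  rewrite -(bigcup_mkord p (fun i => pcoset ((0 : K) + p%:R ^+ n * i%:R, n.+1))).
  apply/seteqP; split=> x.
    by move=> /pcoset_split[i ip ix]; exists i.
  by move=> [i ip ix]; apply/pcoset_split; exists i.
have := IHn; rewrite hU measure_bigsetU_ord //; first last.
- move=> i j _ _ [x [xi xj]]; apply/val_inj.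
  exact: (pcoset_split_disjoint (ltn_ord i) (ltn_ord j) xi xj).
- by move=> i; exact: measurable_pcoset.
have ->: \sum_(i < p) mu (pcoset ((0 : K) + p%:R ^+ n * (i : nat)%:R,
  n.+1)) = \sum_(i < p) mu (pcoset ((0 : K) , n.+1)).
  apply: eq_bigr => i _. 
  exact: haar_pcoset0.
have sumc (x : \bar R) : \sum_(i < p) x = (P%:E * x)%E.
  transitivity ((\sum_(i < p) 1%:E) * x)%E; last by rewrite sumEFin sumr_const card_ord.
  by rewrite ge0_sume_distrl //; apply: eq_bigr => i _; rewrite mul1e.
rewrite sumc => h.
have p0 := p_neq0; have pe : ((P^-1)%:E * (P%:E * mu (pcoset (0%R : K, n.+1))) = (P ^- n.+1)%:E)%E.
  by rewrite h -EFinM exprS invfM.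
by rewrite -pe muleA -EFinM mulVf // mul1e.
Qed.

Lemma mu_pcoset_gt0 (a : K) n : (0 < mu (pcoset (a, n)))%E.
Proof. by rewrite haar_pcoset lte_fin invr_gt0 exprn_gt0 ?p_gt0. Qed.

End Haar.

(** * Characters of a finite abelian group *)

Section FiniteAbelianDual.
Variables (gT : finGroupType) (C : numClosedFieldType).
Hypothesis abel : forall g h : gT, (g * h = h * g)%g.

Definition multiplicative_fun (f : gT -> C) :=
  f 1%g = 1 /\ forall g h, f (g * h)%g = f g * f h.

Lemma mfun_neq0 f g : multiplicative_fun f -> f g != 0.
Proof.
move=> [f1 fM]; apply: contra_eq_neq f1 => fg0.
by rewrite -(mulgV g) fM fg0 mul0r eq_sym oner_neq0.
Qed.

Lemma mfunV f g : multiplicative_fun f -> f g^-1%g = (f g)^-1.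
Proof.
move=> mf; apply: (mulfI (mfun_neq0 g mf)).
by rewrite -mf.2 mulgV mf.1 divff ?mfun_neq0.
Qed.

Lemma mfun_norm f g : multiplicative_fun f -> `|f g| = 1.
Proof.
move=> mf; have fX k : f (g ^+ k)%g = f g ^+ k.
  elim: k => [|k IHk]; first by rewrite expg0 mf.1.
  by rewrite expgS mf.2 IHk exprS.
have : `|f g| ^+ #[g]%g = 1 by rewrite -normrX -fX expg_order mf.1 normr1.
by move/eqP; rewrite pexpr_eq1 ?order_gt0 // => /eqP.
Qed.

Lemma mfun_sum0 f g : multiplicative_fun f -> f g != 1 -> \sum_h f h = 0.
Proof.
move=> mf fg; apply/eqP; have : f g * (\sum_h f h) = \sum_h f h.
  rewrite mulr_sumr [RHS](reindex_inj (mulgI g)).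
  by apply: eq_bigr => h _; rewrite mf.2.
move/eqP; rewrite -subr_eq0 -{2}[\sum_h _]mul1r -mulrBl mulf_eq0 subr_eq0.
by rewrite (negPf fg).
Qed.

Lemma mfun_ortho f f' : multiplicative_fun f -> multiplicative_fun f' ->
  \sum_g f g * f' g^-1%g = if `[< f =1 f' >] then #|gT|%:R else 0.
Proof.
move=> mf mf'; case: asboolP => [ff'|nff'].
  under eq_bigr => g _ do rewrite ff' -mf'.2 mulgV mf'.1.
  by rewrite sumr_const.
have mfun : multiplicative_fun (fun g => f g * f' g^-1%g).
  split=> [|g h]; first by rewrite invg1 mf.1 mf'.1 mulr1.
  by rewrite mf.2 invMg abel mf'.2 mulrACA.
have [g hg] : exists g, f g <> f' g.
  by apply: contrapT => /forallNP h; apply: nff' => g; apply: contrapT => /h.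
apply: (mfun_sum0 (g := g) mfun); apply/negP => /eqP h; apply: hg.
by move: h; rewrite (mfunV _ mf') => /(canRL (mulfVK (mfun_neq0 g mf'))); rewrite mul1r.
Qed.

Lemma diagonalizable_finite_order n (A : 'M[C]_n.+1) k :
  (0 < k)%N -> A ^+ k = 1 -> diagonalizable A.
Proof.
move=> k0 Ak; apply/diagonalizableP.
have [rs rsE] := closed_field_poly_normal ('X^k - 1%:P : {poly C}).
have l1 : lead_coef ('X^k - 1%:P : {poly C}) = 1 by rewrite lead_coefXnsubC.
rewrite l1 scale1r in rsE; exists rs.
  by rewrite -separable_prod_XsubC -rsE polyC1 separable_Xn_sub_1 // pnatr_eq0 -lt0n.
rewrite -rsE; apply: mxminpoly_min.
by rewrite rmorphB /= rmorphXn /= horner_mx_X horner_mx_C Ak subrr.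
Qed.

(* The translation matrices commute and have finite order, so they are
   simultaneously diagonalizable; the coordinate functions of a common
   eigenvector are proportional to a multiplicative function. *)
Lemma dual_basis : exists X : gT -> gT -> C,
  [/\ forall i, multiplicative_fun (X i),
      forall i j, X i =1 X j -> i = j &
      forall f : gT -> C, exists c : gT -> C, forall g, f g = \sum_i c i * X i g].
Proof.
have [n cn] : exists n, #|gT| = n.+1.
  by exists #|gT|.-1; rewrite prednK //; apply/card_gt0P; exists 1%g.
pose e (i : 'I_n.+1) : gT := enum_val (cast_ord (esym cn) i).
pose r (g : gT) : 'I_n.+1 := cast_ord cn (enum_rank g).
have eK : cancel e r by move=> i; rewrite /e /r enum_valK cast_ordKV.
have rK : cancel r e by move=> g; rewrite /e /r cast_ordK enum_rankK.
pose A (g : gT) : 'M[C]_n.+1 := \matrix_(i, j) (e j == e i * g)%g%:R.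
have rowA (v : 'rV[C]_n.+1) g j : (v *m A g) 0 j = v 0 (r (e j * g^-1)%g).
  rewrite !mxE (bigD1 (r (e j * g^-1)%g)) //= !mxE rK mulgKV eqxx mulr1.
  rewrite big1 ?addr0 // => i ij; rewrite !mxE; case: eqP => [eji|]; rewrite ?mulr0 //.
  by move: ij; rewrite eji mulgK eK eqxx.
have mulvP (M N : 'M[C]_n.+1) : (forall v : 'rV_n.+1, v *m M = v *m N) -> M = N.
  by move=> h; apply/row_matrixP => i; rewrite !rowE.
have AM g h : A g *m A h = A (g * h)%g.
  apply: mulvP => v; apply/rowP => j; rewrite mulmxA !rowA rK.
  by rewrite invMg mulgA.
have A1 : A 1%g = 1.
  by apply: mulvP => v; apply/rowP => j; rewrite rowA invg1 mulg1 eK mulmx1.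
have AX g k : A g ^+ k = A (g ^+ k)%g.
  elim: k => [|k IHk]; first by rewrite expg0 A1.
  by rewrite exprS IHk -[_ * _]/(_ *m _) AM expgS.
have codiag : codiagonalizable [seq A g | g <- enum gT].
  apply/codiagonalizableP; split=> [_ _ /mapP[g _ ->] /mapP[h _ ->]|_ /mapP[g _ ->]].
    by rewrite /comm_mx !AM abel.
  by apply: (@diagonalizable_finite_order _ _ #[g]%g); rewrite ?order_gt0 // AX expg_order A1.
have [P Punit /allP PA] := codiag.
have hP g : exists d : 'rV[C]_n.+1, P *m A g = diag_mx d *m P.
  have := PA (A g); rewrite map_f ?mem_enum // => /(_ isT) /diagonalizable_forPex[d /simmxLR dP].
  by exists d; rewrite dP // mxpoly.conjVmx // !mulmxA mulmxV // mul1mx.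
have [d dP] := choice hP.
pose v i g := P i (r g).
(* Row i of [P] is a common eigenvector: translating it by g multiplies it by [d g 0 i]. *)
have vg i g h : v i (h * g^-1)%g = d g 0 i * v i h.
  have /rowP/(_ (r h)) := congr1 (row i) (dP g).
  by rewrite row_mul rowA rK mul_diag_mx mxE /v !mxE.
(* By [vg] every coordinate of row i is a multiple of the one at 1, and an invertible matrix has no
   zero row. *)
have v1 i : v i 1%g != 0.
  apply/eqP => vi0; have : row i P = 0.
    apply/rowP => j; rewrite !mxE -[j]eK -/(v i _).
    by rewrite -[e j]mul1g -[e j]invgK vg vi0 mulr0.
  have : row_free P by rewrite row_free_unit.
  by move=> /row_free_inj inj; rewrite rowE -[RHS](mul0mx _ P) => /inj/rowP/(_ i);
    rewrite !mxE !eqxx => /eqP; rewrite oner_eq0.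
pose X (g : gT) h := v (r g) h / v (r g) 1%g.
(* Taking h = 1 in [vg] shows that the eigenvalue is itself a normalized coordinate; this is what
   makes [X] multiplicative. *)
have dX i g : d g 0 i = v i g^-1%g / v i 1%g.
  by rewrite -[g^-1%g]mul1g vg mulfK.
have XM i : multiplicative_fun (X i).
  split=> [|g h]; first by rewrite /X divff.
  by rewrite /X -[h in LHS]invgK vg dX invgK -mulrA mulrC.
exists X; split=> // [i j Xij|f].
  have : row_free P by rewrite row_free_unit.
  move=> /row_free_inj inj.
  (* Equal characters make rows [r i] and [r j] of [P] proportional, and invertibility then forces
     the indices to agree. *)
  have : (v (r j) 1%g *: delta_mx 0 (r i) : 'rV_n.+1) *m P = (v (r i) 1%g *: delta_mx 0
    (r j) : 'rV_n.+1) *m P.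
    rewrite -!scalemxAl -!rowE; apply/rowP => k; rewrite !mxE -[k]eK.
    have := Xij (e k); rewrite /X -!/(v _ _) => /(canRL (mulfVK (v1 _))) ->.
    by rewrite mulrA [v (r j) 1%g * _]mulrC divfK // mulrC.
  move=> /inj/rowP/(_ (r i)); rewrite !mxE !eqxx /= mulr1.
  case: eqP => [/(can_inj rK)//|_]; rewrite mulr0 => /eqP.
  by rewrite (negPf (v1 _)).
pose fr : 'rV[C]_n.+1 := \row_j f (e j).
exists (fun i => (fr *m invmx P) 0 (r i) * v (r i) 1%g) => g.
have -> : f g = (fr *m invmx P *m P) 0 (r g) by rewrite mulmxKV // mxE rK.
rewrite mxE (reindex r) /=; last by exists e => i _; rewrite ?eK ?rK.
by apply: eq_bigr => i _; rewrite -/(v (r i) g) /X -[in RHS]mulrA [v (r i) 1%g * _]mulrC divfK.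
Qed.

(** If f differed from every [X i] it would be orthogonal to all of them, hence to itself by
    spanning; but its pairing with itself is the order of the group. *)
Lemma dual_basis_complete (X : gT -> gT -> C) (f : gT -> C) :
  (forall i, multiplicative_fun (X i)) ->
  (forall f : gT -> C, exists c : gT -> C, forall g, f g = \sum_i c i * X i g) ->
  multiplicative_fun f -> exists i, f =1 X i.
Proof.
move=> mX sX mf; apply: contrapT => /forallNP h.
have [c fE] := sX f; have : \sum_g f g * f g^-1%g = 0.
  under eq_bigr => g _ do rewrite {1}fE mulr_suml.
  rewrite exchange_big big1 //= => i _.
  under eq_bigr => g _ do rewrite -mulrA.
  rewrite -mulr_sumr mfun_ortho //; case: asboolP; rewrite ?mulr0 // => Xf.
  by case: (h i) => g; rewrite Xf.
rewrite mfun_ortho //; case: asboolP => // _ /eqP; rewrite pnatr_eq0.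
by move=> /eqP/card0_eq/(_ 1%g).
Qed.
End FiniteAbelianDual.

(** * The partition of F into balls *)

Section Residues.
Variables (p : nat) (hp : prime p).
Local Notation Z := (padic_int hp).
Local Notation q n := ((p ^ n)%N%:Z).

Lemma pexp_gt1 N : (0 < N)%N -> (1 < p ^ N)%N.
Proof. by move=> N0; rewrite -(exp1n N) ltn_exp2r // prime_gt1. Qed.

(** The type 'Z_(p ^ N) is the ring Z/p^N only when p^N > 1, hence the recurring condition 0 < N. *)
Definition zred N (x : Z) : 'Z_(p ^ N) := (zpres x N)%:~R.

Lemma Zp_intr_mod N (a : int) : (0 < N)%N -> ((a %% q N)%Z)%:~R = a%:~R :> 'Z_(p ^ N).
Proof.
move=> N0; rewrite [in RHS](divz_eq a (q N)) [RHS]rmorphD /= [X in _ = X + _]intrM.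
suff -> : (q N)%:~R = 0 :> 'Z_(p ^ N) by rewrite mulr0 add0r.
exact: (pchar_Zp (pexp_gt1 N0)).
Qed.

Lemma Zp_intr_inj N (a b : int) : (0 < N)%N -> 0 <= a < q N -> 0 <= b < q N ->
  a%:~R = b%:~R :> 'Z_(p ^ N) -> a = b.
Proof.
case: a => // a; case: b => // b N0; rewrite !ltz_nat /= => ha hb.
move=> /(congr1 (fun x : 'Z_(p ^ N) => x : nat)).
by rewrite -![(Posz _)%:~R]/(_%:R) !val_Zp_nat ?pexp_gt1 // !modn_small // => ->.
Qed.

Lemma zpres_bound (x : Z) N : 0 <= zpres x N < q N.
Proof.
by rewrite -zpres_mod modz_ge0 ?ltz_pmod ?ltz_nat ?eqz_nat -?lt0n ?expn_gt0 ?prime_gt0.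
Qed.

Lemma zred1 N : (0 < N)%N -> zred N 1 = 1.
Proof. by move=> N0; rewrite /zred -[zpres 1 N]/((1 %% q N)%Z) Zp_intr_mod. Qed.

Lemma zredM N (x y : Z) : (0 < N)%N -> zred N (x * y) = zred N x * zred N y.
Proof. by move=> N0; rewrite /zred zpresM Zp_intr_mod // intrM. Qed.

Lemma zredP N (x y : Z) : (0 < N)%N ->
  zred N x = zred N y <-> exists z, y = x + p%:R ^+ N * z.
Proof.
move=> N0; split=> [|[z ->]]; last first.
  by rewrite /zred zpresD zpres_expM addr0 zpres_mod.
move=> /(Zp_intr_inj N0 (zpres_bound _ _) (zpres_bound _ _)) h.
have [|z zE] := @zp_dvd_exp p hp (y - x) N.
  by rewrite zpresD zpresN modzDmr h subrr mod0z.
by exists z; rewrite -zE addrC subrK.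
Qed.

Lemma zred_unit N (x : Z) : (0 < N)%N -> (zred N x \is a GRing.unit) = (x \is a GRing.unit).
Proof.
move=> N0; rewrite zp_unitE -(prednK N0) -(dvdz_zpres x N.-1) prednK //.
have /andP[x0 _] := zpres_bound x N.
have -> : zred N x = (`|zpres x N|%N)%:R by rewrite /zred -[in LHS](gez0_abs x0).
by rewrite unitZpE ?pexp_gt1 // coprime_pexpl // prime_coprime.
Qed.

Definition unitsZp N := {unit 'Z_(p ^ N)}.
(* On residues of non-units, [unit_class] takes the junk value 1. *)
Definition zlift N (a : unitsZp N) : Z := (FinRing.uval a : nat)%:R.
Definition unit_class N (u : Z) : unitsZp N := insubd (1%g : unitsZp N) (zred N u).

Lemma zred_lift N (a : unitsZp N) : (0 < N)%N -> zred N (zlift a) = FinRing.uval a.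
Proof.
move=> N0; rewrite /zred /zlift zpres_nat Zp_intr_mod //.
exact: natr_Zp.
Qed.

Lemma zlift_unit N (a : unitsZp N) : (0 < N)%N -> zlift a \is a GRing.unit.
Proof. by move=> N0; rewrite -(zred_unit _ N0) zred_lift //; exact: valP. Qed.

Lemma val_unit_class N (u : Z) : (0 < N)%N -> u \is a GRing.unit -> FinRing.uval
  (unit_class N u) = zred N u.
Proof. by move=> N0 uu; apply: (insubdK (1%g : unitsZp N)); rewrite -topredE /= zred_unit. Qed.

Lemma unit_class_lift N (a : unitsZp N) : (0 < N)%N -> unit_class N (zlift a) = a.
Proof. by move=> N0; apply: val_inj => /=; rewrite val_unit_class ?zlift_unit ?zred_lift. Qed.

Lemma unit_classM N (u v : Z) : (0 < N)%N -> u \is a GRing.unit -> v \is a GRing.unit ->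
  unit_class N (u * v) = (unit_class N u * unit_class N v)%g.
Proof.
move=> N0 uu uv; apply: val_inj; rewrite /= !val_unit_class ?unitrM ?uu ?uv //.
by rewrite zredM.
Qed.

Lemma unit_class1 N : (0 < N)%N -> unit_class N 1 = 1%g.
Proof. by move=> N0; apply: val_inj; rewrite /= val_unit_class ?unitr1 ?zred1. Qed.

Lemma unit_classP N (u v : Z) : (0 < N)%N -> u \is a GRing.unit -> v \is a GRing.unit ->
  unit_class N u = unit_class N v <-> exists z, v = u + p%:R ^+ N * z.
Proof.
move=> N0 uu uv; rewrite -zredP //; split=> [/(congr1 (@FinRing.uval _))|h].
  by rewrite !val_unit_class.
by apply: val_inj; rewrite /= !val_unit_class.
Qed.

End Residues.

Section Balls.
Variables (p : nat) (hp : prime p) (m : nat).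
Local Notation Z := (padic_int hp).
Local Notation K := (Qp hp).
Local Notation iota := (@FracField.tofrac (padic_int hp) : padic_int hp -> Qp hp).

(* The cell (k, a) indexes the ball p^k (a + p^N Z_p); for 0 < N these balls
   partition F. *)
Definition cells N := ('I_m * unitsZp p N)%type.
Definition rep N (c : cells N) : K := p%:R ^+ c.1 * iota (zlift hp c.2).
Definition pball N (c : cells N) : set K := pcoset (rep c, c.1 + N)%N.

Lemma rep_psphere N (c : cells N) : (0 < N)%N -> psphere (c.1 : nat)%:Z (rep c).
Proof. by move=> N0; apply/psphereP; exists (zlift hp c.2); rewrite ?zlift_unit. Qed.

Lemma pballP N (c : cells N) (x : K) : (0 < N)%N ->
  pball c x <-> exists u : Z, [/\ u \is a GRing.unit,
    x = p%:R ^+ c.1 * iota u & unit_class N u = c.2].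
Proof.
move=> N0; split=> [/pcosetP[z ->]|[u [uu -> uc]]].
  exists (zlift hp c.2 + p%:R ^+ N * z).
  have uu : zlift hp c.2 + p%:R ^+ N * z \is a GRing.unit by rewrite zp_unit_addM ?zlift_unit.
  split=> //; first by rewrite rmorphD rmorphM /= -/(iota _) iota_p mulrDr mulrA -exprD.
  by rewrite -[RHS](unit_class_lift hp _ N0); apply/esym/unit_classP; rewrite ?zlift_unit //;
    exists z.
have [|z uz] := (unit_classP N0 (zlift_unit hp c.2 N0) uu).1; first by rewrite unit_class_lift.
apply/pcosetP; exists z; rewrite uz rmorphD rmorphM /= -/(iota _) iota_p.
by rewrite mulrDr mulrA -exprD.
Qed.

Lemma ball_rep N (c : cells N) : pball c (rep c).
Proof. exact: pcoset_refl. Qed.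

Lemma ball_psphere N (c : cells N) (x : K) : (0 < N)%N -> pball c x -> psphere (c.1 : nat)%:Z x.
Proof. by move=> N0 /(pballP _ _ N0)[u [uu -> _]]; apply/psphereP; exists u. Qed.

Lemma ball_inj N (c c' : cells N) (x : K) : (0 < N)%N -> pball c x -> pball c' x -> c = c'.
Proof.
move=> N0 cx cx'; have := psphere_uniq (ball_psphere N0 cx) (ball_psphere N0 cx').
move=> [] e1; move: cx cx' => /(pballP _ _ N0)[u [uu -> uc]] /(pballP _ _ N0)[v [uv + vc]].
rewrite e1 => /mulfI => /(_ (expf_neq0 _ (qp_p_neq0 hp))) /eqP.
rewrite tofrac_eq => /eqP uvE; case: c c' e1 uc vc => [i a] [j b] /= ij <- <-.
by rewrite uvE; congr (_, _); exact: val_inj.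
Qed.

Lemma F_psphere (x : K) : F m x <-> exists k : 'I_m, psphere (k : nat)%:Z x.
Proof. by split=> [[k km kx]|[k kx]]; [exists (Ordinal km)|exists (k : nat) => //;
  exact: ltn_ord]. Qed.

Lemma F_ball N (x : K) : (0 < N)%N -> F m x <-> exists c : cells N, pball c x.
Proof.
move=> N0; split=> [/F_psphere[k /psphereP[u uu xu]]|[c /(ball_psphere N0) cx]].
  by exists (k, unit_class N u); apply/pballP => //; exists u.
by apply/F_psphere; exists c.1.
Qed.

Lemma F_neq0 (x : K) : F m x -> x != 0.
Proof. by move=> /F_psphere[k /psphere_neq0]. Qed.

Lemma F_rep N (c : cells N) : (0 < N)%N -> F m (rep c).
Proof. by move=> N0; apply/(F_ball _ N0); exists c; exact: ball_rep. Qed.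

Lemma F_bigcup N : (0 < N)%N -> F m = \big[setU/set0]_(c : cells N) @pball N c.
Proof.
move=> N0; apply/seteqP; split=> x.
  by move=> /(F_ball _ N0)[c cx]; rewrite (bigD1 c) //=; left.
rewrite -bigcup_seq => -[c _ cx]; apply/(F_ball _ N0); by exists c.
Qed.

Lemma ball_subF N (c : cells N) : (0 < N)%N -> pball c `<=` F m.
Proof. by move=> N0 x cx; apply/(F_ball _ N0); exists c. Qed.

Lemma ball_le N N' (c : cells N) (c' : cells N') (x : K) : (0 < N <= N')%N ->
  pball c x -> pball c' x -> pball c' `<=` pball c.
Proof.
move=> /andP[N0 NN'] cx cx' y; have N0' := leq_trans N0 NN'.
have [e1] := psphere_uniq (ball_psphere N0 cx) (ball_psphere N0' cx').
rewrite /pball (pcoset_eq cx) (pcoset_eq cx') -e1 => h.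
by apply: pcoset_le h; rewrite leq_add2l.
Qed.

Lemma open_F : open (@F p hp m).
Proof.
rewrite openE => x /(F_ball _ (ltn0Sn 0))[c cx]; apply/nbhs_pcosetP.
exists (c.1 + 1)%N; rewrite -(pcoset_eq cx); exact: ball_subF.
Qed.

Lemma measurable_F : measurable (@F p hp m).
Proof. by apply: (@measurable_open _ _ (@F p hp m)); exact: open_F. Qed.

Lemma measurable_ball N (c : cells N) : measurable (pball c).
Proof. exact: measurable_pcoset. Qed.

(* The values of [u] outside F are unconstrained. *)
Definition level (T : Type) N (u : K -> T) := forall (c : cells N) x, pball c x -> u x = u (rep c).

Lemma level_le (T : Type) N N' (u : K -> T) : (0 < N <= N')%N -> level N u -> level N' u.
Proof.
move=> NN' uN c' x cx'; have /andP[N0 N0'] := NN'; have {}N0' := leq_trans N0 N0'.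
have [c cx] := (F_ball _ N0).1 (ball_subF N0' cx').
by rewrite (uN c x cx) -(uN c (rep c')) //; apply: ball_le cx cx' _ (ball_rep _).
Qed.

Lemma F_sub_Zp : F m `<=` pcoset (0 : K, 0%N).
Proof.
move=> x /F_psphere[k /psphereP[v vu ->]]; apply/pcosetP; exists (p%:R ^+ k * v).
by rewrite rmorphM /= -/(iota _) iota_p expr0 mul1r add0r.
Qed.

Lemma level_locally_constant (T : Type) N (u : K -> T) : (0 < N)%N -> level N u ->
  forall x, F m x -> \forall y \near x, u y = u x.
Proof.
move=> N0 uN x /(F_ball _ N0)[c cx]; apply/nbhs_pcosetP; exists (c.1 + N)%N => y.
by rewrite -(pcoset_eq cx) => cy; rewrite (uN c y) // (uN c x).
Qed.

(* Compactness of F, by subdivision: if no level worked, nested balls on which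
   none works would shrink to a p-adic integer, near which [u] is constant. *)
Lemma locally_constant_level (T : Type) (u : K -> T) :
  (forall x, F m x -> \forall y \near x, u y = u x) -> exists2 N, (0 < N)%N & level N u.
Proof.
move=> uc.
pose good (A : set K) := exists2 N, (0 < N)%N & forall (c : cells N) x y,
  A x -> A y -> pball c x -> pball c y -> u x = u y.
pose bad (s : nat * nat) := ~ good (pcoset (s.1%:R : K, s.2) `&` F m).
have [/= [N N0 h]|bad0] := pselect (good (pcoset ((0 : nat)%:R : K, 0%N) `&` F m)).
  have ZF x : F m x -> (pcoset ((0 : nat)%:R : K, 0%N) `&` F m) x.
    by move=> Fx; split=> //; exact: F_sub_Zp.
  exists N => // c x cx; have rc := ball_rep c; apply: (h c) => //; apply: ZF.
    exact: ball_subF cx.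
  exact: F_rep.
have step s : exists i, bad s -> bad ((s.1 + p ^ s.2 * i)%N, s.2.+1).
  apply: contrapT => /forallNP h.
  have {}h i : bad s /\ good (pcoset ((s.1 + p ^ s.2 * i)%:R : K, s.2.+1) `&` F m).
    by have /not_implyP[bs /contrapT] := h i.
  have h2 i : exists N, (0 < N)%N /\ forall (c : cells N) x y,
      (pcoset ((s.1 + p ^ s.2 * i)%:R : K, s.2.+1) `&` F m) x ->
      (pcoset ((s.1 + p ^ s.2 * i)%:R : K, s.2.+1) `&` F m) y ->
      pball c x -> pball c y -> u x = u y.
    by have [N N0 hN] := (h i).2; exists N.
  have [f hf] := choice h2; apply: (h 0%N).1.
  (* The term [s.2.+1] puts every ball of level N that meets the coset inside a single one of its p
     subcosets; the maximum then makes N fine enough for each of them. *)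
  pose N := maxn s.2.+1 (\max_(i < p) f i); have sN : (s.2 < N)%N by rewrite leq_maxl.
  have N0 : (0 < N)%N := leq_ltn_trans (leq0n _) sN.
  exists N => // c x y [sx Fx] [sy Fy] cx cy.
  have /pcoset_split[i ip ix] := sx.
  have xE : (s.1 + p ^ s.2 * i)%:R = s.1%:R + p%:R ^+ s.2 * i%:R :> K.
    by rewrite natrD natrM natrX.
  have fN : (f i <= N)%N.
    by rewrite leq_max (leq_bigmax (Ordinal ip) (F := fun i : 'I_p => f i)) orbT.
  have [c' c'x] := (F_ball x (hf i).1).1 Fx.
  apply: ((hf i).2 c') => //; rewrite ?xE //.
    split=> //; rewrite (pcoset_eq ix); apply: (pcoset_le (leq_trans sN (leq_addl c.1 N))).
    by rewrite -(pcoset_eq cx).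
  by apply: ball_le c'x cx _ cy; rewrite (hf i).1.
have /choice[f hf] := step.
pose s n := iter n (fun s : nat * nat => ((s.1 + p ^ s.2 * f s)%N, s.2.+1)) (0%N, 0%N).
have s2 n : (s n).2 = n by elim: n => //= n ->.
have sbad n : bad (s n) by elim: n => // n IHn; exact: hf.
have sS n : ((s n.+1).1%:Z = (s n).1%:Z %[mod (p ^ n)%N%:Z])%Z.
  by rewrite /= s2 PoszD PoszM addrC mulrC modzMDl.
(* The centres of the nested bad cosets agree to increasing precision; x is their limit and lies in
   all of them. *)
pose x : Z := zpmk hp sS.
have xs n : pcoset ((s n).1%:R : K, n) (iota x).
  have [|z zE] := @zp_dvd_exp p hp (x - (s n).1%:R) n.
    rewrite zpresD zpresN zpres_nat modzDmr -modzDmr modzNm modzDmr -[zpres x n]/((s n).1%:Z %%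
      (p ^ n)%N%:Z)%Z modzDml subrr mod0z //.
  apply/pcosetP; exists z.
  by rewrite -[x](subrK (s n).1%:R) zE rmorphD rmorphM /= -/(iota _) iota_p rmorph_nat addrC.
have [Fx|nFx] := pselect (F m (iota x)).
  have /nbhs_pcosetP[n hn] := uc _ Fx.
  case: (sbad n); rewrite s2 (pcoset_eq (xs n)); exists 1%N => // c y z [ny _] [nz _] _ _.
  by rewrite (hn y ny) (hn z nz).
(* A limit outside F has a neighbourhood missing F: p^m Z_p if it is 0, otherwise a ball inside its
   own sphere. On such a coset [good] holds vacuously. *)
suff [n hn] : exists n, forall y, pcoset (iota x, n) y -> ~ F m y.
  case: (sbad n); rewrite s2 (pcoset_eq (xs n)); exists 1%N => // c y z [ny Fy].
  by case: (hn y ny).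
have [x0|x0] := eqVneq x 0.
  exists m => y; rewrite x0 rmorph0 => /pcoset_sym h /F_psphere[k ky].
  have := (@pcosetB _ _ y 0 m k); rewrite subr0 => /(_ ky).
  by move=> -[/(_ (pcoset_sym h))]; rewrite lez_nat leqNgt ltn_ord.
have [k [v vu xv]] := zp_decomp x0.
have kx : psphere (k : nat)%:Z (iota x).
  by apply/psphereP; exists v => //; rewrite xv rmorphM /= -/(iota _) iota_p.
exists k.+1 => y /(pcoset_psphere (ltnSn k) kx) ky /F_psphere[j jy].
have [jk] := psphere_uniq ky jy; apply: nFx; apply/F_psphere; exists j.
by rewrite -jk.
Qed.

End Balls.

(** * Integration of complex-valued functions *)

Section ComplexIntegralTheory.
Context d (T : measurableType d) (R : realType) (mu : {measure set T -> \bar R}).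
Implicit Types (A : set T) (f g : T -> R[i]).

Lemma cReD (x y : R[i]) : complex.Re (x + y) = complex.Re x + complex.Re y.
Proof. by case: x; case: y. Qed.
Lemma cImD (x y : R[i]) : complex.Im (x + y) = complex.Im x + complex.Im y.
Proof. by case: x; case: y. Qed.
Lemma cReM (x y : R[i]) :
  complex.Re (x * y) = complex.Re x * complex.Re y - complex.Im x * complex.Im y.
Proof. by case: x; case: y. Qed.
Lemma cImM (x y : R[i]) :
  complex.Im (x * y) = complex.Re x * complex.Im y + complex.Im x * complex.Re y.
Proof. by case: x; case: y. Qed.

Lemma complex_eqP (x y : R[i]) :
  complex.Re x = complex.Re y -> complex.Im x = complex.Im y -> x = y.
Proof. by case: x => a b; case: y => a' b' /= -> ->. Qed.

Lemma Re_sum (I : Type) (s : seq I) (P : pred I) (F : I -> R[i]) :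
  complex.Re (\sum_(i <- s | P i) F i) = \sum_(i <- s | P i) complex.Re (F i).
Proof. by apply: (big_morph (fun x : R[i] => complex.Re x)) => //; exact: cReD. Qed.

Lemma Im_sum (I : Type) (s : seq I) (P : pred I) (F : I -> R[i]) :
  complex.Im (\sum_(i <- s | P i) F i) = \sum_(i <- s | P i) complex.Im (F i).
Proof. by apply: (big_morph (fun x : R[i] => complex.Im x)) => //; exact: cImD. Qed.

Lemma eq_cintegral A f g : {in A, f =1 g} -> cintegral mu A f = cintegral mu A g.
Proof. by move=> fg; congr Complex; apply: eq_Rintegral => x Ax; rewrite fg. Qed.

Lemma eq_cintegrable A f g : measurable A -> {in A, f =1 g} ->
  cintegrable mu A f -> cintegrable mu A g.
Proof.
move=> mA fg [f1 f2]; split.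
  by apply: eq_integrable f1 => // x Ax; rewrite fg.
by apply: eq_integrable f2 => // x Ax; rewrite fg.
Qed.

Lemma cintegrableD A f g : measurable A -> cintegrable mu A f -> cintegrable mu A g ->
  cintegrable mu A (fun x => f x + g x).
Proof.
move=> mA [f1 f2] [g1 g2]; split.
  by apply: eq_integrable (integrableD mA f1 g1) => // x _; rewrite /= cReD.
by apply: eq_integrable (integrableD mA f2 g2) => // x _; rewrite /= cImD.
Qed.

Lemma cintegralD A f g : measurable A -> cintegrable mu A f -> cintegrable mu A g ->
  cintegral mu A (fun x => f x + g x) = cintegral mu A f + cintegral mu A g.
Proof.
move=> mA [f1 f2] [g1 g2]; apply: complex_eqP; rewrite ?cReD ?cImD /=.
  by rewrite -RintegralD //; apply: eq_Rintegral => x _; rewrite cReD.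
by rewrite -RintegralD //; apply: eq_Rintegral => x _; rewrite cImD.
Qed.

Lemma cintegrableZ A f (k : R[i]) : measurable A -> cintegrable mu A f ->
  cintegrable mu A (fun x => f x * k).
Proof.
move=> mA [f1 f2]; split.
  apply: eq_integrable (integrableB mA (integrableZr mA (complex.Re k) f1)
    (integrableZr mA (complex.Im k) f2)) => // x _; by rewrite /= cReM EFinB !EFinM.
apply: eq_integrable (integrableD mA (integrableZr mA (complex.Im k) f1)
    (integrableZr mA (complex.Re k) f2)) => // x _; by rewrite /= cImM EFinD !EFinM.
Qed.

Lemma cintegralZ A f (k : R[i]) : measurable A -> cintegrable mu A f ->
  cintegral mu A (fun x => f x * k) = cintegral mu A f * k.
Proof.
move=> mA [f1 f2]; apply: complex_eqP; rewrite ?cReM ?cImM /=.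
  rewrite -!RintegralZr // -RintegralB //; first by apply: eq_Rintegral => x _; rewrite cReM.
    exact: (integrableZr mA (complex.Re k) f1).
  exact: (integrableZr mA (complex.Im k) f2).
rewrite -!RintegralZr // -RintegralD //; first by apply: eq_Rintegral => x _; rewrite cImM.
  exact: (integrableZr mA (complex.Im k) f1).
exact: (integrableZr mA (complex.Re k) f2).
Qed.

Lemma cintegrable0 A : measurable A -> cintegrable mu A (fun=> 0).
Proof. by move=> mA; split; exact: integrable0. Qed.

Lemma cintegral0 A : cintegral mu A (fun=> 0) = 0.
Proof. by apply: complex_eqP; rewrite /= /Rintegral integral0_eq. Qed.

Lemma cintegrable_sum (I : eqType) (s : seq I) (F : I -> T -> R[i]) A : measurable A ->
  (forall i, i \in s -> cintegrable mu A (F i)) ->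
  cintegrable mu A (fun x => \sum_(i <- s) F i x).
Proof.
move=> mA; elim: s => [|i s IHs] h.
  by apply: eq_cintegrable (cintegrable0 mA) => // x _; rewrite big_nil.
apply: eq_cintegrable (cintegrableD mA (h i (mem_head _ _)) (IHs _)) => //.
  by move=> x _; rewrite big_cons.
by move=> j js; apply: h; rewrite inE js orbT.
Qed.

Lemma cintegrableS A B f : measurable A -> measurable B -> B `<=` A ->
  cintegrable mu A f -> cintegrable mu B f.
Proof. by move=> mA mB BA [f1 f2]; split; [exact: integrableS f1|exact: integrableS f2]. Qed.

Lemma Rintegral_bigsetU (I : finType) (A : I -> set T) (f : T -> R) :
  (forall i, measurable (A i)) -> trivIset setT A ->
  mu.-integrable (\big[setU/set0]_i A i) (EFin \o f) ->
  \int[mu]_(x in \big[setU/set0]_i A i) f x = \sum_i \int[mu]_(x in A i) f x.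
Proof.
move=> mA tA fi; have mU : measurable (\big[setU/set0]_i A i).
  by apply: bigsetU_measurable => i _.
have fiA i : mu.-integrable (A i) (EFin \o f).
  by apply: integrableS fi => //; rewrite (bigD1 i) //=; exact: subsetUl.
rewrite /Rintegral integral_bigsetU_EFin //; last 3 first.
- exact: index_enum_uniq.
- by apply: sub_trivIset tA.
- exact: measurable_int fi.
by rewrite -sum_fine //= => i _; exact: integrable_fin_num.
Qed.

Lemma cintegral_bigsetU (I : finType) (A : I -> set T) (f : T -> R[i]) :
  (forall i, measurable (A i)) -> trivIset setT A ->
  cintegrable mu (\big[setU/set0]_i A i) f ->
  cintegral mu (\big[setU/set0]_i A i) f = \sum_i cintegral mu (A i) f.
Proof.
move=> mA tA [f1 f2]; apply: complex_eqP; rewrite ?Re_sum ?Im_sum /=.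
  exact: Rintegral_bigsetU.
exact: Rintegral_bigsetU.
Qed.

Lemma cintegrable_indic A B f : measurable A -> measurable B -> B `<=` A ->
  cintegrable mu B f -> cintegrable mu A (fun x => f x * (\1_B x)%:C).
Proof.
move=> mA mB BA.
have h (g : T -> R) : mu.-integrable B (EFin \o g) ->
    mu.-integrable A (fun x => (g x * \1_B x)%:E).
  rewrite -[B in mu.-integrable B](setIidr BA) => /(integrable_restrict mu mB mA).
  apply: eq_integrable => // x _; rewrite /patch /= indicE; case: ifPn => xB.
    by rewrite mulr1.
  by rewrite mulr0.
move=> [f1 f2]; split.
  by apply: eq_integrable (h _ f1) => // x _ /=; rewrite cReM /= mulr0 subr0.
by apply: eq_integrable (h _ f2) => // x _ /=; rewrite cImM /= mulr0 add0r.
Qed.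

Lemma cintegral_real (A : set T) (f : T -> R) :
  cintegral mu A (fun x => (f x)%:C) = (\int[mu]_(x in A) f x)%:C.
Proof. by congr Complex; rewrite /Rintegral integral0_eq. Qed.

End ComplexIntegralTheory.

(** * Integrals against functions constant on balls *)

Section LevelIntegral.
Variables (R : realType) (p : nat) (hp : prime p).
Variables (mu : {measure set (Qp hp) -> \bar R}) (hmu : is_haar mu) (m : nat).
Local Notation K := (Qp hp).
Local Notation P := (p%:R : R).
Local Notation fn := (K -> R[i]).
Local Notation cells := (cells p m).

Lemma haar_ball N (c : cells N) : mu (@pball p hp m N c) = (P ^- (c.1 + N))%:E.
Proof. exact: haar_pcoset. Qed.

Lemma cintegrable_level N (f h : fn) : (0 < N)%N ->
  cintegrable mu (F m) f -> level m N h -> cintegrable mu (F m) (fun x => f x * h x).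
Proof.
move=> N0 fi hN; have mF := @measurable_F p hp m.
have : cintegrable mu (F m) (fun x => \sum_(c : cells N) f x * h (rep hp c) *
  (\1_(@pball p hp m N c) x)%:C).
  apply: cintegrable_sum => // c _; apply: cintegrable_indic => //.
  - exact: measurable_ball.
  - exact: ball_subF.
  apply: cintegrableZ; first exact: measurable_ball.
  by apply: cintegrableS fi => //; [exact: measurable_ball|exact: ball_subF].
apply: eq_cintegrable => // x /set_mem /(F_ball m _ N0)[c cx].
rewrite (bigD1 c) //= big1 ?addr0; last first.
  move=> c' cc'; rewrite indicE memNset ?mulr0 // => c'x; move: cc'.
  by rewrite (ball_inj N0 c'x cx) eqxx.
by rewrite indicE mem_set // mulr1 (hN c x).
Qed.

Lemma cintegral_level N (f h : fn) : (0 < N)%N ->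
  cintegrable mu (F m) f -> level m N h ->
  cintegral mu (F m) (fun x => f x * h x) =
  \sum_(c : cells N) cintegral mu (@pball p hp m N c) f * h (rep hp c).
Proof.
move=> N0 fi hN; have fhi := cintegrable_level N0 fi hN.
have mb c : measurable (@pball p hp m N c) by exact: measurable_ball.
rewrite (F_bigcup _ _ N0) cintegral_bigsetU //; last 2 first.
- by move=> c c' _ _ [x [cx c'x]]; exact: (ball_inj N0 cx c'x).
- by rewrite -F_bigcup.
apply: eq_bigr => c _; rewrite -cintegralZ //; last first.
  by apply: cintegrableS fi => //; [exact: measurable_F|exact: ball_subF].
by apply: eq_cintegral => x /set_mem cx; rewrite (hN c).
Qed.

Lemma mu_F_fin : (mu (F m) < +oo)%E.
Proof.
apply: (@le_lt_trans _ _ (mu (pcoset (0 : K, 0%N)))); last by rewrite haar_pcoset // ltry.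
exact: (le_measure mu (mem_set (@measurable_F p hp m)) (mem_set (@measurable_pcoset p hp 0 0))
  (@F_sub_Zp p hp m)).
Qed.

Lemma cintegrable_cst (k : R[i]) : cintegrable mu (F m) (fun=> k).
Proof.
have mF := @measurable_F p hp m.
by split; apply: measurable_bounded_integrable => //;
  [exact: mu_F_fin|exact: bounded_cst|exact: mu_F_fin|exact: bounded_cst].
Qed.

Lemma cintegral_ball_cst N (c : cells N) (k : R[i]) : 
  cintegral mu (@pball p hp m N c) (fun=> k) = (P ^- (c.1 + N))%:C * k.
Proof.
have mb := @measurable_ball p hp m N c.
by apply: complex_eqP; rewrite ?cReM ?cImM /= Rintegral_cst // haar_ball /=; ring.
Qed.

Lemma cintegral_level1 N (h : fn) : (0 < N)%N -> level m N h ->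
  cintegrable mu (F m) h /\
  cintegral mu (F m) h = \sum_(c : cells N) (P ^- (c.1 + N))%:C * h (rep hp c).
Proof.
move=> N0 hN; have c1 := cintegrable_cst 1; have mF := @measurable_F p hp m; split.
  by apply: eq_cintegrable (cintegrable_level N0 c1 hN) => // x _; rewrite mul1r.
transitivity (cintegral mu (F m) (fun x => 1 * h x)).
  by apply: eq_cintegral => x _; rewrite mul1r.
rewrite (cintegral_level N0 c1 hN); apply: eq_bigr => c _.
by rewrite cintegral_ball_cst mulr1.
Qed.

End LevelIntegral.

(** * The operator on locally constant functions *)

Section Operator.
Variables (R : realType) (p : nat) (hp : prime p).
Variables (mu : {measure set (Qp hp) -> \bar R}) (hmu : is_haar mu) (m : nat).
Local Notation K := (Qp hp).
Local Notation P := (p%:R : R).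
Local Notation fn := (K -> R[i]).
Local Notation cells := (cells p m).
Local Notation level := (@level p hp m).
Local Notation pball := (@pball p hp m).
Local Notation rep := (@rep p hp m).
Local Notation pabsC x := ((pabs R x)%:C).

Lemma conjC_real (x : R) : Num.conj (x%:C : R[i]) = x%:C.
Proof. exact: conjc_real. Qed.

Lemma pabs_level N : (0 < N)%N -> level N (@pabs p hp R).
Proof.
move=> N0 c x cx.
by rewrite (pabs_psphere R (ball_psphere N0 cx)) (pabs_psphere R (rep_psphere hp c N0)).
Qed.

Lemma pabs_rep N (c : cells N) : (0 < N)%N -> pabs R (rep c) = P ^- c.1.
Proof. by move=> N0; rewrite (pabs_psphere R (rep_psphere hp c N0)) exprnN. Qed.

Lemma pabs_sym (x y : K) : pabs R (x - y) = pabs R (y - x).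
Proof.
have [->|xy] := eqVneq x y; first by [].
rewrite -[y - x]opprB; have s := psphere_vp (_ : x - y != 0).
have {}s := s (_ : x - y != 0); rewrite subr_eq0 in s; have {}s := s xy.
by rewrite (pabs_psphere R s) (pabs_psphere R (psphereN s)).
Qed.

Lemma level_comp (T U : Type) (g : T -> U) N (f : K -> T) : level N f -> level N (g \o f).
Proof. by move=> fN c x cx; rewrite /= (fN c x). Qed.

Lemma level_comp2 (T U V : Type) (g : T -> U -> V) N (f : K -> T) (h : K -> U) :
  level N f -> level N h -> level N (fun x => g (f x) (h x)).
Proof. by move=> fN hN c x cx; rewrite (fN c x) ?(hN c x). Qed.

(** On the ball of x the numerator vanishes identically, on every other ball the distance to x is
    constant. The singular integral defining D thus becomes a finite sum. *)
Lemma Dkernel_level N (u : fn) (x : K) : (0 < N)%N -> F m x -> level N u ->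
  level N (Dkernel u x).
Proof.
move=> N0 Fx uN c y cy; rewrite /Dkernel (uN c y) //.
have [cx|ncx] := pselect (pball c x); first by rewrite (uN c x cx) subrr !mul0r.
by rewrite (pabs_pcoset R cy).
Qed.

Lemma Dop_level N (u : fn) (x : K) : (0 < N)%N -> F m x -> level N u ->
  cintegrable mu (F m) (Dkernel u x) /\
  Dop mu m u x = pabsC x * \sum_(c : cells N) (P ^- (c.1 + N))%:C * Dkernel u x (rep c).
Proof.
rewrite /Dop => N0 Fx uN; have [ki ->] := cintegral_level1 hmu N0 (Dkernel_level N0 Fx uN).
by [].
Qed.

Lemma level_Dop N (u : fn) : (0 < N)%N -> level N u -> level N (Dop mu m u).
Proof.
move=> N0 uN c x cx.
rewrite (Dop_level N0 _ uN).2; last exact: ball_subF cx.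
rewrite (Dop_level N0 _ uN).2; last exact: F_rep.
rewrite (pabs_level N0 cx); congr (_ * _); apply: eq_bigr => c' _; congr (_ * _).
rewrite /Dkernel (uN c x cx); have [->|c'c] := eqVneq c' c; first by rewrite subrr !mul0r.
rewrite pabs_sym (pabs_pcoset R cx) ?(pabs_sym (rep c)) //.
move=> h; move/eqP: c'c; apply; apply: (ball_inj N0 (ball_rep hp c')).
exact: h.
Qed.

(** The factor |x|_p of D times p^-N is the volume of the ball of x, which makes this matrix
    symmetric. Its diagonal is 0 by the convention 1/0 = 0. *)
Definition cell_kernel N (c c' : cells N) : R :=
  P ^- (c.1 + N) * P ^- (c'.1 + N) / pabs R (rep c' - rep c) ^+ 2.

Lemma cell_kernel_sym N (c c' : cells N) : cell_kernel c c' = cell_kernel c' c.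
Proof. by rewrite /cell_kernel pabs_sym (mulrC (P ^- (c.1 + N))). Qed.

Lemma Dop_rep N (u : fn) (c : cells N) : (0 < N)%N -> level N u ->
  (P ^- N)%:C * Dop mu m u (rep c) =
  \sum_(c' : cells N) (cell_kernel c c')%:C * (u (rep c') - u (rep c)).
Proof.
move=> N0 uN; rewrite (Dop_level N0 (F_rep hp c N0) uN).2 mulrA mulr_sumr.
apply: eq_bigr => c' _; rewrite /cell_kernel /Dkernel pabs_rep //.
rewrite !rmorphM /= !fmorphV /= !rmorphXn /= !exprD !invfM.
by ring.
Qed.

Lemma eq_Dop_level N (u v : fn) (x : K) : (0 < N)%N -> F m x -> level N u -> level N v ->
  (forall c : cells N, u (rep c) = v (rep c)) -> Dop mu m u x = Dop mu m v x.
Proof.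
move=> N0 Fx uN vN uv; rewrite (Dop_level N0 Fx uN).2 (Dop_level N0 Fx vN).2.
have uvx : u x = v x.
  by have [c cx] := (F_ball m x N0).1 Fx; rewrite (uN c x cx) (vN c x cx).
by congr (_ * _); apply: eq_bigr => c _; rewrite /Dkernel uv uvx.
Qed.

Lemma Dop_sum N (I : finType) (k : I -> R[i]) (f : I -> fn) (x : K) : (0 < N)%N -> F m x ->
  (forall i, level N (f i)) ->
  Dop mu m (fun x => \sum_i k i * f i x) x = \sum_i k i * Dop mu m (f i) x.
Proof.
move=> N0 Fx fN; have sN : level N (fun x => \sum_i k i * f i x).
  by move=> c y cy; apply: eq_bigr => i _; rewrite (fN i c y).
rewrite (Dop_level N0 Fx sN).2.
under [RHS]eq_bigr => i _ do rewrite (Dop_level N0 Fx (fN i)).2.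
rewrite mulr_sumr; under [RHS]eq_bigr => i _ do rewrite mulrCA mulr_sumr mulr_sumr.
rewrite exchange_big; apply: eq_bigr => c _ /=.
rewrite /Dkernel -sumrB mulr_suml mulr_sumr mulr_sumr.
by apply: eq_bigr => i _; ring.
Qed.

Lemma Dop_conj N (u : fn) (x : K) : (0 < N)%N -> F m x -> level N u ->
  Dop mu m (fun x => Num.conj (u x)) x = Num.conj (Dop mu m u x).
Proof.
move=> N0 Fx uN; have uN' : level N (fun x => Num.conj (u x)) by exact: level_comp.
rewrite (Dop_level N0 Fx uN').2 (Dop_level N0 Fx uN).2 rmorphM /= conjC_real rmorph_sum.
congr (_ * _); apply: eq_bigr => c _; rewrite rmorphM /= conjC_real /Dkernel.
have cM (a b : R[i]) : Num.conj (a * b) = Num.conj a * Num.conj b by exact: rmorphM.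
have cB (a b : R[i]) : Num.conj (a - b) = Num.conj a - Num.conj b by exact: rmorphB.
have cV (a : R[i]) : Num.conj (a^-1) = (Num.conj a)^-1 by exact: fmorphV.
by rewrite cM cB cV conjC_real.
Qed.

Definition step N (U : cells N -> R[i]) : fn := fun x => \sum_c U c * (\1_(pball c) x)%:C.

Lemma stepE N (U : cells N -> R[i]) c x : (0 < N)%N -> pball c x -> step U x = U c.
Proof.
move=> N0 cx; rewrite /step (bigD1 c) //= indicE mem_set // mulr1 big1 ?addr0 //.
move=> c' c'c; rewrite indicE memNset ?mulr0 // => c'x; move/eqP: c'c; apply.
exact: (ball_inj N0 c'x cx).
Qed.

Lemma step_rep N (U : cells N -> R[i]) c : (0 < N)%N -> step U (rep c) = U c.
Proof. by move=> N0; rewrite (stepE U N0 (ball_rep hp c)). Qed.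

Lemma step_level N (U : cells N -> R[i]) : (0 < N)%N -> level N (step U).
Proof. by move=> N0 c x cx; rewrite (stepE U N0 cx) step_rep. Qed.

(** Conditional expectation onto the functions of level N. As |x|_p is constant on each ball,
    averaging for dz or for dx/|x|_p gives the same value. *)
Definition avg N (u : fn) : fn :=
  step (fun c : cells N => (P ^+ (c.1 + N))%:C * cintegral mu (pball c) u).

Lemma avg_level N (u : fn) : (0 < N)%N -> level N (avg N u).
Proof. by move=> N0; exact: step_level. Qed.

(** For dx/|x|_p every ball of level N has mass p^-N, whatever its sphere, so the sum over cells
    carries no weights. *)
Lemma Fint_avg N (u g : fn) : (0 < N)%N -> cintegrable mu (F m) u -> level N g ->
  Fint mu m (fun x => u x * g x) = (P ^- N)%:C * \sum_(c : cells N) avg N u (rep c) * g (rep c).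
Proof.
move=> N0 ui unitsZp; have p0 := p_neq0 R hp.
have hN : level N (fun x => g x / pabsC x).
  exact: (level_comp2 (fun a b => a / b%:C) unitsZp (pabs_level N0)).
transitivity (cintegral mu (F m) (fun x => u x * (g x / pabsC x))).
  by apply: eq_cintegral => x _; rewrite mulrA.
rewrite (cintegral_level N0 ui hN) mulr_sumr; apply: eq_bigr => c _.
rewrite /avg step_rep // pabs_rep // !fmorphV /= !rmorphXn /= !exprD.
by field; rewrite !expf_neq0 ?fmorph_eq0.
Qed.

Lemma avg_id N (u : fn) (x : K) : (0 < N)%N -> level N u -> F m x -> avg N u x = u x.
Proof.
move=> N0 uN /(F_ball m _ N0)[c cx]; rewrite /avg (stepE _ N0 cx).
rewrite (@eq_cintegral _ _ _ _ _ _ (fun=> u (rep c))); last by move=> y /set_mem cy;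
  rewrite (uN c y).
rewrite (cintegral_ball_cst hmu) (uN c x) // mulrA -rmorphM /= mulfV ?mul1r //.
by rewrite expf_neq0 // (p_neq0 R hp).
Qed.

Lemma Fint_level N (u g : fn) : (0 < N)%N -> level N u -> level N g ->
  Fint mu m (fun x => u x * g x) = (P ^- N)%:C * \sum_(c : cells N) u (rep c) * g (rep c).
Proof.
move=> N0 uN unitsZp; rewrite (@Fint_avg N) //; last exact: (cintegral_level1 hmu N0 uN).1.
by congr (_ * _); apply: eq_bigr => c _; rewrite avg_id //; exact: F_rep.
Qed.

(** The diagonal products u g cancel in the difference of the two sides, and the remaining double
    sum changes sign when the two cells are exchanged. *)
Lemma cell_sum_Dop_sym N (u g : fn) : (0 < N)%N -> level N u -> level N g ->
  \sum_(c : cells N) Dop mu m u (rep c) * g (rep c) =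
  \sum_(c : cells N) u (rep c) * Dop mu m g (rep c).
Proof.
move=> N0 uN unitsZp; have p0 : (P ^- N)%:C != 0 :> R[i].
  by rewrite fmorph_eq0 invr_eq0 expf_neq0 // (p_neq0 R hp).
apply: (mulfI p0); rewrite !mulr_sumr.
under eq_bigr => c _ do rewrite mulrA Dop_rep // mulr_suml.
under [RHS]eq_bigr => c _ do rewrite mulrCA Dop_rep // mulr_sumr.
apply/eqP; rewrite -subr_eq0 -sumrB; under eq_bigr => c _ do rewrite -sumrB.
set S := (X in X == 0); have : S = - S.
  rewrite {1}/S exchange_big /= -sumrN; apply: eq_bigr => c _.
  by rewrite -sumrN; apply: eq_bigr => c' _; rewrite (cell_kernel_sym c'); ring.
move/eqP; rewrite -addr_eq0 -mulr2n mulrn_eq0 /=. by [].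
Qed.

(** Moves D from the test function onto the average of an arbitrary integrable u, which converts a
    weak equation for u into equations between functions of level N. *)
Lemma Fint_Dop_avg N (u g : fn) : (0 < N)%N -> cintegrable mu (F m) u -> level N g ->
  Fint mu m (fun x => u x * Dop mu m g x) = Fint mu m (fun x => Dop mu m (avg N u) x * g x).
Proof.
move=> N0 ui unitsZp; have aN := avg_level u N0; have DgN := level_Dop N0 unitsZp.
rewrite (Fint_avg N0) // (Fint_level N0) //; last exact: level_Dop.
by rewrite cell_sum_Dop_sym.
Qed.

End Operator.

(** * The group of units modulo p^N and its congruence subgroups *)

Section UnitGroup.
Variables (p : nat) (hp : prime p).
Local Notation Z := (padic_int hp).
Local Notation unitsZp := (unitsZp p).
Local Notation iota := (@FracField.tofrac (padic_int hp) : padic_int hp -> Qp hp).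
Local Notation lift := (zlift hp).

Definition cong k (u v : Z) := zpres u k == zpres v k.

Lemma congP k (u v : Z) : cong k u v <-> exists z, v = u + p%:R ^+ k * z.
Proof.
split=> [/eqP uv|[z ->]]; last by rewrite /cong zpresD zpres_expM addr0 zpres_mod.
have [|z zE] := @zp_dvd_exp p hp (v - u) k.
  by rewrite zpresD zpresN modzDmr uv subrr mod0z.
by exists z; rewrite -zE addrC subrK.
Qed.

Lemma cong_pcoset k (u v : Z) : cong k u v <-> pcoset (iota u, k) (iota v).
Proof.
split=> [/congP[z ->]|/pcosetP[z vE]].
  by apply/pcosetP; exists z; rewrite rmorphD rmorphM /= -/(iota _) iota_p.
apply/congP; exists z; apply/eqP; rewrite -tofrac_eq rmorphD rmorphM /= -!/(iota _) iota_p.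
exact/eqP.
Qed.

Lemma cong_le k k' (u v : Z) : (k <= k')%N -> cong k' u v -> cong k u v.
Proof. by move=> kk' /cong_pcoset h; apply/cong_pcoset; exact: pcoset_le h. Qed.

Lemma congM k (u v w : Z) : cong k u v -> cong k (u * w) (v * w).
Proof.
by move=> /congP[z ->]; apply/congP; exists (z * w); rewrite mulrDl mulrA.
Qed.

Lemma cong_trans k (u v w : Z) : cong k u v -> cong k v w -> cong k u w.
Proof. by move=> /eqP uv /eqP vw; rewrite /cong uv vw. Qed.

Lemma cong_sym k (u v : Z) : cong k u v = cong k v u.
Proof. exact: eq_sym. Qed.

Lemma cong_lift N (u : Z) : (0 < N)%N -> u \is a GRing.unit -> cong N u (lift (unit_class N u)).
Proof.
move=> N0 uu; apply/congP; apply/(unit_classP N0) => //; first exact: zlift_unit.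
by rewrite unit_class_lift.
Qed.

Lemma cong_unit_class N (u v : Z) : (0 < N)%N -> u \is a GRing.unit -> v \is a GRing.unit ->
  (unit_class N u == unit_class N v) = cong N u v.
Proof. by move=> N0 uu uv;
  apply/eqP/idP => [/(unit_classP N0 uu uv)/congP|/congP/(unit_classP N0 uu uv)]. Qed.

(** For 0 < k <= N this is the image of 1 + p^k Z_p in the units modulo p^N; for k = 0 it is the
    whole group. *)
Definition principal_units N k (g : unitsZp N) := cong k 1 (lift g).

Lemma principal_unitsE N k (a b : unitsZp N) : (0 < N)%N -> (k <= N)%N -> cong k (lift b)
  (lift a) = principal_units k (a * b^-1)%g.
Proof.
move=> N0 kN.
have h (u v : unitsZp N) : cong k (lift (u * v)%g) (lift u * lift v).
  apply: (cong_le kN); rewrite cong_sym -cong_unit_class ?unit_classM ?unit_class_lift ?unitrM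
    ?zlift_unit //.
have e : cong k (lift (a * b^-1)%g * lift b) (lift a).
  by rewrite cong_sym -{1}(mulgKV b a); exact: h.
apply/idP/idP => ab.
  have ub := zlift_unit hp b N0.
  have := congM (lift b)^-1 (cong_trans ab _ : cong k (lift b) (lift (a * b^-1)%g * lift b)).
  by rewrite cong_sym in e; move=> /(_ e); rewrite mulrV // mulrK.
apply: cong_trans e.
by have := congM (lift b) ab; rewrite mul1r.
Qed.

Lemma principal_units_mul N k (h g : unitsZp N) : (0 < N)%N ->
  (k <= N)%N -> principal_units k h -> principal_units k (h * g)%g = principal_units k g.
Proof.
move=> N0 kN hh; have := principal_unitsE (h * g)%g g N0 kN; rewrite mulgK hh => hg.
by apply/idP/idP => [|x]; [move=> x; apply: cong_trans x _; rewrite cong_sym|apply: cong_trans x _].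
Qed.

Lemma principal_units0 N (g : unitsZp N) : principal_units 0 g.
Proof. by rewrite /principal_units /cong !zpres_x0. Qed.

Lemma card_unitsZp N : (0 < N)%N -> #|{: unitsZp N}| = (p ^ N.-1 * p.-1)%N.
Proof.
move=> N0; have := card_units_Zp (ltnW (pexp_gt1 hp N0)).
rewrite /units_Zp cardsT => ->; rewrite totient_pfactor // mulnC //.
Qed.


(** Reduction from units modulo p^N to units modulo p^k is onto and its fibres are translates of the
    principal units, so their number is the quotient of the two group orders. *)
Lemma card_principal_units N k : (0 < k <= N)%N ->
  (\sum_(g : unitsZp N | principal_units k g) 1 = p ^ (N - k))%N.
Proof.
move=> /andP[k0 kN]; have N0 := leq_trans k0 kN.
pose pr (g : unitsZp N) : unitsZp k := unit_class k (lift g).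
have prE (g h : unitsZp N) : (pr g == pr h) = principal_units k (g * h^-1)%g.
  by rewrite /pr cong_unit_class ?zlift_unit // cong_sym principal_unitsE.
have fib (b : unitsZp k) :
  (\sum_(g | pr g == b) 1 = \sum_(g : unitsZp N | principal_units k g) 1)%N.
  pose g0 := unit_class N (lift b).
  have -> : b = pr g0.
    rewrite -[LHS](unit_class_lift hp) //; apply/eqP; rewrite /pr cong_unit_class ?zlift_unit //.
    by apply: (cong_le kN); apply: cong_lift; rewrite ?zlift_unit.
  rewrite (reindex_inj (mulIg g0)); apply: eq_bigl => g.
  by rewrite prE mulgK.
have := card_unitsZp N0; rewrite -sum1_card (partition_big pr xpredT) //=.
under eq_bigr => j _ do rewrite fib.
rewrite sum_nat_const card_unitsZp // => /eqP; rewrite mulnAC.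
have -> : (p ^ N.-1 * p.-1 = p ^ k.-1 * p ^ (N - k) * p.-1)%N.
  by rewrite -expnD; congr (_ ^ _ * _)%N; lia.
have pp : (0 < p.-1)%N by rewrite -subn1 subn_gt0 prime_gt1.
by rewrite eqn_pmul2r // eqn_pmul2l ?expn_gt0 ?prime_gt0 // => /eqP.
Qed.

End UnitGroup.

(** * D as a matrix on the cells of a level *)

Section CellFormula.
Variables (R : realType) (p : nat) (hp : prime p).
Variables (mu : {measure set (Qp hp) -> \bar R}) (hmu : is_haar mu) (m : nat).
Local Notation K := (Qp hp).
Local Notation Z := (padic_int hp).
Local Notation P := (p%:R : R).
Local Notation fn := (K -> R[i]).
Local Notation cells := (cells p m).
Local Notation unitsZp := (unitsZp p).
Local Notation level := (@level p hp m).
Local Notation rep := (@rep p hp m).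
Local Notation lift := (zlift hp).
Local Notation iota := (@FracField.tofrac (padic_int hp) : padic_int hp -> Qp hp).

Lemma pabsM (x y : K) : pabs R (x * y) = pabs R x * pabs R y.
Proof.
have [->|x0] := eqVneq x 0; first by rewrite mul0r pabs0 mul0r.
have [->|y0] := eqVneq y 0; first by rewrite mulr0 pabs0 mulr0.
have sx := psphere_vp x0; have sy := psphere_vp y0.
rewrite (pabs_psphere R (psphereM sx sy)) (pabs_psphere R sx) (pabs_psphere R sy).
by rewrite opprD expfzDr // (p_neq0 R hp).
Qed.

Lemma pabs_exp_p (k : nat) : pabs R (p%:R ^+ k : K) = P ^- k.
Proof.
have s : psphere k%:Z (p%:R ^+ k : K).
  by apply/psphereP; exists 1; rewrite ?unitr1 // rmorph1 mulr1.
by rewrite (pabs_psphere R s) exprnN.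
Qed.

(** Let j be the valuation of u - v. The left side is p^(2j), and [cong k u v] holds exactly for k
    <= j, so the sum telescopes to p^(2j) - 1. The hypothesis says j < N, so no layer is cut off. *)
Lemma pabs_weight N (u v : Z) : ~~ cong N u v ->
  (pabs R (iota u - iota v) ^+ 2)^-1 =
  1 + \sum_(1 <= k < N) (P ^+ (2 * k) - P ^+ (2 * k.-1)) * (cong k u v)%:R.
Proof.
move=> nuv; have uv0 : u - v != 0.
  by apply: contraNneq nuv => /eqP; rewrite subr_eq0 => /eqP ->; rewrite /cong.
have [j [w wu uvE]] := zp_decomp uv0.
have sj : psphere j%:Z (iota v - iota u).
  rewrite -opprB; apply: psphereN; apply/psphereP; exists w => //.
  by rewrite -rmorphB /= uvE rmorphM /= -/(iota _) iota_p.
have cE k : cong k u v = (k <= j)%N.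
  apply/idP/idP => [/cong_pcoset/(pcosetB _ sj)|kj]; first by rewrite lez_nat.
  by apply/cong_pcoset/(pcosetB _ sj); rewrite lez_nat.
have jN : (j < N)%N by rewrite ltnNge -cE.
rewrite pabs_sym (pabs_psphere R sj) -exprnN exprVn invrK -exprM mulnC.
rewrite (big_cat_nat (n := j.+1)) //= [X in _ + (_ + X)]big_nat_cond.
rewrite [X in _ + (_ + X)]big1 ?addr0; last first.
  by move=> k /andP[/andP[jk _] _]; rewrite cE leqNgt jk mulr0.
rewrite (eq_big_nat _ _ (F2 := fun k => P ^+ (2 * k) - P ^+ (2 * k.-1))); last first.
  by move=> k /andP[_ kj]; rewrite cE -ltnS kj mulr1.
elim: j {sj cE jN uvE} => [|j IHj]; first by rewrite big_geq // addr0 muln0 expr0.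
by rewrite big_nat_recr //= addrA -IHj addrC subrK.
Qed.

Lemma pabs_rep_neq N (c c' : cells N) : (0 < N)%N -> c.1 != c'.1 ->
  pabs R (rep c' - rep c) = P ^- minn c.1 c'.1.
Proof.
move=> N0; wlog : c c' / (c.1 < c'.1)%N => [h|lt _].
  rewrite neq_ltn => /orP[lt|lt]; first by apply: h; rewrite // neq_ltn lt.
  by rewrite pabs_sym minnC; apply: h; rewrite // neq_ltn lt.
rewrite (minn_idPl (ltnW lt)) pabs_sym.
have s : psphere (c.1 : nat)%:Z (rep c - rep c').
  apply: (pcoset_psphere (ltnSn c.1) (rep_psphere hp c N0)); apply/pcosetP.
  exists (- (p%:R ^+ (c'.1 - c.1.+1) * lift c'.2)).
  by rewrite rmorphN rmorphM /= -!/(iota _) iota_p mulrN mulrA -exprD subnKC.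
by rewrite (pabs_psphere R s) exprnN.
Qed.

Lemma pabs_rep_eq N (i : 'I_m) (a b : unitsZp N) :
  pabs R (rep (i, a) - rep (i, b)) = P ^- i * pabs R (iota (lift a) - iota (lift b)).
Proof. by rewrite /rep /= -mulrBr pabsM pabs_exp_p. Qed.

(** Since i + j - 2 min(i, j) = |i - j|, the interaction between two distinct spheres is governed by
    the matrix P. *)
Lemma pmx_weight (i j : 'I_m) N :
  P ^- i * P ^- (j + N) / (P ^- minn i j) ^+ 2 = P ^- N * Pmx R p m i j.
Proof.
have p0 := p_neq0 R hp; rewrite mxE.
have [ij|/ltnW ji] := leqP i j.
  have [d jE] : exists d, j = (i + d)%N :> nat by exists (j - i)%N; rewrite subnKC.
  have -> : `|(i : nat)%:Z - (j : nat)%:Z|%N = d by rewrite jE; lia.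
  by rewrite jE !exprD; field; rewrite !expf_neq0.
have [d iE] : exists d, i = (j + d)%N :> nat by exists (i - j)%N; rewrite subnKC.
have -> : `|(i : nat)%:Z - (j : nat)%:Z|%N = d by rewrite iE; lia.
by rewrite iE !exprD; field; rewrite !expf_neq0.
Qed.

Lemma cscaleE (A B W : R) (v : R[i]) : A%:C * (B%:C * (v / W%:C)) = (A * B / W)%:C * v.
Proof. by rewrite !rmorphM /= fmorphV /=; ring. Qed.

(** Separates the exchange with other spheres, whose weight depends only on the two indices, from
    the exchange inside the sphere, where the scaling factors p^-i cancel. *)
Lemma Dop_cells N (u : fn) (i : 'I_m) (b : unitsZp N) : (0 < N)%N -> level N u ->
  Dop mu m u (rep (i, b)) =
  \sum_(j : 'I_m | j != i) \sum_(a : unitsZp N)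
     (P ^- N * Pmx R p m i j)%:C * (u (rep (j, a)) - u (rep (i, b)))
  + \sum_(a : unitsZp N) (P ^- N * (pabs R (iota (lift a) - iota (lift b)) ^+ 2)^-1)%:C *
      (u (rep (i, a)) - u (rep (i, b))).
Proof.
move=> N0 uN; have p0 := p_neq0 R hp.
rewrite (Dop_level hmu N0 (F_rep hp _ N0) uN).2 pabs_rep //= mulr_sumr.
rewrite -(pair_big xpredT xpredT (fun (j : 'I_m) (a : unitsZp N) =>
  (P ^- i)%:C * ((P ^- (j + N))%:C * Dkernel u (rep (i, b)) (rep (j, a))))) /=.
rewrite (bigD1 i) //= addrC; congr (_ + _); last first.
  apply: eq_bigr => a _; rewrite /Dkernel pabs_rep_eq.
  set w := pabs R _; set v := u _ - _.
  have e : P ^- i * P ^- (i + N) / (P ^- i * w) ^+ 2 = P ^- N * (w ^+ 2)^-1.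
    rewrite exprMn invfM; set w' := (w ^+ 2)^-1; rewrite exprD.
    by field; rewrite !expf_neq0.
  by rewrite -e; exact: cscaleE.
apply: eq_bigr => j ji; apply: eq_bigr => a _; rewrite /Dkernel pabs_rep_neq 1?eq_sym //=.
by rewrite -pmx_weight; exact: cscaleE.
Qed.

(** The mass 1 - 1/p of a sphere for dx/|x|_p, counted as p^-N times its number of balls. *)
Lemma unitsZp_density N : (0 < N)%N -> P ^- N * #|{: unitsZp N}|%:R = 1 - P^-1.
Proof.
move=> N0; have p0 := p_neq0 R hp.
rewrite (card_unitsZp hp N0) natrM natrX.
have -> : (p.-1)%:R = P - 1 by rewrite -subn1 natrB ?prime_gt0.
have -> : P ^+ N = P * P ^+ N.-1 by rewrite -exprS prednK.
by field; rewrite p0 expf_neq0.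
Qed.

Lemma geometric_two_sided i k :
  (P - 1) * \sum_(0 <= j < i.+1 + k) P ^- `|i%:Z - j%:Z|%N = P + 1 - P ^- i - P ^- k.
Proof.
have p0 := p_neq0 R hp; elim: k => [|k IHk].
  rewrite addn0 expr0 invr1; elim: i => [|i IHi].
    by rewrite big_nat1 expr0 invr1; ring.
  rewrite big_nat_recl //.
  rewrite (eq_big_nat _ _ (F2 := fun j => P ^- `|i%:Z - j%:Z|%N)); last first.
    by move=> j _; congr (P ^- _); lia.
  rewrite mulrDr IHi subr0 absz_nat exprS; field.
  by rewrite p0 expf_neq0.
rewrite addnS big_nat_recr //= mulrDr IHk.
have -> : `|i%:Z - (i.+1 + k)%:Z|%N = k.+1 by lia.
by rewrite exprS; field; rewrite p0 !expf_neq0.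
Qed.

(** The geometric series over all integers j would give p + 1; [bdry] is the contribution of the
    spheres missing on the two sides of F. *)
Lemma Pmx_sum (i : 'I_m) :
  (P - 1) * \sum_(j : 'I_m) Pmx R p m i j = P + 1 - bdry R p m i.
Proof.
have p0 := p_neq0 R hp.
have mE : m = (i.+1 + (m - i.+1))%N by rewrite subnKC.
have -> : \sum_(j : 'I_m) Pmx R p m i j = \sum_(0 <= j < m) P ^- `|(i : nat)%:Z - j%:Z|%N.
  by rewrite big_mkord; apply: eq_bigr => j _; rewrite mxE.
rewrite {1}mE geometric_two_sided /bdry exprnN (_ : (i : nat)%:Z + 1 - m%:Z = - (m - i.+1)%N%:Z).
  by rewrite !exprnN opprD addrA.
by have := ltn_ord i; lia.
Qed.

Lemma Pmx_sum_neq (i : 'I_m) :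
  (1 - P^-1) * \sum_(j : 'I_m | j != i) Pmx R p m i j = (2 - bdry R p m i) / P.
Proof.
have p0 := p_neq0 R hp; have := Pmx_sum i; rewrite (bigD1 i) //= mxE subrr expr0 invr1.
set S := \sum_(_ | _) _; set B := bdry _ _ _ _ => h.
have -> : B = P + 1 - (P - 1) * (1 + S) by rewrite h; ring.
by field.
Qed.

Variables (Q : 'M[R]_m) (lam0 : 'rV[R]_m).
Hypothesis Qorth : Q^T *m Q = 1%:M.
Hypothesis Qdiag : invmx Q *m Rmx R p m *m Q = diag_mx lam0.

Lemma Q_unit : Q \in unitmx.
Proof. by have := mulmx1_unit Qorth; case. Qed.

Lemma Rmx_eigen (k l : 'I_m) : 
  (1 - P^-1) * (\sum_(j | j != k) Pmx R p m k j * (Q j l - Q k l)) = lam0 0 l * Q k l.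
Proof.
have h : Rmx R p m *m Q = Q *m diag_mx lam0.
  by rewrite -Qdiag !mulmxA mulmxV ?Q_unit // mul1mx.
have := congr1 (fun M : 'M[R]_m => M k l) h; rewrite mul_mx_diag !mxE [_ * lam0 0 l]mulrC => <-.
rewrite /Rmx /Lmx.
under [RHS]eq_bigr => j _ do rewrite !mxE.
rewrite [RHS](bigD1 k) //= eqxx mulr1n.
have -> : \sum_j Pmx R p m k j * (const_mx 1 : 'cV[R]_m) j 0 =
    Pmx R p m k k + \sum_(j | j != k) Pmx R p m k j.
  by rewrite (bigD1 k) //= [const_mx _ _ _]mxE mulr1; congr (_ + _); apply: eq_bigr => j _;
    rewrite [const_mx _ _ _]mxE mulr1.
have Pkk : Pmx R p m k k = P ^- `|(k : nat)%:Z - (k : nat)%:Z|%N by rewrite mxE.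
rewrite -Pkk addrAC subrr add0r; set S := Pmx R p m k k + _.
rewrite mulr_sumr mulr_sumr mulr_suml -big_split /=.
apply: eq_bigr => j jk; rewrite (negPf (_ : k != j)) 1?eq_sym // mulr0n sub0r mxE.
by ring.
Qed.

End CellFormula.

(** * The listed eigenfunctions *)

Section Eigenfunctions.
Variables (R : realType) (p : nat) (hp : prime p).
Variables (mu : {measure set (Qp hp) -> \bar R}) (hmu : is_haar mu) (m : nat).
Local Notation K := (Qp hp).
Local Notation Z := (padic_int hp).
Local Notation P := (p%:R : R).
Local Notation fn := (K -> R[i]).
Local Notation unitsZp := (unitsZp p).
Local Notation level := (@level p hp m).
Local Notation rep := (@rep p hp m).
Local Notation lift := (zlift hp).
Local Notation iota := (@FracField.tofrac (padic_int hp) : padic_int hp -> Qp hp).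

Lemma indic_psphere (j k : 'I_m) (x : K) : psphere (j : nat)%:Z x ->
  \1_(psphere (k : nat)%:Z) x = (j == k)%:R :> R.
Proof.
move=> jx; rewrite indicE; have [<-|jk] := eqVneq j k; first by rewrite mem_set.
rewrite memNset // => kx; have [/val_inj jkE] := psphere_uniq jx kx.
by rewrite jkE eqxx in jk.
Qed.

Lemma phi0E (Q : 'M[R]_m) (l j : 'I_m) (x : K) : psphere (j : nat)%:Z x ->
  @phi0 R p hp m Q l x = (Q j l)%:C.
Proof.
move=> jx; rewrite /phi0; congr (_%:C); rewrite (bigD1 j) //= (indic_psphere j jx) eqxx mulr1.
by rewrite big1 ?addr0 // => k kj; rewrite (indic_psphere k jx) eq_sym (negPf kj) mulr0.
Qed.

Lemma phi0_level (Q : 'M[R]_m) (l : 'I_m) N : (0 < N)%N -> level N (@phi0 R p hp m Q l).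
Proof.
move=> N0 c x cx.
by rewrite (phi0E Q l (ball_psphere N0 cx)) (phi0E Q l (rep_psphere hp c N0)).
Qed.

(** On a function constant on spheres the exchange inside a sphere vanishes, and summing over the
    balls of another sphere produces the factor 1 - 1/p of R. Hence D acts as R on such
    functions. *)
Lemma Dop_phi0 (Q : 'M[R]_m) (lam0 : 'rV[R]_m) (l : 'I_m) (x : K) :
  Q^T *m Q = 1%:M -> invmx Q *m Rmx R p m *m Q = diag_mx lam0 -> F m x ->
  Dop mu m (@phi0 R p hp m Q l) x = (lam0 0 l)%:C * @phi0 R p hp m Q l x.
Proof.
move=> Qo Qd Fx; have [[i b] cx] := (F_ball m x (ltn0Sn 0)).1 Fx.
have L := phi0_level Q l (ltn0Sn 0).
rewrite (level_Dop hmu (ltn0Sn 0) L cx) (L _ _ cx) (Dop_cells hmu) //.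
have pE j (a : unitsZp 1) : @phi0 R p hp m Q l (rep (j, a)) = (Q j l)%:C.
  exact/phi0E/(rep_psphere hp (j, a) (ltn0Sn 0)).
rewrite [X in _ + X]big1 ?addr0; last by move=> a _; rewrite !pE subrr mulr0.
rewrite pE -rmorphM /= -(Rmx_eigen Qo Qd) mulr_sumr rmorph_sum; apply: eq_bigr => j _ /=.
under eq_bigr => a _ do rewrite !pE -rmorphB -rmorphM /=.
rewrite sumr_const -rmorphMn /=; congr (_%:C).
by rewrite -(unitsZp_density R hp (ltn0Sn 0)) -mulr_natr; ring.
Qed.

Section Character.
Variables (chi : fn) (hchi : is_character chi).

Lemma chi1 : chi 1 = 1.
Proof.
have [_ chiM chin _] := hchi.
have u1 : Zpunits (1 : K) by exists 1; [exact: unitr1|exact: rmorph1].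
have := chiM _ _ u1 u1; rewrite mulr1 => h.
have c0 : chi 1 != 0 by rewrite -normr_eq0 chin // oner_neq0.
by apply: (mulfI c0); rewrite -h mulr1.
Qed.

Lemma chiM (u v : Z) : u \is a GRing.unit -> v \is a GRing.unit ->
  chi (iota (u * v)) = chi (iota u) * chi (iota v).
Proof.
move=> uu uv; have [_ h _ _] := hchi; rewrite rmorphM h //; first by exists u.
by exists v.
Qed.

Lemma chi_cong n (u v : Z) : (0 < n)%N -> trivial_on chi n -> u \is a GRing.unit ->
  cong n u v -> chi (iota v) = chi (iota u).
Proof.
move=> n0 tr uu /congP[z ->].
have -> : u + p%:R ^+ n * z = u * (1 + p%:R ^+ n * (z / u)).
  by rewrite mulrDr mulr1 mulrCA [u * _]mulrC divrK.
rewrite chiM //; last by rewrite zp_unit_addM ?unitr1.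
rewrite (tr (iota (1 + _))) ?mulr1 //; apply/pcosetP; exists (z / u).
by rewrite rmorphD rmorph1 rmorphM /= -/(iota _) iota_p.
Qed.

Variables (n : nat) (n0 : (0 < n)%N).

Definition chiX (g : unitsZp n) : R[i] := chi (iota (lift g)).

Lemma chiX_unit_class (u : Z) : trivial_on chi n -> u \is a GRing.unit -> chiX
  (unit_class n u) = chi (iota u).
Proof. by move=> tr uu; apply: (chi_cong n0) => //; exact: cong_lift. Qed.

Lemma chiXM (g h : unitsZp n) : trivial_on chi n -> chiX (g * h)%g = chiX g * chiX h.
Proof.
move=> tr; have ug := zlift_unit hp g n0; have uh := zlift_unit hp h n0.
rewrite -{1}(unit_class_lift hp g n0) -{1}(unit_class_lift hp h n0) -unit_classM //
  chiX_unit_class ?unitrM ?ug //.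
by rewrite chiM.
Qed.

Lemma phichi_rep (l j : 'I_m) (a : unitsZp n) : 
  phichi chi l (rep (j, a)) = if j == l then chiX a else 0.
Proof.
rewrite /phichi (indic_psphere l (rep_psphere hp (j, a) n0)) /=.
case: eqP => [->|]; rewrite ?mulr0 // mulr1 /rep /= mulrA mulVf ?mul1r //.
by rewrite expf_neq0 // qp_p_neq0.
Qed.

Lemma phichi_level (l : 'I_m) : trivial_on chi n -> level n (phichi chi l).
Proof.
move=> tr [j a] x cx; rewrite phichi_rep /phichi (indic_psphere l (ball_psphere n0 cx)) /=.
case: eqP => [jl|]; rewrite ?mulr0 // mulr1; move: cx => /(pballP _ _ n0)[u [uu -> /= <-]].
by rewrite jl mulrA mulVf ?mul1r ?expf_neq0 ?qp_p_neq0 // chiX_unit_class.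
Qed.

Hypothesis hn : has_conductor chi n.

Lemma conductor_trivial : trivial_on chi n.
Proof. by move: n0 hn; case: (n) => // k _ []. Qed.

(** Minimality of the conductor, or non-triviality of chi when k = 0, provides an element of the
    subgroup with chi different from 1; translating by it multiplies the sum by that value. *)
Lemma chi_principal_units_sum0 k :
  (k < n)%N -> \sum_(g : unitsZp n | principal_units hp k g) chiX g = 0.
Proof.
move=> kn; have tr := conductor_trivial.
have [h hh Xh] : exists2 h : unitsZp n, principal_units hp k h & chiX h != 1.
  have [v [uv vk vX]] : exists v, [/\ v \is a GRing.unit, cong k 1 v & chi (iota v) <> 1].
    apply: contrapT => /forallNP hv; case: k kn hv => [|k] kn hv.
      have hnt : ~ (forall u, Zpunits u -> chi u = 1).
        by move: n0 hn; case: (n) => // k' _ [].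
      apply: hnt => u [v uv <-].
      by apply: contrapT => vX; apply: (hv v); split=> //; rewrite /cong !zpres_x0.
    have [_ _ /(_ k.+1)] : [/\ ~ (forall u, Zpunits u -> chi u = 1), trivial_on chi n &
           forall k, (0 < k < n)%N -> ~ trivial_on chi k] by move: n0 hn; case: (n).
    rewrite kn => /(_ isT); apply=> u /pcosetP[z uz]; apply: contrapT => uX.
    apply: (hv (1 + p%:R ^+ k.+1 * z)); split.
    - by rewrite zp_unit_addM ?unitr1.
    - by apply/congP; exists z.
    by rewrite rmorphD rmorph1 rmorphM /= -/(iota _) iota_p -uz.
  exists (unit_class n v).
    by apply: cong_trans vk _; apply: (cong_le (ltnW kn)); exact: cong_lift.
  by rewrite chiX_unit_class //; exact/eqP.
apply/eqP; have : chiX h *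
  (\sum_(g | principal_units hp k g) chiX g) = \sum_(g | principal_units hp k g) chiX g.
  rewrite mulr_sumr [RHS](reindex_inj (mulgI h)).
  rewrite [RHS](eq_bigl (fun g => principal_units hp k g)); last by move=> g;
    rewrite principal_units_mul // ltnW.
  by apply: eq_bigr => g _; rewrite chiXM.
move/eqP; rewrite -subr_eq0 -{2}[\sum_(_ | _) _]mul1r -mulrBl mulf_eq0 subr_eq0.
by rewrite (negPf Xh).
Qed.

Lemma chi_coset_sum k (b : unitsZp n) : (0 < k < n)%N ->
  \sum_(a : unitsZp n | cong k (lift a) (lift b)) (chiX a - chiX b) = - chiX b * (P ^+ (n - k))%:C.
Proof.
move=> /andP[k0 kn]; have tr := conductor_trivial.
rewrite (reindex_inj (mulIg b)) /= (eq_bigl (fun g => principal_units hp k g)); last first.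
  by move=> g; rewrite cong_sym principal_unitsE // ?mulgK // ltnW.
rewrite (eq_bigr (fun g => chiX b * chiX g - chiX b)); last first.
  by move=> g _; rewrite chiXM // mulrC.
rewrite sumrB -mulr_sumr chi_principal_units_sum0 // mulr0 sub0r mulNr; congr (- _).
rewrite -natrX rmorph_nat -(card_principal_units hp) ?k0 ?(ltnW kn) // natr_sum mulr_sumr.
by apply: eq_bigr => g _; rewrite mulr1.
Qed.

Lemma chi_sum0 : \sum_(g : unitsZp n) chiX g = 0.
Proof.
by rewrite -[RHS](chi_principal_units_sum0 n0); apply: eq_bigl => g; rewrite principal_units0.
Qed.

Lemma chi_total_sum (b : unitsZp n) :
  \sum_(a : unitsZp n) (chiX a - chiX b) = - chiX b * (#|{: unitsZp n}|%:R)%:C.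
Proof.
by rewrite sumrB chi_sum0 sub0r sumr_const rmorph_nat mulNr mulr_natr.
Qed.

(* The first term is the rate of leaving the sphere of radius p^-l; the k-th
   summand comes from the layer-cake expansion of |z - x|^-2 in [pabs_weight]. *)
Lemma lambda_layers (l : nat) :
  - ((2 - bdry R p m l) / P) -
  (P ^- n * (#|{: unitsZp n}|%:R + \sum_(1 <= k < n) (P ^+ (2 * k) - P ^+ (2 * k.-1)) * P ^+
    (n - k)))
  = lambda R p m n l.
Proof.
have p0 := p_neq0 R hp; rewrite mulrDr (unitsZp_density R hp n0) mulr_sumr.
rewrite (eq_big_nat _ _ (F2 := fun k => (P ^+ (2 * k) - P ^+ (2 * k.-1)) / P ^+ k)); last first.
  move=> k /andP[_ kn]; rewrite mulrCA; congr (_ * _); apply: (canLR (mulKf _));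
    rewrite ?expf_neq0 //.
  by rewrite -{2}(subnK (ltnW kn)) exprD mulfK // expf_neq0.
rewrite /lambda; case: n n0 => // k _.
have -> : P ^ (k.+1%:Z - 1) = P ^+ k by rewrite -addn1 PoszD addrK.
have -> : P ^ (k.+1%:Z - 2) = P ^+ k / P.
  by rewrite (_ : k.+1%:Z - 2 = k%:Z - 1) ?expfzDr ?exprN1 //; lia.
have -> : \sum_(1 <= k < k.+1) (P ^+ (2 * k) - P ^+
  (2 * k.-1)) / P ^+ k = P ^+ k + P ^+ k / P - 1 - P^-1.
  elim: k => [|k IHk]; first by rewrite big_geq // expr0; field.
  rewrite big_nat_recr //= IHk !mul2n -!addnn !exprD !exprS; field.
  by rewrite p0 expf_neq0.
by field.
Qed.

Lemma Dop_phichi (l : 'I_m) (x : K) : F m x ->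
  Dop mu m (phichi chi l) x = (lambda R p m n l)%:C * phichi chi l x.
Proof.
have tr := conductor_trivial; move=> Fx; have [[i b] cx] := (F_ball m x n0).1 Fx.
have L := phichi_level l tr.
rewrite (level_Dop hmu n0 L cx) (L _ _ cx) (Dop_cells hmu) // phichi_rep.
(* Off the sphere of index l only the values of chi on that sphere contribute, with one common
   weight, and they sum to 0. *)
have [il|il] := eqVneq i l; last first.
  rewrite mulr0 [X in _ + X]big1 ?addr0; last first.
    by move=> a _; rewrite phichi_rep (negPf il) subrr mulr0.
  rewrite big1 // => j _; have [jl|jl] := eqVneq j l; last first.
    by rewrite big1 // => a _; rewrite phichi_rep (negPf jl) subrr mulr0.
  rewrite (eq_bigr (fun a => (P ^- n * Pmx R p m i j)%:C * chiX a)); last first.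
    by move=> a _; rewrite phichi_rep jl eqxx subr0.
  by rewrite -mulr_sumr chi_sum0 mulr0.
rewrite -lambda_layers rmorphB mulrBl /= rmorphN mulNr; congr (_ + _).
  rewrite -(Pmx_sum_neq R hp) -il mulrC mulr_sumr rmorph_sum mulr_sumr -sumrN;
    apply: eq_bigr => j ji.
  under eq_bigr => a _ do rewrite phichi_rep (negPf ji) sub0r.
  rewrite sumr_const -(unitsZp_density R hp n0) -mulr_natr !rmorphM /= rmorph_nat; ring.
(* The layer-cake expansion requires a != b; for a = b both sides vanish together with the
   difference of the two values of chi. *)
rewrite (eq_bigr (fun a => (P ^- n)%:C * (chiX a - chiX b) + \sum_(1 <= k < n)
   ((P ^- n * (P ^+ (2 * k) - P ^+ (2 * k.-1)))%:C * ((cong k (lift a) (lift b))%:R *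
     (chiX a - chiX b))))); last first.
  move=> a _; rewrite phichi_rep il eqxx.
  have [->|ab] := eqVneq a b.
    by rewrite [in RHS]big1 => [|k _]; rewrite (subrr (chiX b)) !mulr0 ?addr0.
  rewrite (@pabs_weight _ _ _ n); last first.
    by rewrite -cong_unit_class ?zlift_unit ?unit_class_lift.
  rewrite [P ^- n * (1 + _)]mulrDr mulr1 rmorphD mulrDl; congr (_ + _).
  rewrite mulr_sumr rmorph_sum mulr_suml; apply: eq_bigr => k _ /=.
  by rewrite !rmorphM /= rmorph_nat; ring.
rewrite big_split /= -mulr_sumr chi_total_sum exchange_big /=.
rewrite (eq_big_nat _ _ (F2 := fun k => - ((P ^- n)%:C * ((P ^+ (2 * k) - P ^+
  (2 * k.-1)) * P ^+ (n - k))%:C * chiX b))); last first.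
  move=> k kn; rewrite -mulr_sumr.
  transitivity ((P ^- n * (P ^+ (2 * k) - P ^+ (2 * k.-1)))%:C * \sum_(a : unitsZp n | cong k
    (lift a) (lift b)) (chiX a - chiX b)).
    congr (_ * _); rewrite [RHS]big_mkcond; apply: eq_bigr => a _.
    by case: (cong _ _ _); rewrite ?mul1r ?mul0r.
  by rewrite chi_coset_sum // !rmorphM /=; ring.
rewrite sumrN -mulr_suml -mulr_sumr rmorphM rmorphD /= rmorph_sum /=; ring.
Qed.

End Character.
End Eigenfunctions.

(** * Weak eigenfunctions are locally constant *)

Section WeakFormulation.
Variables (R : realType) (p : nat) (hp : prime p).
Variables (mu : {measure set (Qp hp) -> \bar R}) (hmu : is_haar mu) (m : nat).
Local Notation K := (Qp hp).
Local Notation fn := (K -> R[i]).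
Local Notation cells := (cells p m).
Local Notation unitsZp := (unitsZp p).
Local Notation level := (@level p hp m).
Local Notation pball := (@pball p hp m).
Local Notation rep := (@rep p hp m).

Lemma eq_Fint (f g : fn) : {in F m, f =1 g} -> Fint mu m f = Fint mu m g.
Proof. by move=> fg; apply: eq_cintegral => x Fx; rewrite fg. Qed.

Lemma cintegrable_cmeasurable (A : set K) (f : fn) : cintegrable mu A f -> cmeasurable A f.
Proof. by move=> [f1 f2]; split; apply/measurable_EFinP;
  [exact: measurable_int f1|exact: measurable_int f2]. Qed.

Lemma sqr_normC (z : R[i]) : complex.Re (`|z| ^+ 2) = complex.Re z ^+ 2 + complex.Im z ^+ 2.
Proof. by case: z => a b;
  rewrite normc_def -[_ ^+ 2](rmorphXn (real_complex R)) /= sqr_sqrtr // addr_ge0 ?sqr_ge0. Qed.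

Lemma level_L2F N (f : fn) : (0 < N)%N -> level N f -> L2F mu m f.
Proof.
move=> N0 fN; split; first by apply: cintegrable_cmeasurable; exact: (cintegral_level1 hmu N0 fN).1.
have hN : level N (fun x => (complex.Re (`|f x| ^+ 2) / pabs R x)%:C).
  by move=> c x cx; rewrite (fN c x cx) (pabs_level R N0 cx).
have [[h1 _] _] := cintegral_level1 hmu N0 hN.
by apply: integrable_lty h1; exact: measurable_F.
Qed.

Lemma F_pabs_le1 (x : K) : F m x -> 0 < pabs R x <= 1.
Proof.
move=> Fx; rewrite pabs_gt0 ?(F_neq0 Fx) //=; have /F_psphere[k kx] := Fx.
rewrite (pabs_psphere R kx) -exprnN invf_le1 ?exprn_gt0 ?(p_gt0 R hp) //.
by rewrite exprn_ege1 // ler1n prime_gt0.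
Qed.

(** F has finite measure and |x|_p <= 1 on it, so |u| <= 1 + |u|^2 / |x|_p gives an integrable
    majorant. *)
Lemma L2F_cintegrable (u : fn) : L2F mu m u -> cintegrable mu (F m) u.
Proof.
move=> [[mr mi] fin]; have mF := @measurable_F p hp m.
have h (g : K -> R) : measurable_fun (F m) g ->
    (forall x, F m x -> `|g x| <= 1 + complex.Re (`|u x| ^+ 2) / pabs R x) ->
    mu.-integrable (F m) (EFin \o g).
  move=> mg gle; apply/integrableP; split; first exact/measurable_EFinP.
  have mq : measurable_fun (F m) (fun x => complex.Re (`|u x| ^+ 2) / pabs R x).
    apply: measurable_funM; last first.
      apply/measurable_EFinP.
      have hN : level 1 (fun x : K => ((pabs R x)^-1)%:C) by move=> c x cx;
        rewrite (pabs_level R (ltn0Sn 0) cx).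
      have [[h1 _] _] := cintegral_level1 hmu (ltn0Sn 0) hN.
      exact: measurable_int h1.
    rewrite (_ : (fun x => _) = (fun x => complex.Re (u x) ^+ 2 + complex.Im (u x) ^+ 2)).
      by apply: measurable_funD; exact: measurable_funX.
    by apply/funext => x; rewrite sqr_normC.
  apply: (@le_lt_trans _ _ (\int[mu]_(x in F m) (1%:E + (complex.Re
    (`|u x| ^+ 2) / pabs R x)%:E))%E).
    apply: ge0_le_integral => //.
    - by apply: measurableT_comp => //; exact/measurable_EFinP.
    by apply: emeasurable_funD => //; exact/measurable_EFinP.
  rewrite ge0_integralD //; first last.
  - exact/measurable_EFinP.
  - move=> x Fx; rewrite lee_fin divr_ge0 // ?sqr_normC ?addr_ge0 ?sqr_ge0 //.
    by have /andP[/ltW] := F_pabs_le1 Fx.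
  rewrite lte_add_pinfty // integral_cst // mul1e; exact: mu_F_fin.
have bound (a b : R) (x : K) : F m x -> `|a| <= 1 + (a ^+ 2 + b ^+ 2) / pabs R x.
  move=> Fx; have /andP[x0 x1] := F_pabs_le1 Fx.
  have h1 : a ^+ 2 <= (a ^+ 2 + b ^+ 2) / pabs R x.
    rewrite ler_pdivlMr // (@le_trans _ _ (a ^+ 2 * 1)) ?ler_wpM2l ?sqr_ge0 //.
    by rewrite mulr1 lerDl sqr_ge0.
  apply: (@le_trans _ _ (1 + a ^+ 2)); last by rewrite lerD2l.
  rewrite -[a ^+ 2](real_normK (num_real a)); move: (normr_ge0 a); move: `|a| => t t0.
  have := sqr_ge0 (t - 1); rewrite !expr2; nra.
split; apply: h => // x Fx; rewrite sqr_normC; first exact: bound.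
by rewrite addrC [_ ^+ 2 + _]addrC addrC; exact: bound.
Qed.

Lemma innerE (u g : fn) N : (0 < N)%N -> cintegrable mu (F m) u -> level N g ->
  inner mu m u (Dop mu m g) = inner mu m (Dop mu m (avg mu m N u)) g.
Proof.
move=> N0 ui unitsZp; rewrite /inner.
have gN' : level N (fun x => Num.conj (g x)) by exact: level_comp.
rewrite -(Fint_Dop_avg hmu N0 ui gN'); apply: eq_Fint => x /set_mem Fx.
by rewrite (Dop_conj hmu N0 Fx unitsZp).
Qed.

(** The function f and a given test function have a common level. There D is symmetric and averaging
    does not change f, so the pointwise equation implies the weak one. *)
Lemma level_eigen_DL2 N (f : fn) (lam : R[i]) : (0 < N)%N -> level N f ->
  (forall x, F m x -> Dop mu m f x = lam * f x) -> DL2 mu m f (fun x => lam * f x).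
Proof.
move=> N0 fN Df; have L : level N (fun x => lam * f x) by move=> c x cx; rewrite (fN c x).
split; [exact: level_L2F fN|exact: level_L2F L|move=> phi /locally_constant_level[N' N0' phiN]].
pose M := maxn N N'; have M0 : (0 < M)%N by rewrite leq_max N0.
have fM : level M f by apply: level_le fN; rewrite N0 leq_maxl.
have pM : level M phi by apply: level_le phiN; rewrite N0' leq_maxr.
rewrite (innerE M0 _ pM); last exact: (cintegral_level1 hmu N0 fN).1.
apply: eq_Fint => x /set_mem Fx; congr (_ * _); rewrite -Df //.
apply: (eq_Dop_level hmu M0 Fx _ fM); first exact: avg_level.
by move=> c; rewrite (avg_id hmu) //; exact: F_rep.
Qed.

Lemma level_eqF0 N (f : fn) (c : cells N) : (0 < N)%N -> level N f -> f (rep c) != 0 ->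
  ~ eqF mu m f (fun=> 0).
Proof.
move=> N0 fN fc h; have : mu (pball c) = 0%E.
  apply: measure_negligible; first exact: measurable_ball.
  apply: negligibleS h => x cx /=; apply/not_implyP; split; first exact: ball_subF cx.
  by rewrite (fN c x cx); exact/eqP.
by rewrite (haar_ball hmu) => /eqP; rewrite eqe invr_eq0 expf_eq0 (negPf (p_neq0 R hp)) andbF.
Qed.

End WeakFormulation.

(** * Averages over balls and the weak equation *)

Section Averages.
Variables (R : realType) (p : nat) (hp : prime p).
Variables (mu : {measure set (Qp hp) -> \bar R}) (hmu : is_haar mu) (m : nat).
Local Notation K := (Qp hp).
Local Notation P := (p%:R : R).
Local Notation fn := (K -> R[i]).
Local Notation cells := (cells p m).
Local Notation level := (@level p hp m).
Local Notation pball := (@pball p hp m).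
Local Notation rep := (@rep p hp m).
Local Notation avg := (avg mu m).

Lemma integral_ball_union N (g : K -> R) (Pr : pred (cells N)) : (0 < N)%N ->
  mu.-integrable (F m) (EFin \o g) -> (forall c : cells N, \int[mu]_(x in pball c) g x = 0) ->
  (\int[mu]_(x in \big[setU/set0]_(c | Pr c) pball c) (g x)%:E = 0)%E.
Proof.
move=> N0 gi h; rewrite -big_filter; set s := [seq _ <- _ | _].
have mS : measurable (\big[setU/set0]_(c <- s) pball c).
  by apply: bigsetU_measurable => c _; exact: measurable_ball.
rewrite integral_bigsetU_EFin //.
- rewrite big1_seq // => c _; rewrite -[X in X = _]fineK; first by congr (_%:E); exact: h.
  apply: integrable_fin_num; first exact: measurable_ball.
  by apply: integrableS gi; [exact: measurable_F|exact: measurable_ball|exact: ball_subF].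
- by move=> c; exact: measurable_ball.
- by rewrite filter_uniq ?index_enum_uniq.
- by move=> c c' _ _ [x [cx c'x]]; exact: (ball_inj N0 cx c'x).
apply: (measurable_funS (@measurable_F p hp m)) (measurable_int _ gi) => x.
by rewrite -bigcup_seq => -[c _]; exact: ball_subF.
Qed.

(* Dynkin induction from the open sets; an open set is the disjoint union over
   n of the unions [V n] of its maximal balls of level n + N0. *)
Lemma ae_zero_of_ball_integrals (g : K -> R) N0 : (0 < N0)%N ->
  mu.-integrable (F m) (EFin \o g) ->
  (forall N (c : cells N), (N0 <= N)%N -> \int[mu]_(x in pball c) g x = 0) ->
  {ae mu, forall x, F m x -> g x = 0}.
Proof.
move=> N00 gi h; have mF := @measurable_F p hp m.
have mE (E : set K) : measurable E -> measurable (E `&` F m) by move=> mE; exact: measurableI.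
have giE (E : set K) : measurable E -> mu.-integrable (E `&` F m) (EFin \o g).
  by move=> ?; apply: integrableS gi => //; exact: mE.
have F0 : (\int[mu]_(x in F m) (g x)%:E = 0)%E.
  rewrite (F_bigcup hp m N00); apply: integral_ball_union => // c; exact: h.
have main : forall E : set K, <<s @open K >> E -> (\int[mu]_(x in E `&` F m) (g x)%:E = 0)%E.
  apply: (@dynkin_induction _ _ (@open K)) => //.
  - by move=> A B; exact: openI.
  - by rewrite setTI.
  - move=> U oU; pose V n := \big[setU/set0]_(c : cells (n + N0) |
       `[< pball c `<=` U /\ forall n' (c' : cells (n' + N0)),
         (n' < n)%N -> pball c `<=` pball c' -> ~ (pball c' `<=` U) >]) pball c.
    have nN n : (0 < n + N0)%N by rewrite ltn_addl.
    have UV : U `&` F m = \bigcup_n V n.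
      apply/seteqP; split=> x; last first.
        move=> [n _]; rewrite /V -bigcup_seq_cond => -[c /= /andP[_ /asboolP[cU _]] cx].
        by split; [exact: cU|exact: ball_subF cx].
      move=> [Ux Fx]; have hex : exists n, `[< exists2 c : cells (n + N0),
        pball c x & pball c `<=` U >].
        have /nbhs_pcosetP[n nU] : nbhs x U by move: oU; rewrite openE => /(_ x Ux).
        exists n; apply/asboolP; have [c cx] := (F_ball m x (nN n)).1 Fx; exists c => //.
        rewrite /pball (pcoset_eq cx); apply: subset_trans nU; apply: pcoset_le.
        by rewrite addnCA leq_addr.
      case: (ex_minnP hex) => n /asboolP[c cx cU] nmin; exists n => //.
      rewrite /V -bigcup_seq_cond; exists c => //=; rewrite mem_index_enum /=.
      apply/asboolP; split=> // n' c' n'n cc' c'U.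
      have : (n <= n')%N by apply: nmin; apply/asboolP; exists c' => //; exact: cc'.
      by rewrite leqNgt n'n.
    have mV n : measurable (V n) by apply: bigsetU_measurable => c _; exact: measurable_ball.
    rewrite UV integral_bigcup //; last 2 first.
    - suff dis n n' x : (n < n')%N -> V n x -> V n' x -> False.
        move=> n n' _ _ [x [nx n'x]]; have [nn'|nn'|//] := ltngtP n n'.
          by case: (dis _ _ _ nn' nx n'x).
        by case: (dis _ _ _ nn' n'x nx).
      case: n' => // n' nn'; rewrite /V -!bigcup_seq_cond.
      move=> [c /= /andP[_ /asboolP[cU _]] cx] [c' /= /andP[_ /asboolP[c'U hc']] c'x].
      have Fx : F m x := ball_subF (nN _) cx.
      (* The ball of x one level above [c'] contains [c'] and lies in [c], hence in U, against the
         maximality of [c']. *)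
      have [d dx] := (F_ball m x (nN n')).1 Fx.
      apply: (hc' n' d) => //; first by apply: ball_le dx c'x; rewrite nN leq_add2r leqnSn.
      by apply: subset_trans cU; apply: ball_le cx dx; rewrite nN leq_add2r.
    - by rewrite -UV; apply: giE; exact: (@measurable_open _ _ U).
    by rewrite eseries0 // => n _ _; apply: integral_ball_union => // c; apply: h; rewrite leq_addl.
  - move=> S mS S0; have : (\int[mu]_(x in (S `&` F m) `|` (~` S `&` F m)) (g x)%:E = 0)%E.
      by rewrite -setIUl setUv setTI.
    rewrite integral_setU; first 1 last.
    + exact: mE.
    + by apply: mE; exact: measurableC.
    + by rewrite -setIUl setUv setTI; exact: measurable_int gi.
    + by apply/disj_setPS => x [[Sx _] [nSx _]].
    by rewrite S0 add0e.
  move=> B mB tB B0; rewrite setI_bigcupl integral_bigcup //.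
  + by rewrite eseries0.
  + by apply: trivIset_setIr.
  + by move=> k; exact: mE.
  by rewrite -setI_bigcupl; apply: giE; exact: bigcupT_measurable.
have : ae_eq mu (F m) (EFin \o g) (fun=> 0%E).
  apply: integral_ae_eq => // E EF mE'; rewrite integral0.
  by rewrite -(setIidl EF); apply: main.
by apply: filterS => x /= gx /gx [].
Qed.

Lemma Fint_avgE N (u g : fn) : (0 < N)%N -> cintegrable mu (F m) u -> level N g ->
  Fint mu m (fun x => u x * g x) = Fint mu m (fun x => avg N u x * g x).
Proof.
move=> N0 ui unitsZp; rewrite (Fint_avg N0 ui unitsZp) (Fint_level hmu N0) //.
exact: avg_level.
Qed.

Lemma cells_testP N (a b : cells N -> R[i]) : (0 < N)%N ->
  (forall g : fn, level N g -> \sum_c a c * g (rep c) = \sum_c b c * g (rep c)) -> a =1 b.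
Proof.
move=> N0 h c; have := h (@step R p hp m N (fun c' => (c' == c)%:R)) (step_level _ N0).
rewrite (bigD1 c) //= [RHS](bigD1 c) //= !step_rep // eqxx !mulr1.
by rewrite !big1 ?addr0 // => i ic; rewrite step_rep // (negPf ic) mulr0.
Qed.

(** Tower property of conditional expectations, obtained by pairing both sides with functions of
    level N. *)
Lemma avg_avg N N' (u : fn) (x : K) : (0 < N <= N')%N -> cintegrable mu (F m) u -> F m x ->
  avg N (avg N' u) x = avg N u x.
Proof.
move=> NN' ui Fx; have /andP[N0 NN] := NN'; have N0' := leq_trans N0 NN.
have ai : cintegrable mu (F m) (avg N' u) by exact: (cintegral_level1 hmu N0'
  (avg_level _ _ N0')).1.
have [c cx] := (F_ball m x N0).1 Fx.
rewrite (avg_level _ _ N0 cx) [RHS](avg_level _ _ N0 cx); move: c {cx}.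
apply: (cells_testP N0) => g unitsZp.
have p0 : (P ^- N)%:C != 0 :> R[i].
  by rewrite fmorph_eq0 invr_eq0 expf_neq0 // (p_neq0 R hp).
apply: (mulfI p0); rewrite -!Fint_avg //.
by rewrite -Fint_avgE //; exact: level_le unitsZp.
Qed.

(** Tests of level N suffice: symmetry puts D on the average of u, and two functions of level N with
    the same pairings agree on F. *)
Lemma DL2_avg (u : fn) (lam : R[i]) N (x : K) : (0 < N)%N ->
  DL2 mu m u (fun x => lam * u x) -> F m x ->
  Dop mu m (avg N u) x = lam * avg N u x.
Proof.
move=> N0 [Lu Lf hw] Fx; have ui := L2F_cintegrable hmu Lu.
have aN := avg_level mu u N0 : level N (avg N u).
have [c cx] := (F_ball m x N0).1 Fx.
rewrite (level_Dop hmu N0 aN cx) (aN c x cx); move: c {cx}.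
apply: (cells_testP N0) => g unitsZp.
have gN' : level N (fun x => Num.conj (g x)) by exact: level_comp.
have := hw _ (level_locally_constant N0 gN').
rewrite (innerE hmu N0 ui gN') /inner.
have -> : Fint mu m (fun x => lam * u x * Num.conj (Num.conj (g x))) = lam * Fint mu m
  (fun x => u x * g x).
  rewrite /Fint mulrC -cintegralZ; last 2 first.
  - exact: measurable_F.
  - apply: (eq_cintegrable (@measurable_F p hp m)) (cintegrable_level N0 ui
      (level_comp2 (fun a b => a / b%:C) unitsZp (pabs_level R N0))) => y _.
    by rewrite mulrA.
  by apply: eq_cintegral => y _; rewrite conjCK; ring.
rewrite (Fint_avg N0 ui unitsZp) (Fint_level hmu N0); last 2 first.
- exact: level_Dop.
- by move=> c y cy; rewrite (unitsZp c y).
have p0 : (P ^- N)%:C != 0 :> R[i].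
  by rewrite fmorph_eq0 invr_eq0 expf_neq0 // (p_neq0 R hp).
rewrite mulrCA => /(mulfI p0) h.
under eq_bigr => c _ do rewrite -[g _]conjCK.
by rewrite h mulr_sumr; apply: eq_bigr => c _; rewrite mulrA.
Qed.

End Averages.

(** * Characters of the p-adic units and of their finite quotients *)

Section CharactersOfUnits.
Variables (R : realType) (p : nat) (hp : prime p).
Local Notation K := (Qp hp).
Local Notation Z := (padic_int hp).
Local Notation fn := (K -> R[i]).
Local Notation unitsZp := (unitsZp p).
Local Notation iota := (@FracField.tofrac (padic_int hp) : padic_int hp -> Qp hp).

(** For m = 1 the set F is the group of units of Z_p, so this step function is the inflation of X to
    the units, extended by 0. *)
Definition charN N (X : unitsZp N -> R[i]) : fn := @step R p hp 1 N (fun c => X c.2).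

Lemma Zpunits_F (x : K) : Zpunits x <-> F 1 x.
Proof.
split=> [[u uu <-]|/F_psphere[k /psphereP[u uu ->]]].
  by apply/F_psphere; exists ord0; apply/psphereP; exists u; rewrite ?mul1r.
by exists u => //; rewrite ord1 mul1r.
Qed.

Lemma Zpunits_iota (u : Z) : u \is a GRing.unit -> Zpunits (iota u).
Proof. by exists u. Qed.

Variables (N : nat) (N0 : (0 < N)%N).

Lemma charN_unit (X : unitsZp N -> R[i]) (u : Z) : u \is a GRing.unit ->
  charN X (iota u) = X (unit_class N u).
Proof.
move=> uu; rewrite /charN (stepE (c := (ord0, unit_class N u)) _ N0) //.
by apply/pballP => //; exists u; rewrite mul1r.
Qed.

Lemma charN_out (X : unitsZp N -> R[i]) (x : K) : ~ Zpunits x -> charN X x = 0.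
Proof.
move=> nx; rewrite /charN /step big1 // => c _; rewrite indicE memNset ?mulr0 // => cx.
by apply: nx; apply/Zpunits_F; exact: ball_subF cx.
Qed.

Lemma near_const_within_continuous (A : set K) (f : fn) :
  (forall x, A x -> \forall y \near x, f y = f x) ->
  {within A, continuous (f : K -> R[i]^o)}.
Proof.
move=> h; apply/subspace_continuousP => x Ax; apply: cvg_near_cst.
by apply: cvg_within; exact: h.
Qed.

Lemma charN_character (X : unitsZp N -> R[i]) : multiplicative_fun X -> is_character (charN X).
Proof.
move=> mX; split.
- exact: charN_out.
- move=> _ _ [u uu <-] [v uv <-]; rewrite -[LHS]/(charN X (iota u * iota v)) -rmorphM.
  by rewrite !charN_unit ?unitrM ?uu // unit_classM // mX.2.
- by move=> _ [u uu <-]; rewrite charN_unit // mfun_norm.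
apply: near_const_within_continuous => x /Zpunits_F Fx.
exact: (level_locally_constant N0 (step_level _ N0) Fx).
Qed.

Lemma charN_trivial_on (X : unitsZp N -> R[i]) : multiplicative_fun X -> trivial_on (charN X) N.
Proof.
move=> mX u /pcosetP[z ->].
have -> : 1 + p%:R ^+ N * iota z = iota (1 + p%:R ^+ N * z).
  by rewrite rmorphD rmorph1 rmorphM /= -!/(iota _) iota_p.
have u1 : (1 : Z) + p%:R ^+ N * z \is a GRing.unit by rewrite zp_unit_addM ?unitr1.
rewrite charN_unit // -[RHS]mX.1; congr X; rewrite -(unit_class1 hp N0);
  apply/esym/unit_classP => //.
  exact: unitr1.
by exists z.
Qed.

Lemma conductor_exists (chi : fn) : is_character chi -> trivial_on chi N ->
  ~ (forall u, Zpunits u -> chi u = 1) ->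
  exists2 n, (0 < n <= N)%N & has_conductor chi n.
Proof.
move=> hchi tr nt.
have hex : exists n, (0 < n)%N && `[< trivial_on chi n >].
  by exists N; rewrite N0; apply/asboolP.
case: (ex_minnP hex) => n /andP[n0 /asboolP tn] nmin; exists n.
  by rewrite n0 /=; apply: nmin; rewrite N0; apply/asboolP.
case: n n0 tn nmin => // n _ tn nmin; split=> // k /andP[k0 kn] tk.
have : (n.+1 <= k)%N by apply: nmin; rewrite k0; apply/asboolP.
by rewrite leqNgt kn.
Qed.

Lemma chiX_mfun (chi : fn) : is_character chi -> trivial_on chi N ->
  multiplicative_fun (@chiX R p hp chi N).
Proof.
move=> hchi tr; split=> [|g h]; last exact: chiXM.
by rewrite -(unit_class1 hp N0) chiX_unit_class ?unitr1 // rmorph1 chi1.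
Qed.

Lemma charN_chiX (chi : fn) : is_character chi -> trivial_on chi N ->
  charN (@chiX R p hp chi N) = chi.
Proof.
move=> hchi tr; apply/funext => x; have [[u uu <-]|nx] := pselect (Zpunits x).
  by rewrite charN_unit // chiX_unit_class.
by rewrite charN_out //; have [-> //] := hchi.
Qed.

Lemma chiX_charN (X : unitsZp N -> R[i]) : @chiX R p hp (charN X) N =1 X.
Proof. by move=> g; rewrite /chiX charN_unit ?zlift_unit // unit_class_lift. Qed.

Lemma unitZp_mulC (g h : unitsZp N) : (g * h = h * g)%g.
Proof. by apply: val_inj; rewrite /= mulrC. Qed.

End CharactersOfUnits.

Lemma real_complex_sum (R : realType) (I : finType) (f : I -> R) :
  (\sum_i f i)%:C = \sum_i (f i)%:C :> R[i].
Proof. exact: rmorph_sum. Qed.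

Lemma conjCM (R : realType) (a b : R[i]) : Num.conj (a * b) = Num.conj a * Num.conj b.
Proof. exact: rmorphM. Qed.

Lemma conjC_sum (R : realType) (I : finType) (f : I -> R[i]) :
  Num.conj (\sum_i f i) = \sum_i Num.conj (f i).
Proof. exact: rmorph_sum. Qed.

(** * Diagonalization of D at a fixed level *)

Section SpectralDecomposition.
Variables (R : realType) (p : nat) (hp : prime p).
Variables (mu : {measure set (Qp hp) -> \bar R}) (hmu : is_haar mu) (m : nat).
Local Notation K := (Qp hp).
Local Notation fn := (K -> R[i]).
Local Notation cells := (cells p m).
Local Notation unitsZp := (unitsZp p).
Local Notation level := (@level p hp m).
Local Notation rep := (@rep p hp m).
Variables (Q : 'M[R]_m) (lam0 : 'rV[R]_m).
Hypothesis Qorth : Q^T *m Q = 1%:M.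
Hypothesis Qdiag : invmx Q *m Rmx R p m *m Q = diag_mx lam0.

Lemma Q_row_orth (i j : 'I_m) : \sum_k Q i k * Q j k = (i == j)%:R.
Proof.
have := congr1 (fun M : 'M[R]_m => M i j) (mulmx1C Qorth); rewrite !mxE => <-.
by apply: eq_bigr => k _; rewrite mxE.
Qed.

Lemma Q_col_orth (i j : 'I_m) : \sum_k Q k i * Q k j = (i == j)%:R.
Proof.
have := congr1 (fun M : 'M[R]_m => M i j) Qorth; rewrite !mxE => <-.
by apply: eq_bigr => k _; rewrite mxE.
Qed.

(** Bounds the level of a listed function by its eigenvalue. The phi_0^l have level 1, so n = 1 puts
    no condition on nu. *)
Definition in_level_spectrum (nu : R) (n : nat) : Prop :=
  n = 1%N \/ exists2 l : 'I_m, (0 < n)%N & nu = lambda R p m n l.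

(* In the basis formed by the characters of (Z/p^N)^*, the trivial one is replaced
   by the columns of [Q], which mix the spheres of F. *)
Lemma level_span N : (0 < N)%N -> exists (e : cells N -> fn) (nu : cells N -> R),
  [/\ forall c, listed Q lam0 (nu c)%:C (e c),
      forall c, level N (e c),
      forall c x, F m x -> Dop mu m (e c) x = (nu c)%:C * e c x,
      forall c, exists2 n, in_level_spectrum (nu c) n & level n (e c) &
      forall f, level N f -> exists k : cells N -> R[i],
        forall x, F m x -> f x = \sum_c k c * e c x].
Proof.
move=> N0; have [X [mX Xinj Xspan]] := dual_basis R[i] (@unitZp_mulC p N).
have [i0 X0] : exists i0, (fun=> 1) =1 X i0.
  apply: (dual_basis_complete (@unitZp_mulC p N) mX Xspan).
  by split=> // *; rewrite mulr1.
have hn (i : unitsZp N) : exists n,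
  i != i0 -> (0 < n <= N)%N /\ has_conductor (@charN R p hp N (X i)) n.
  (* The value 0 at the trivial character is a placeholder: [e] and [nu] use the columns of [Q]
     there. *)
  have [->|ii0] := eqVneq i i0; first by exists 0%N.
  have [|||n nN hn] := @conductor_exists R p hp N N0 (@charN R p hp N (X i)).
  - exact: charN_character.
  - exact: charN_trivial_on.
  - move=> h; move/eqP: ii0; apply; apply: Xinj => g; rewrite -X0.
    rewrite -(chiX_charN hp N0 (X i)) /chiX h //.
    exact/Zpunits_iota/zlift_unit.
  by exists n.
have {hn} [nn hn] := choice hn.
pose e (c : cells N) : fn := if c.2 == i0 then @phi0 R p hp m Q c.1 else phichi (@charN R p hp N
  (X c.2)) c.1.
pose nu (c : cells N) : R := if c.2 == i0 then lam0 0 c.1 else lambda R p m (nn c.2) c.1.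
have trX i : trivial_on (@charN R p hp N (X i)) N by exact: charN_trivial_on.
have chX i : is_character (@charN R p hp N (X i)) by exact: charN_character.
exists e, nu; split.
- move=> [l i]; rewrite /e /nu /=; case: eqVneq => [_|/hn[/andP[n0 _] hc]]; [left|right].
    by exists l.
  by exists (nn i), l, (@charN R p hp N (X i)).
- move=> [l i]; rewrite /e /=; case: eqVneq => _; first exact: phi0_level.
  exact: phichi_level.
- move=> [l i] x Fx; rewrite /e /nu /=; case: eqVneq => [_|/hn[/andP[n0 _] hc]].
    exact: Dop_phi0.
  exact: Dop_phichi.
- move=> [l i]; rewrite /e /nu /=; case: eqVneq => [_|/hn[/andP[n0 _] hc]].
    by exists 1%N; [left|exact: phi0_level].
  exists (nn i); first by right; exists l.
  by apply: phichi_level => //; exact: (conductor_trivial n0 hc).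
move=> f fN.
have hc l := Xspan (fun g => f (rep (l, g))).
have {hc} [cf hcf] := choice hc.
(* The trivial-character parts of f form a vector indexed by spheres; its coordinates in the columns
   of [Q] are its inner products with them, since [Q] is orthogonal. *)
pose kk (c : cells N) : R[i] := if c.2 == i0 then \sum_l cf l i0 * (Q l c.1)%:C else cf c.1 c.2.
exists kk => x Fx; have [[j a] cx] := (F_ball m x N0).1 Fx.
rewrite (fN _ x cx) hcf.
have eN c : level N (e c).
  case: c => l i; rewrite /e /=; case: eqVneq => _; first exact: phi0_level.
  exact: phichi_level.
under [RHS]eq_bigr => c _ do rewrite (eN c _ x cx).
rewrite -(pair_big xpredT xpredT (fun (l : 'I_m) (i : unitsZp N) => kk (l, i) * e (l, i) (rep (j,
  a)))) /=.
rewrite exchange_big /= (bigD1 i0) //= [RHS](bigD1 i0) //=; congr (_ + _).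
  rewrite -X0 mulr1 /kk /e /= eqxx.
  transitivity (\sum_l cf l i0 * (\sum_k Q l k * Q j k)%:C).
    rewrite (bigD1 j) //= Q_row_orth eqxx mulr1 big1 ?addr0 // => l lj.
    by rewrite Q_row_orth (negPf lj) mulr0.
  rewrite (eq_bigr (fun l => \sum_k cf l i0 * (Q l k * Q j k)%:C)); last first.
    by move=> l _; rewrite real_complex_sum mulr_sumr.
  rewrite exchange_big; apply: eq_bigr => k _ /=.
  rewrite (phi0E Q k (rep_psphere hp (j, a) N0)) mulr_suml; apply: eq_bigr => l _.
  by rewrite rmorphM mulrA.
apply: eq_bigr => i ii0; rewrite (bigD1 j) //= big1 ?addr0.
  by rewrite /kk /e /= (negPf ii0) phichi_rep // eqxx chiX_charN.
by move=> l lj; rewrite /kk /e /= (negPf ii0) phichi_rep // eq_sym (negPf lj) mulr0.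
Qed.

(** Instead of comparing coefficients, let w collect the terms of v whose eigenvalue is not lam.
    Then w also satisfies D w = lam w, so by symmetry it is orthogonal to each [e j] with another
    eigenvalue, hence to itself. *)
Lemma level_eigenspace N (e : cells N -> fn) (nu : cells N -> R) (v : fn) (lam : R[i]) :
  (0 < N)%N -> (forall c, level N (e c)) ->
  (forall c x, F m x -> Dop mu m (e c) x = (nu c)%:C * e c x) ->
  (exists k : cells N -> R[i], forall x, F m x -> v x = \sum_c k c * e c x) ->
  (forall x, F m x -> Dop mu m v x = lam * v x) -> level N v ->
  exists k : cells N -> R[i], forall x, F m x -> v x = \sum_(c | (nu c)%:C == lam) k c * e c x.
Proof.
move=> N0 eN De [k vE] Dv vN; exists k => x Fx; rewrite vE //.
pose k' c := if (nu c)%:C == lam then 0 else k c.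
pose w : fn := fun x => \sum_c k' c * e c x.
have wN : level N w by move=> c y cy; apply: eq_bigr => i _; rewrite (eN i c y).
suff w0 (c : cells N) : w (rep c) = 0.
  have [c cx] := (F_ball m x N0).1 Fx; have := w0 c; rewrite -(wN c x cx) /w.
  rewrite (bigID (fun c => (nu c)%:C == lam)) /= big1 => [|i il]; last by rewrite /k' il mul0r.
  rewrite add0r => w0x; rewrite (bigID (fun c => (nu c)%:C == lam)) /=.
  rewrite [X in _ + X = _](_ : _ = 0) ?addr0 // -[RHS]w0x.
  by apply: eq_bigr => i il; rewrite /k' (negPf il).
have Dw y : F m y -> Dop mu m w y = lam * w y.
  move=> Fy; rewrite (Dop_sum hmu k' N0 Fy eN).
  have : \sum_c ((nu c)%:C - lam) * (k c * e c y) = 0.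
    under eq_bigr => i _ do rewrite mulrBl.
    rewrite sumrB -mulr_sumr -vE // -Dv //.
    rewrite (eq_Dop_level hmu N0 Fy vN (v := fun x => \sum_c k c * e c x)); first last.
    - by move=> c'; rewrite vE //; exact: F_rep.
    - by move=> c' z c'z; apply: eq_bigr => i _; rewrite (eN i c' z).
    rewrite (Dop_sum hmu k N0 Fy eN) -sumrB big1 // => i _.
    by rewrite De // mulrCA subrr.
  move=> h; apply/eqP; rewrite -subr_eq0 mulr_sumr -sumrB -[X in _ == X]h; apply/eqP.
  apply: eq_bigr => i _; rewrite De // /k'; case: eqP => [->|_];
    first by rewrite !mul0r mulr0 !subrr mul0r.
  by ring.
have ortho j : (nu j)%:C != lam -> \sum_(c : cells N) w (rep c) * Num.conj (e j (rep c)) = 0.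
  move=> jl; have ejN : level N (fun x => Num.conj (e j x)) by exact: level_comp.
  have := cell_sum_Dop_sym hmu N0 wN ejN.
  under eq_bigr => c1 _ do rewrite (Dw _ (F_rep hp c1 N0)) -mulrA.
  under [RHS]eq_bigr => c1 _ do
    rewrite (Dop_conj hmu N0 (F_rep hp c1 N0) (eN j)) (De _ _
      (F_rep hp c1 N0)) conjCM conjC_real mulrCA.
  rewrite -!mulr_sumr => /eqP; rewrite -subr_eq0 -mulrBl mulf_eq0 subr_eq0 eq_sym.
  by rewrite (negPf jl) => /eqP.
have ww : \sum_(c : cells N) w (rep c) * Num.conj (w (rep c)) = 0.
  under eq_bigr => c1 _ do rewrite [X in _ * Num.conj X]/w conjC_sum mulr_sumr.
  rewrite exchange_big big1 //= => j _.
  have [jl|jl] := eqVneq (nu j)%:C lam.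
    by rewrite big1 // => c' _; rewrite /k' jl eqxx mul0r rmorph0 mulr0.
  under eq_bigr => c' _ do rewrite conjCM mulrCA.
  by rewrite -mulr_sumr ortho // mulr0.
have := psumr_eq0P (fun c _ => mul_conjC_ge0 (w (rep c))) ww => /(_ c isT) /eqP.
by rewrite mul_conjC_eq0 => /eqP.
Qed.

End SpectralDecomposition.

(** * Bounds on the eigenvalues, and weak eigenfunctions *)

Section Spectrum.
Variables (R : realType) (p : nat) (hp : prime p).
Variables (mu : {measure set (Qp hp) -> \bar R}) (hmu : is_haar mu) (m : nat).
Local Notation K := (Qp hp).
Local Notation Z := (padic_int hp).
Local Notation P := (p%:R : R).
Local Notation fn := (K -> R[i]).
Local Notation cells := (cells p m).
Local Notation level := (@level p hp m).
Local Notation pball := (@pball p hp m).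
Local Notation rep := (@rep p hp m).
Local Notation avg := (avg mu m).
Variables (Q : 'M[R]_m) (lam0 : 'rV[R]_m).
Hypothesis Qorth : Q^T *m Q = 1%:M.
Hypothesis Qdiag : invmx Q *m Rmx R p m *m Q = diag_mx lam0.

Lemma lambdaS n l : lambda R p m n.+1 l = - P ^+ n - P ^+ n / P + bdry R p m l / P.
Proof.
have p0 := p_neq0 R hp; rewrite /lambda; congr (- _ - _ + _).
  by rewrite -addn1 PoszD addrK.
by rewrite (_ : n.+1%:Z - 2 = n%:Z - 1) ?expfzDr ?exprN1 //; lia.
Qed.

Lemma bdry_le2 (l : 'I_m) : 0 < bdry R p m l <= 2.
Proof.
have p0 := p_gt0 R hp; have p1 := p_gt1 R hp; rewrite /bdry.
have -> : P ^ ((l : nat)%:Z + 1 - m%:Z) = P ^- (m - l.+1).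
  rewrite exprnN; congr (_ ^ _); have := ltn_ord l; lia.
have h k : 0 < P ^- k <= 1.
  by rewrite invr_gt0 exprn_gt0 //= invf_le1 ?exprn_gt0 // exprn_ege1 // ltW.
have /andP[a1 a2] := h l; have /andP[b1 b2] := h (m - l.+1)%N.
by apply/andP; split; lra.
Qed.

Lemma lambda_lt0 n (l : 'I_m) : (0 < n)%N -> lambda R p m n l < 0.
Proof.
case: n => // n _; rewrite lambdaS; have p0 := p_gt0 R hp; have p1 := p_gt1 R hp.
have /andP[_ b2] := bdry_le2 l.
have pn : 1 <= P ^+ n by rewrite exprn_ege1 // ltW.
have pi : 0 < P^-1 by rewrite invr_gt0.
have pi1 : P^-1 < 1 by rewrite invf_lt1.
by nra.
Qed.

Lemma lambda_bounded (lam : R[i]) : exists N0, (0 < N0)%N /\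
  forall n (l : 'I_m), (N0 <= n)%N -> (lambda R p m n l)%:C <> lam.
Proof.
(* Since lambda_{n+1} <= 2 - p^n <= 2 - n, it lies below the real part of lam as soon as n > 3 - Re
   lam. *)
pose r := 3 - complex.Re lam; pose N1 := Num.bound `|r|; exists N1.+1; split=> // -[//|n] l.
rewrite ltnS => Nn h; have : complex.Re lam = lambda R p m n.+1 l by rewrite -h.
rewrite lambdaS => hl.
have p0 := p_gt0 R hp; have p1 := p_gt1 R hp; have /andP[_ b2] := bdry_le2 l.
have pn : n%:R <= P ^+ n :> R.
  by rewrite -natrX ler_nat ltnW // ltn_expl // prime_gt1.
have r1 : r < n%:R.
  apply: le_lt_trans (ler_norm r) _; apply: lt_le_trans (archi_boundP (normr_ge0 r)) _.
  by rewrite ler_nat.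
have pi : 0 < P^-1 by rewrite invr_gt0.
have pi1 : P^-1 < 1 by rewrite invf_lt1.
have : 0 <= P ^+ n / P by rewrite divr_ge0 ?exprn_ge0 // ltW.
have : bdry R p m l / P <= 2 by nra.
rewrite /r in r1; lra.
Qed.

(* Maximum principle: R has positive off-diagonal entries and zero row sums. *)
Lemma Rmx_ker (l : 'I_m) : lam0 0 l = 0 -> forall i j, Q i l = Q j l.
Proof.
move=> l0 i j.
have p0 := p_gt0 R hp; have p1 := p_gt1 R hp.
have hk k : \sum_(j | j != k) Pmx R p m k j * (Q j l - Q k l) = 0.
  have := Rmx_eigen Qorth Qdiag k l; rewrite l0 mul0r => /eqP.
  rewrite mulf_eq0 subr_eq0 => /orP[/eqP e|/eqP //].
  have : P^-1 < 1 by rewrite invf_lt1.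
  by rewrite -e ltxx.
pose k0 := [arg max_(k > i) Q k l]%O.
have kmax k : Q k l <= Q k0 l by rewrite /k0; case: arg_maxP => // k' _; apply.
suff all k : Q k l = Q k0 l by rewrite all (all j).
have [->//|kk0] := eqVneq k k0.
have /psumr_eq0P h : forall j, j != k0 -> 0 <= Pmx R p m k0 j * (Q k0 l - Q j l).
  by move=> k' _; rewrite mulr_ge0 ?subr_ge0 // mxE invr_ge0 exprn_ge0 // ltW.
have := h _ k kk0; rewrite (eq_bigr (fun j => - (Pmx R p m k0 j * (Q j l - Q k0 l)))); last first.
  by move=> k' _; rewrite -mulrN opprB.
rewrite sumrN hk oppr0 => /(_ erefl) /eqP; rewrite mulf_eq0 subr_eq0 mxE invr_eq0.
by rewrite expf_eq0 gt_eqF // andbF /= => /eqP.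
Qed.

(** By [Rmx_ker] another column with eigenvalue 0 would be constant, and orthogonality to the
    constant column 0 would then make it vanish. *)
Lemma lam0_neq0 (hm : (0 < m)%N) (l : 'I_m) :
  (forall k : 'I_m, Q k (Ordinal hm) = (Num.sqrt (m%:R : R))^-1) ->
  l != Ordinal hm -> lam0 0 l != 0.
Proof.
move=> Q0 l0; apply/eqP => /Rmx_ker h.
have s0 : (Num.sqrt (m%:R : R))^-1 != 0 by rewrite invr_eq0 gt_eqF // sqrtr_gt0 ltr0n.
have := Q_col_orth Qorth (Ordinal hm) l; rewrite eq_sym (negPf l0).
under eq_bigr => k _ do rewrite Q0 (h k (Ordinal hm)).
rewrite sumr_const card_ord => /eqP;
  rewrite mulrn_eq0 eqn0Ngt hm /= mulf_eq0 (negPf s0) /= => /eqP q0.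
have := Q_col_orth Qorth l l; rewrite eqxx big1 => [/eqP|k _]; first by rewrite eq_sym oner_eq0.
by rewrite (h k (Ordinal hm)) q0 mul0r.
Qed.

(* The ball averages of a weak eigenfunction are genuine eigenfunctions of each
   level.  As lambda_n tends to -oo, only finitely many levels carry the
   eigenvalue [lam], so the averages stabilize and [u] equals one of them. *)
Lemma DL2_listed (u : fn) (lam : R[i]) : DL2 mu m u (fun x => lam * u x) ->
  exists (n : nat) (c : 'I_n -> R[i]) (f : 'I_n -> fn),
    (forall i, listed Q lam0 lam (f i)) /\ eqF mu m u (fun x => \sum_(i < n) c i * f i x).
Proof.
move=> hD; have [Lu _ _] := hD; have ui := L2F_cintegrable hmu Lu.
have mF := @measurable_F p hp m.
have [N0 [N00 hN0]] := lambda_bounded lam.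
have key N : (N0 <= N)%N -> exists (e : cells N -> fn) (nu : cells N -> R) (k : cells N -> R[i]),
  [/\ forall c, listed Q lam0 (nu c)%:C (e c),
      forall c, exists2 n, in_level_spectrum p m (nu c) n & level n (e c) &
      forall x, F m x -> avg N u x = \sum_(c | (nu c)%:C == lam) k c * e c x].
  move=> NN; have N1 := leq_trans N00 NN.
  have [e [nu [h1 h2 h3 h4 h5]]] := level_span hmu Qorth Qdiag N1.
  have aN := avg_level mu u N1 : level N (avg N u).
  have [k hk] := level_eigenspace hmu N1 h2 h3 (h5 _ aN) (fun x => DL2_avg hmu N1 hD) aN.
  by exists e, nu, k.
(* A listed function with eigenvalue lam has level at most N0, so [avg N u] has level N0, and the
   tower property identifies it with [avg N0 u]. *)
have stable N x : (N0 <= N)%N -> F m x -> avg N u x = avg N0 u x.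
  move=> NN Fx; have [e [nu [k [h1 h2 h3]]]] := key N NN.
  rewrite -(@avg_avg _ _ _ _ hmu m N0 N u x _ ui Fx) ?N00 // [RHS](avg_id hmu N00 _ Fx) // =>
    c y cy.
  have Fy := ball_subF N00 cy.
  rewrite !h3 //; last exact: F_rep.
  apply: eq_bigr => i il; congr (_ * _); have [n hn en] := h2 i.
  apply: (level_le (N := n) (N' := N0) _ en) => //.
  case: hn => [->//|[l n0 nul]]; rewrite n0 /= leqNgt; apply/negP => /ltnW/hN0.
  by move=> /(_ l); apply; rewrite -nul; exact/eqP.
have [e [nu [k [h1 h2 h3]]]] := key N0 (leqnn _).
have ai : cintegrable mu (F m) (avg N0 u).
  by exact: (cintegral_level1 hmu N00 (avg_level _ _ N00)).1.
pose w : fn := fun x => u x + avg N0 u x * (-1).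
have wi : cintegrable mu (F m) w by apply: cintegrableD => //; exact: cintegrableZ.
have w0 N (c : cells N) : (N0 <= N)%N -> cintegral mu (pball c) w = 0.
  move=> NN; have N1 := leq_trans N00 NN; have mb := @measurable_ball p hp m N c.
  have uc : cintegrable mu (pball c) u by apply: cintegrableS ui => //; exact: ball_subF.
  have ac : cintegrable mu (pball c) (avg N0 u) by apply: cintegrableS ai => //; exact: ball_subF.
  rewrite cintegralD // ?cintegralZ //; last exact: cintegrableZ.
  have -> : cintegral mu (pball c) (avg N0 u) = cintegral mu (pball c) (fun=> avg N u (rep c)).
    apply: eq_cintegral => x /set_mem cx.
    by rewrite -(stable N) //; [exact: avg_level|exact: ball_subF cx].
  rewrite (cintegral_ball_cst hmu) /avg step_rep // mulrA -rmorphM mulVf; last first.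
    by rewrite expf_neq0 // (p_neq0 R hp).
  by rewrite mul1r mulrN1 subrr.
have wr := ae_zero_of_ball_integrals N00 wi.1 (fun N c NN => congr1 (@complex.Re R) (w0 N c NN)).
have wim := ae_zero_of_ball_integrals N00 wi.2 (fun N c NN => congr1 (@complex.Im R) (w0 N c NN)).
pose A := [pred c | (nu c)%:C == lam].
exists #|A|, (fun i => k (enum_val i)), (fun i => e (enum_val i)); split.
  by move=> i; have := enum_valP i; rewrite inE => /eqP <-.
apply: filterS2 wr wim => x /= h1' h2' Fx.
have : w x = 0 by apply: complex_eqP; rewrite ?h1' ?h2'.
rewrite /w mulrN1 => /eqP; rewrite subr_eq0 => /eqP ->; rewrite h3 //.
transitivity (\sum_(c in A) k c * e c x); last by rewrite big_enum_val.
by apply: eq_bigl => c; rewrite inE.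
Qed.

Lemma cmeasurableM (f g : fn) : cmeasurable (F m) f -> cmeasurable (F m) g ->
  cmeasurable (F m) (fun x => f x * g x).
Proof.
move=> [f1 f2] [g1 g2]; split.
  rewrite (_ : (fun x => _) = (fun x => complex.Re (f x) * complex.Re (g x) - complex.Im
    (f x) * complex.Im (g x))).
    by apply: measurable_funB; exact: measurable_funM.
  by apply/funext => x; rewrite cReM.
rewrite (_ : (fun x => _) = (fun x => complex.Re (f x) * complex.Im (g x) + complex.Im
  (f x) * complex.Re (g x))).
  by apply: measurable_funD; exact: measurable_funM.
by apply/funext => x; rewrite cImM.
Qed.

Lemma cmeasurableD (f g : fn) : cmeasurable (F m) f -> cmeasurable (F m) g ->
  cmeasurable (F m) (fun x => f x + g x).
Proof.
move=> [f1 f2] [g1 g2]; split.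
  rewrite (_ : (fun x => _) = (fun x => complex.Re (f x) + complex.Re (g x))).
    exact: measurable_funD.
  by apply/funext => x; rewrite cReD.
rewrite (_ : (fun x => _) = (fun x => complex.Im (f x) + complex.Im (g x))).
  exact: measurable_funD.
by apply/funext => x; rewrite cImD.
Qed.

Lemma cmeasurable_level N (f : fn) : (0 < N)%N -> level N f -> cmeasurable (F m) f.
Proof.
by move=> N0 fN; apply: cintegrable_cmeasurable; exact: (cintegral_level1 hmu N0 fN).1.
Qed.

Lemma L2F_integrable (u : fn) : cmeasurable (F m) u ->
  L2F mu m u <-> mu.-integrable (F m) (fun x => (complex.Re (`|u x| ^+ 2) / pabs R x)%:E).
Proof.
have mF := @measurable_F p hp m; move=> mu'; split=> [[_ fin]|ui]; last first.
  by split=> //; exact: integrable_lty ui.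
have [[m1 _] _] := (cmeasurableM (cmeasurableD (cmeasurableM mu' mu') mu') mu', tt).
have mi : measurable_fun (F m) (fun x => (complex.Re (`|u x| ^+ 2) / pabs R x)%:E).
  apply/measurable_EFinP; apply: measurable_funM; last first.
    by have [] := cmeasurable_level (ltn0Sn 0) (level_comp (fun r : R => (r^-1)%:C)
      (pabs_level R (ltn0Sn 0))).
  rewrite (_ : (fun x => _) = (fun x => complex.Re (u x) ^+ 2 + complex.Im (u x) ^+ 2)).
    by have [r1 r2] := mu'; apply: measurable_funD; exact: measurable_funX.
  by apply/funext => x; rewrite sqr_normC.
apply/integrableP; split=> //;
  rewrite (eq_integral (fun x => (complex.Re (`|u x| ^+ 2) / pabs R x)%:E)) //.
move=> x /set_mem Fx; rewrite gee0_abs // lee_fin divr_ge0 ?sqr_normC ?addr_ge0 ?sqr_ge0 //.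
by have /andP[/ltW] := F_pabs_le1 R Fx.
Qed.

Lemma L2F_lin (u v : fn) (a b : R[i]) : L2F mu m u -> L2F mu m v ->
  L2F mu m (fun x => a * u x + b * v x).
Proof.
have mF := @measurable_F p hp m.
move=> Lu Lv; have [mu' _] := Lu; have [mv' _] := Lv.
have ca (k : R[i]) : cmeasurable (F m) (fun=> k) by split; exact: measurable_cst.
have mw : cmeasurable (F m) (fun x => a * u x + b * v x).
  by apply: cmeasurableD; exact: cmeasurableM.
have iu := (L2F_integrable mu').1 Lu; have iv := (L2F_integrable mv').1 Lv.
(* The factors 2 come from |z + t|^2 <= 2 |z|^2 + 2 |t|^2. *)
pose A := 2 * complex.Re (`|a| ^+ 2); pose B := 2 * complex.Re (`|b| ^+ 2).
apply/(L2F_integrable mw).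
apply: le_integrable (integrableD mF (integrableZl mF A iu) (integrableZl mF B iv)) => //.
  have mr : cmeasurable (F m) (fun x => (a * u x + b * v x) * Num.conj (a * u x + b * v x)).
    apply: cmeasurableM => //; have [r1 r2] := mw; split.
      rewrite (_ : (fun x => _) = (fun x => complex.Re (a * u x + b * v x))) //.
      by apply/funext => x; case: (_ + _).
    rewrite (_ : (fun x => _) = (fun x => - complex.Im (a * u x + b * v x))).
      exact: measurable_funN.
    by apply/funext => x; case: (_ + _).
  apply/measurable_EFinP; apply: measurable_funM; last first.
    by have [] := cmeasurable_level (ltn0Sn 0) (level_comp (fun r : R => (r^-1)%:C)
      (pabs_level R (ltn0Sn 0))).
  by have [r _] := mr; under eq_fun do rewrite normCK.
move=> x Fx; have /andP[x0 _] := F_pabs_le1 R Fx.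
have pos (z : R[i]) : 0 <= complex.Re (`|z| ^+ 2) by rewrite sqr_normC addr_ge0 ?sqr_ge0.
have reM (z t : R[i]) : complex.Re (`|z * t| ^+ 2) = complex.Re (`|z| ^+ 2) * complex.Re
  (`|t| ^+ 2).
  by rewrite !sqr_normC cReM cImM; ring.
have par (z t : R[i]) : complex.Re (`|z + t| ^+ 2) <= 2 * complex.Re
  (`|z| ^+ 2) + 2 * complex.Re (`|t| ^+ 2).
  rewrite !sqr_normC cReD cImD; have := sqr_ge0 (complex.Re z - complex.Re t).
  have := sqr_ge0 (complex.Im z - complex.Im t); rewrite !expr2; lra.
set s := complex.Re (`|u x| ^+ 2) / pabs R x; set t := complex.Re (`|v x| ^+ 2) / pabs R x.
have s0 : 0 <= s by rewrite divr_ge0 // ltW.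
have t0 : 0 <= t by rewrite divr_ge0 // ltW.
have AB : complex.Re (`|a * u x + b * v x| ^+ 2) / pabs R x <= A * s + B * t.
  rewrite /s /t !mulrA -mulrDl ler_pM2r ?invr_gt0 //; apply: le_trans (par _ _) _.
  by rewrite !reM !mulrA.
apply: (@le_trans _ _ (A * s + B * t)%:E); last exact: lee_abs.
by rewrite gee0_abs lee_fin ?AB // divr_ge0 // ltW.
Qed.

Lemma eq_ae_cintegral (f g : fn) : cmeasurable (F m) f -> cmeasurable (F m) g -> 
  eqF mu m f g -> cintegral mu (F m) f = cintegral mu (F m) g.
Proof.
have mF := @measurable_F p hp m.
move=> [f1 f2] [g1 g2] fg; congr Complex; congr fine; apply: ae_eq_integral => //.
- exact/measurable_EFinP.
- exact/measurable_EFinP.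
- by apply: filterS fg => x h Fx; rewrite (h Fx).
- exact/measurable_EFinP.
- exact/measurable_EFinP.
by apply: filterS fg => x h Fx; rewrite (h Fx).
Qed.

(** The weak equation sees u only up to null sets, so it passes from v to u. *)
Lemma DL2_of_level (u : fn) (lam : R[i]) N (v : fn) : L2F mu m u -> (0 < N)%N -> level N v ->
  (forall x, F m x -> Dop mu m v x = lam * v x) -> eqF mu m u v ->
  DL2 mu m u (fun x => lam * u x).
Proof.
move=> Lu N0 vN Dv uv; have [_ Lv' hw] := level_eigen_DL2 hmu N0 vN Dv.
have ui := L2F_cintegrable hmu Lu; have mF := @measurable_F p hp m.
have [mu' _] := Lu; have mv := cmeasurable_level N0 vN.
have ck (k : R[i]) : cmeasurable (F m) (fun=> k) by split; exact: measurable_cst.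
split=> //.
  have := L2F_lin lam 0 Lu Lu; congr (L2F _ _ _); apply/funext => x.
  by rewrite mul0r addr0.
move=> phi lphi; have [N' N0' pN] := locally_constant_level lphi.
have main (g : fn) (k : R[i]) : level N' g ->
    inner mu m (fun x => k * u x) g = inner mu m (fun x => k * v x) g.
  move=> gM; have mg : cmeasurable (F m) (fun x => Num.conj (g x) / (pabs R x)%:C).
    apply: (cmeasurable_level N0'); apply: (level_comp2 (fun a b => Num.conj a / b%:C) gM).
    exact: pabs_level.
  apply: eq_ae_cintegral.
  - under eq_fun do rewrite -mulrA; apply: cmeasurableM => //; exact: cmeasurableM.
  - under eq_fun do rewrite -mulrA; apply: cmeasurableM => //; exact: cmeasurableM.
  by apply: filterS uv => x h Fx; rewrite h.
rewrite main // -hw //; have := main _ 1 (level_Dop hmu N0' pN).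
have e1 (g : fn) : (fun x => 1 * g x) = g by apply/funext => x; rewrite mul1r.
by rewrite !e1.
Qed.

End Spectrum.

(** * Multiplicities *)

Section Multiplicities.
Variables (R : realType) (p : nat) (hp : prime p).
Local Notation K := (Qp hp).
Local Notation fn := (K -> R[i]).
Local Notation unitsZp := (unitsZp p).
Local Notation iota := (@FracField.tofrac (padic_int hp) : padic_int hp -> Qp hp).
Local Open Scope card_scope.

Definition chars_trivial_on n : set fn := [set chi | is_character chi /\ trivial_on chi n].

(** Parametrizes the characters by a finite type, so that sets of functions can be counted as
    subsets of that type. *)
Lemma card_subset_chars n : (0 < n)%N -> exists f : unitsZp n -> fn,
  [/\ chars_trivial_on n = range f,
      forall S, S `<=` chars_trivial_on n -> S #= `I_#|[pred i : unitsZp n | `[< S (f i) >]]| &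
      injective f].
Proof.
move=> n0; have [X [mX Xinj Xspan]] := dual_basis R[i] (@unitZp_mulC p n).
pose f (i : unitsZp n) := @charN R p hp n (X i).
have finj : injective f.
  move=> i j ij; apply: Xinj => g; rewrite -(chiX_charN hp n0 (X i)) -(chiX_charN hp n0 (X j)).
  by rewrite -/(f i) -/(f j) ij.
have frange : chars_trivial_on n = range f.
  apply/seteqP; split=> [chi [hchi tr]|_ [i _ <-]]; last first.
    by split; [exact: charN_character|exact: charN_trivial_on].
  have [i hi] := dual_basis_complete (@unitZp_mulC p n) mX Xspan (chiX_mfun n0 hchi tr).
  exists i => //; rewrite -[RHS](charN_chiX n0 hchi tr) /f; congr charN.
  by apply/funext => g; rewrite hi.
exists f; split=> // S SC; set A := [pred i | _].
have -> : S = (f \o enum_val) @` [set: 'I_#|A|].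
  apply/seteqP; split=> [chi Schi|_ [i _ <-]]; last first.
    by have := enum_valP i; rewrite inE => /asboolP.
  have [i _ fi] : range f chi by rewrite -frange; exact: SC.
  have iA : i \in A by rewrite inE; apply/asboolP; rewrite fi.
  by exists (enum_rank_in iA i) => //=; rewrite enum_rankK_in.
apply: card_eq_trans (card_esym card_II); apply: inj_card_eq => i j _ _ /= /finj.
exact: enum_val_inj.
Qed.

Lemma card_chars_trivial_on n : (0 < n)%N -> chars_trivial_on n #= `I_#|{: unitsZp n}|.
Proof.
move=> n0; have [f [fr fS _]] := card_subset_chars n0.
have := fS _ (@subset_refl _ _); rewrite (@eq_card _ _ {: unitsZp n}) // => i; rewrite !inE.
by apply/asboolP; rewrite fr; exists i.
Qed.

Lemma card_chars_diff n (B : set fn) b : (0 < n)%N -> B `<=` chars_trivial_on n -> B #= `I_b ->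
  chars_trivial_on n `\` B #= `I_(#|{: unitsZp n}| - b).
Proof.
move=> n0 BC Bb; have [f [fr fS _]] := card_subset_chars n0.
have /card_eq_II hb : `I_#|[pred i : unitsZp n | `[< B (f i) >]]| #= `I_b.
  by apply: card_eq_trans Bb; rewrite card_eq_sym; exact: fS.
have := fS (chars_trivial_on n `\` B) (@subDsetl _ _ _).
rewrite (@eq_card _ _ (predC [pred i : unitsZp n | `[< B (f i) >]])); last first.
  move=> i; rewrite !inE; apply/asboolP/negP => [[_ nB] /asboolP //|nB].
  by split; [rewrite fr; exists i|move=> Bi; apply: nB; apply/asboolP].
by rewrite -hb -(cardC [pred i : unitsZp n | `[< B (f i) >]]) addKn.
Qed.

Lemma Zpunits_pcoset1 n (u : K) : (0 < n)%N -> pcoset (1, n) u -> Zpunits u.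
Proof.
move=> n0 /pcosetP[z ->]; exists (1 + p%:R ^+ n * z).
  by rewrite /= zp_unit_addM ?unitr1.
by rewrite rmorphD rmorph1 rmorphM /= -!/(iota _) iota_p.
Qed.

(** Conductor n + 1 means trivial on 1 + p^(n+1) Z_p but not on 1 + p^n Z_p; for n = 0 it means any
    non-trivial character of the units modulo p. The count is a difference of two group orders. *)
Lemma card_conductor n : (0 < n)%N ->
  [set chi : fn | is_character chi /\ has_conductor chi n] #= `I_(mult p n).
Proof.
(* [B 0] is not given by [trivial_on chi 0]: that would require chi = 1 on all of Z_p, whereas chi
   is 0 on non-units. *)
case: n => // n _; pose B k : set fn := if k is k'.+1 then chars_trivial_on k else [set chi |
  is_character chi /\ forall u, Zpunits u -> chi u = 1].
have -> : [set chi : fn | is_character chi /\ has_conductor chi n.+1] = chars_trivial_on n.+1 `\`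
  B n.
  apply/seteqP; split=> [chi [hchi [nt tr hk]]|chi [[hchi tr] nB]].
    split=> //; case: n hk {tr} => [|n] hk; first by move=> [_ /nt].
    by move=> [_ ]; apply: hk; rewrite ltnSn.
  split=> //; split=> //.
    case: n nB {tr} => [|n] nB h; apply: nB; split=> // u /Zpunits_pcoset1 zu.
    by apply: h; exact: zu.
  move=> k /andP[k0 kn] tk; case: n nB kn {tr} => [|n] nB kn.
    by rewrite ltnS leqNgt k0 in kn.
  by apply: nB; split=> // u /(pcoset_le (kn : (k <= n.+1)%N)) /tk.
have BC : B n `<=` chars_trivial_on n.+1.
  case: (n) => [|k] chi [hchi h]; split=> // u hu.
    by apply: h; exact: Zpunits_pcoset1 hu.
  by apply: h; exact: pcoset_le hu.
have Bb : B n #= `I_(if n is k.+1 then #|{: unitsZp n}| else 1%N).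
  case: (n) => [|k]; last exact: card_chars_trivial_on.
  have m1 : multiplicative_fun (fun _ : unitsZp 1 => 1 : R[i]) by split=> // *; rewrite mulr1.
  rewrite (_ : B 0%N = [set @charN R p hp 1 (fun=> 1)]); first exact: card_set1.
  apply/seteqP; split=> [chi [hchi h]|_ ->]; last first.
    split; first exact: charN_character.
    by move=> _ [u uu <-]; rewrite charN_unit.
  apply/funext => x; have [[u uu <-]|nx] := pselect (Zpunits x).
    by rewrite charN_unit // h //; exists u.
  by rewrite charN_out //; have [-> //] := hchi.
have := card_chars_diff (ltn0Sn n) BC Bb; rewrite (card_unitsZp hp (ltn0Sn n)) /=.
have p1 := prime_gt1 hp.
case: (n) => [|k]; first by rewrite expn0 mul1n /mult /= -!subn1 -subnDA.
rewrite card_unitsZp // /mult /= subSS subn1 -mulnBl expnS -{2}[(p ^ k)%N]mul1n -mulnBl subn1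
  subSS subn0.
by rewrite -mulnn mulnAC.
Qed.

Lemma phichi_inj (l : nat) (chi chi' : fn) : is_character chi -> is_character chi' ->
  phichi chi l = phichi chi' l -> chi = chi'.
Proof.
move=> [out1 _ _ _] [out2 _ _ _] h; apply/funext => x.
have [[u uu <-]|nx] := pselect (Zpunits x); last by rewrite out1 ?out2.
have := congr1 (fun f => f (p%:R ^+ l * iota u)) h; rewrite /phichi.
rewrite indicE mem_set ?mulr1; last by apply/psphereP; exists u.
by rewrite mulrA mulVf ?mul1r // expf_neq0 // qp_p_neq0.
Qed.

Lemma card_phichi n l : (0 < n)%N ->
  [set phichi chi l | chi in [set chi : fn | is_character chi /\ has_conductor chi n]]
  #= `I_(mult p n).
Proof.
move=> n0; apply: card_eq_trans (card_conductor n0); apply: inj_card_eq.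
move=> chi chi' /set_mem[h _] /set_mem[h' _]; exact: phichi_inj.
Qed.

(** The condition on [mult] excludes exactly p = 2, n = 1: there is no character of conductor 1 on
    the 2-adic units. *)
Lemma conductor_char_exists n : (0 < n)%N -> (0 < mult p n)%N ->
  exists2 chi : fn, is_character chi & has_conductor chi n.
Proof.
move=> n0 m0; apply: contrapT => h.
have := card_conductor n0; rewrite (_ : [set _ | _] = set0); last first.
  by apply/seteqP; split=> // chi [hchi hn]; apply: h; exists chi.
rewrite card_eq_sym card_eq0 => /eqP I0.
by have : `I_(mult p n) 0%N by []; rewrite I0.
Qed.

Lemma mult_gt0 n (chi : fn) : (0 < n)%N -> is_character chi -> has_conductor chi n ->
  (0 < mult p n)%N.
Proof.
move=> n0 hchi hn; rewrite lt0n; apply/eqP => m0.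
have := card_conductor n0; rewrite m0 II0 card_eq0 => /eqP h.
by have : [set chi : fn | is_character chi /\ has_conductor chi n] chi by []; rewrite h.
Qed.

End Multiplicities.

(** * Green's function *)

Section GreenFunction.
Variables (R : realType) (p : nat) (hp : prime p).
Variables (mu : {measure set (Qp hp) -> \bar R}) (hmu : is_haar mu) (m : nat).
Local Notation K := (Qp hp).
Local Notation Z := (padic_int hp).
Local Notation P := (p%:R : R).
Local Notation level := (@level p hp m).
Local Notation pball := (@pball p hp m).
Local Notation rep := (@rep p hp m).
Variables (l : 'I_m) (y : K).
Hypothesis hy : psphere (l : nat)%:Z y.
Local Notation lam n := (lambda R p m n l).
Local Notation B k := (pcoset (y, l + k)%N).

(* [layer_series] is the sum of [layer_coef k] over the balls [B k] around the
   pole containing x.  The coefficients are such that pairing the series with a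
   function of level N telescopes to -1/lambda_N on [B N] (see [series_tail]). *)
Definition layer_coef k : R := P ^+ k * ((lam k.+1)^-1 - (lam k)^-1).

Lemma pole_in_F : F m y. Proof. by apply/F_psphere; exists l. Qed.

Lemma lambda_decr k : lam k.+2 <= lam k.+1.
Proof.
have p0 := p_gt0 R hp; have p1 := p_gt1 R hp.
rewrite !lambdaS // lerD2r -!opprD lerN2 exprS.
have x0 : 0 < P ^+ k by rewrite exprn_gt0.
have pi : 0 < P^-1 by rewrite invr_gt0.
by rewrite lerD // ?ler_pM2r // ler_peMl // ltW.
Qed.

Lemma layer_coef_ge0 k : (0 < k)%N -> 0 <= layer_coef k.
Proof.
case: k => // k _; have l1 := lambda_lt0 R hp l (ltn0Sn k);
  have l2 := lambda_lt0 R hp l (ltn0Sn k.+1).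
rewrite mulr_ge0 ?exprn_ge0 ?ler0n // subr_ge0.
by rewrite lef_nV2 ?negrE // lambda_decr.
Qed.

Definition layer_coef_max : R := P / (1 - P^-1).

Lemma layer_coef_max_ge0 : 0 <= layer_coef_max.
Proof.
have p0 := p_gt0 R hp; have p1 := p_gt1 R hp.
by rewrite /layer_coef_max divr_ge0 ?ltW // subr_gt0 invf_lt1.
Qed.

(** The boundary term of lambda_k is at most 2/p <= 2 p^(k-1) / p, so -lambda_k >= p^(k-1) (1 -
    1/p); [layer_coef_max] is the constant that results. *)
Lemma lambdaV_bound k : (0 < k)%N -> 0 < - (lam k)^-1 <= layer_coef_max * P ^- k.
Proof.
case: k => // k _; have l1 := lambda_lt0 R hp l (ltn0Sn k).
have p0 := p_gt0 R hp; have p1 := p_gt1 R hp.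
have pi : 0 < P^-1 by rewrite invr_gt0.
have pi1 : P^-1 < 1 by rewrite invf_lt1.
have q0 : 0 < 1 - P^-1 by rewrite subr_gt0.
have x1 : 1 <= P ^+ k by rewrite exprn_ege1 // ltW.
have x0 : 0 < P ^+ k by rewrite exprn_gt0.
have /andP[_ b2] := bdry_le2 R hp l.
rewrite oppr_gt0 invr_lt0 l1 /= -invrN.
have -> : layer_coef_max * P ^- k.+1 = (P ^+ k * (1 - P^-1))^-1.
  by rewrite /layer_coef_max exprS !invfM mulrACA mulfV ?mul1r ?gt_eqF // mulrC.
rewrite lef_pV2 ?posrE ?mulr_gt0 ?oppr_gt0 // lambdaS //.
have : bdry R p m l * P^-1 <= 2 * P^-1 by rewrite ler_pM2r.
have : P^-1 * 2 <= P^-1 * 2 * P ^+ k by rewrite ler_peMr // mulr_ge0 ?ltW.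
by move=> h1 h2; nra.
Qed.

Lemma layer_coef_bound k : (0 < k)%N -> layer_coef k <= layer_coef_max.
Proof.
move=> k0; have /andP[_ h] := lambdaV_bound k0; have /andP[h2 _] := lambdaV_bound (ltn0Sn k).
have p0 := p_gt0 R hp; have x0 : 0 < P ^+ k by rewrite exprn_gt0.
apply: (@le_trans _ _ (P ^+ k * (layer_coef_max * P ^- k))).
  by rewrite ler_pM2l //; lra.
by rewrite mulrCA mulfV ?mulr1 // gt_eqF.
Qed.

Lemma layer_coef_pow k n : layer_coef k * P ^- (n + k) = P ^- n * ((lam k.+1)^-1 - (lam k)^-1).
Proof.
have p0 := p_neq0 R hp.
by rewrite /layer_coef exprD invfM mulrAC mulrCA mulfV ?mulr1 ?expf_neq0 // mulrC.
Qed.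

Lemma pole_ball_refl k : B k y. Proof. exact: pcoset_refl. Qed.

(** For x other than the pole, the number of balls [B 1], [B 2], ... that contain x. *)
Definition contact (x : K) : nat :=
  if ((l : nat)%:Z <= vp (x - y))%R then absz (vp (x - y) - (l : nat)%:Z)%R else 0%N.

Lemma pole_ball_contact k x : x != y -> (0 < k)%N -> B k x <-> (k <= contact x)%N.
Proof.
move=> xy k0; have s : psphere (vp (x - y)) (x - y) by apply: psphere_vp; rewrite subr_eq0.
rewrite (pcosetB _ s) /contact; move: (vp (x - y)) => v.
by case: (leP (l : nat)%:Z v) => h; split; lia.
Qed.

Lemma indic_pole_ball k x : x != y -> (0 < k)%N -> \1_(B k) x = (k <= contact x)%N%:R :> R.
Proof.
move=> xy k0; rewrite indicE; congr (_%:R); congr nat_of_bool.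
by apply/idP/idP => [/set_mem/(pole_ball_contact xy k0)|/(pole_ball_contact xy k0)/mem_set].
Qed.

Lemma pole_ball_sphere k x : (0 < k)%N -> B k x -> psphere (l : nat)%:Z x.
Proof. by move=> k0; apply: pcoset_psphere hy; rewrite -[ltnLHS]addn0 ltn_add2l. Qed.

Lemma level_pole_ball N k : (0 < k <= N)%N -> level N (\1_(B k) : K -> R).
Proof.
move=> /andP[k0 kN] c x cx; have N0 := leq_trans k0 kN; rewrite !indicE.
have h z z' : pball c z -> pball c z' -> B k z -> B k z'.
  move=> cz cz' Bz; have [e] := psphere_uniq (pole_ball_sphere k0 Bz) (ball_psphere N0 cz).
  rewrite (pcoset_eq Bz); apply: (pcoset_le (n := l + N)); first by rewrite leq_add2l.
  by rewrite e -(pcoset_eq cz).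
have rc := ball_rep hp c.
have -> : (x \in B k) = (rep c \in B k) by apply/idP/idP => /set_mem hz; apply/mem_set; exact: h hz.
by [].
Qed.

Definition layer_sum N (x : K) : R := \sum_(1 <= k < N) layer_coef k * \1_(B k) x.
(* [B k] contains x exactly for k <= [contact x], which makes the sum finite off
   the pole; the value 0 at the pole is arbitrary. *)
Definition layer_series (x : K) : R := if x == y then 0 else \sum_(1 <= k <
  (contact x).+1) layer_coef k.
Definition layer_tail N (x : K) : R := if x == y then 0 else layer_series x - layer_sum N x.

Lemma level_layer_sum N : (0 < N)%N -> level N (layer_sum N).
Proof.
move=> N0 c x cx; apply: eq_big_nat => k /andP[k0 kN].
by rewrite (level_pole_ball (N := N) _ cx) ?k0 ?(ltnW kN).
Qed.

Lemma layer_sum_contact N x : x != y -> layer_sum N x = \sum_(1 <= k < N |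
  (k <= contact x)%N) layer_coef k.
Proof.
move=> xy; rewrite big_mkcond; apply: eq_big_nat => k /andP[k0 _].
by rewrite indic_pole_ball //; case: (k <= _)%N; rewrite ?mulr1 ?mulr0.
Qed.

Lemma layer_seriesE N x : (0 < N)%N -> ~ B N x -> layer_series x = layer_sum N x.
Proof.
move=> N0 nB; have xy : x != y by apply: contra_not_neq nB => ->; exact: pole_ball_refl.
rewrite /layer_series (negPf xy) layer_sum_contact //.
have cN : (contact x < N)%N by rewrite ltnNge; apply/negP => /(pole_ball_contact xy N0).
rewrite [RHS](big_cat_nat (n := (contact x).+1)) //= [X in _ + X]big_nat_cond.
rewrite [X in _ + X]big_pred0 ?addr0; last by move=> k; apply/negP => /andP[/andP[h _]];
  rewrite leqNgt h.
rewrite [RHS]big_nat_cond [LHS]big_nat_cond; apply: eq_bigl => k.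
by rewrite ltnS; case: (1 <= k)%N; case: (k <= contact x)%N.
Qed.

Lemma layer_series_near (x : K) : F m x -> x != y -> \forall z \near x,
  layer_series z = layer_series x.
Proof.
move=> Fx xy; pose N := (contact x).+1.
have nB : ~ B N x by move=> /(pole_ball_contact xy (ltn0Sn _)); rewrite ltnn.
have N0 : (0 < N)%N by [].
have [c cx] := (F_ball m x N0).1 Fx.
apply/nbhs_pcosetP; exists (c.1 + N)%N; rewrite -(pcoset_eq cx) => z cz.
have lB : level N (\1_(B N) : K -> R) by apply: level_pole_ball; rewrite leqnn.
have nBz : ~ B N z.
  move=> Bz; have := lB c z cz; rewrite -(lB c x cx) !indicE mem_set // memNset //.
  by move=> /eqP; rewrite oner_eq0.
by rewrite (layer_seriesE N0 nBz) (layer_seriesE N0 nB) (level_layer_sum N0 cz)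
  (level_layer_sum N0 cx).
Qed.

Lemma layer_tail1 x : layer_tail 1 x = layer_series x.
Proof. by rewrite /layer_tail /layer_sum big_geq // subr0 /layer_series; case: eqP. Qed.

Lemma layer_tail_series N x : (0 < N)%N -> x != y ->
  (layer_tail N x)%:E = (\sum_(n <oo) (layer_coef (N + n) * \1_(B (N + n)) x)%:E)%E.
Proof.
move=> N0 xy; apply/esym/lim_near_cst => //; exists (contact x).+1 => // M /= cM.
rewrite sumEFin; congr (_%:E); rewrite /layer_tail (negPf xy).
pose L := (N + M)%N; have L0 : (0 < L)%N by rewrite ltn_addr.
have nB : ~ B L x.
  move=> /(pole_ball_contact xy L0); apply/negP; rewrite -ltnNge.
  by apply: leq_trans cM _; exact: leq_addl.
rewrite (layer_seriesE L0 nB) /layer_sum [X in _ = X - _](big_cat_nat (n := N)) //=;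
  last exact: leq_addr.
rewrite [RHS]addrAC subrr add0r.
have sh (f : nat -> R) : \sum_(N <= i < L) f i = \sum_(0 <= i < M) f (N + i)%N.
  by rewrite -{1}[N]add0n big_addn /L addKn; apply: eq_bigr => n _; rewrite addnC.
by rewrite sh.
Qed.

Lemma measurable_layer_tail N : (0 < N)%N -> measurable_fun (F m) (layer_tail N).
Proof.
move=> N0.
(* The factor 1 - 1_{B (N + M)} kills the approximants near the pole, so they converge there to the
   conventional value 0; at any other point they are eventually stationary. *)
apply: (@measurable_fun_cvg _ _ _ _ (fun M x => (layer_sum (N + M) x - layer_sum N x) *
  (1 - \1_(B (N + M)) x))).
  move=> M; have L0 : (0 < N + M)%N by rewrite ltn_addr.
  suff h : level (N + M) (fun x => ((layer_sum (N + M) x - layer_sum N x) * (1 - \1_(B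
    (N + M)) x))%:C).
    by have [] := cmeasurable_level hmu L0 h.
  have l1 := level_layer_sum L0.
  have l2 : level (N + M) (layer_sum N) by apply: level_le (level_layer_sum N0);
    rewrite N0 leq_addr.
  have l3 : level (N + M) (\1_(B (N + M)) : K -> R) by apply: level_pole_ball; rewrite L0 leqnn.
  by move=> c x cx; rewrite (l1 c x cx) (l2 c x cx) (l3 c x cx).
move=> x Fx; apply: cvg_near_cst; have [->|xy] := eqVneq x y.
  by apply: nearW => M; rewrite /layer_tail eqxx indicE mem_set ?subrr ?mulr0 //;
    exact: pole_ball_refl.
exists (contact x).+1 => // M /= cM; have L0 : (0 < N + M)%N by rewrite ltn_addr.
have nB : ~ B (N + M) x.
  move=> /(pole_ball_contact xy L0); apply/negP; rewrite -ltnNge.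
  by apply: leq_trans cM _; exact: leq_addl.
by rewrite /layer_tail (negPf xy) (layer_seriesE L0 nB) [\1_ _ _]indicE memNset // subr0 mulr1.
Qed.

Lemma integral_indic_pole_ball k (a : R) : (0 < k)%N -> 0 <= a ->
  (\int[mu]_(x in F m) (a * \1_(B k) x)%:E = (a * P ^- (l + k))%:E)%E.
Proof.
move=> k0 a0; have mF := @measurable_F p hp m; have mB := @measurable_pcoset p hp y (l + k)%N.
under eq_integral do rewrite EFinM.
rewrite ge0_integralZl_EFin //; last first.
  by apply/measurable_EFinP; exact: measurable_indic.
rewrite integral_indic // EFinM -(haar_pcoset hmu y); congr (_ * mu _)%E.
apply/seteqP; split=> [x []//|x Bx]; split=> //.
by apply/F_psphere; exists l; exact: pole_ball_sphere Bx.
Qed.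

Lemma point_bigcap : [set y] = \bigcap_k B k.
Proof.
apply/seteqP; split=> [x -> k _|x h]; first exact: pole_ball_refl.
apply: contrapT => /eqP xy; have := h (contact x).+1 I.
by move=> /(pole_ball_contact xy (ltn0Sn _)); rewrite ltnn.
Qed.

Lemma measurable_point : measurable ([set y] : set K).
Proof. by rewrite point_bigcap; apply: bigcapT_measurable => k; exact: measurable_pcoset. Qed.

Lemma mu_point0 : mu [set y] = 0%E.
Proof.
apply/eqP; rewrite eq_le measure_ge0 andbT; apply/lee_addgt0Pr => e e0; rewrite add0e.
pose k := Num.bound e^-1; apply: (@le_trans _ _ (mu (B k))).
  apply: (le_measure mu (mem_set measurable_point) (mem_set (@measurable_pcoset p hp y (l + k)%N))).
  by move=> x ->; exact: pole_ball_refl.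
rewrite (haar_pcoset hmu) lee_fin -[leRHS]invrK lef_pV2 ?posrE ?exprn_gt0 ?invr_gt0 ?(p_gt0 R hp)
  //.
apply: (@le_trans _ _ k%:R); first by rewrite ltW // archi_boundP // invr_ge0 ltW.
rewrite -natrX ler_nat (leq_trans (leq_addl l k)) // ltnW // ltn_expl // prime_gt1 //.
Qed.

Lemma ae_neq_point (f g : K -> \bar R) : (forall x, F m x -> x != y -> f x = g x) ->
  ae_eq mu (F m) f g.
Proof.
move=> fg; exists [set y]; split; [exact: measurable_point|exact: mu_point0|].
move=> x /= /not_implyP[Fx fgx]; apply: contrapT => /eqP xy; exact/fgx/fg.
Qed.

Lemma layer_tail_ge0 N x : (0 < N)%N -> 0 <= layer_tail N x.
Proof.
move=> N0; have [->|xy] := eqVneq x y; first by rewrite /layer_tail eqxx.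
rewrite -lee_fin layer_tail_series //; apply: nneseries_ge0 => n _ _.
by rewrite lee_fin mulr_ge0 ?layer_coef_ge0 ?ltn_addr // indicE.
Qed.

Lemma cvg_lambdaV N : (fun M => (lam (N.+1 + M))^-1) @ \oo --> (0 : R).
Proof.
have p0 := p_gt0 R hp; have p1 := p_gt1 R hp.
apply: (@squeeze_cvgr _ _ _ _ (fun M => - (layer_coef_max * P ^- N.+1) * P^-1 ^+ M) (fun=> 0)).
- apply: nearW => M; have /andP[h1 h2] := @lambdaV_bound (N.+1 + M) isT.
  rewrite exprD invfM -exprVn in h2; apply/andP; split; last by rewrite -oppr_ge0 ltW.
  by rewrite mulNr lerNl; apply: le_trans h2 _; rewrite !exprVn mulrA.
- rewrite -[X in _ --> X](mulr0 (- (layer_coef_max * P ^- N.+1))); apply: cvgM;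
  first exact: cvg_cst.
  by apply: cvg_expr; rewrite ger0_norm ?invr_ge0 ?ltW // invf_lt1.
exact: cvg_cst.
Qed.

Lemma series_tail N : (0 < N)%N ->
  (\sum_(n <oo) (layer_coef (N + n) * P ^- (l + (N + n)))%:E = (P ^- l * - (lam N)^-1)%:E)%E.
Proof.
case: N => // N _; apply: cvg_lim => //.
have -> : (fun M => \sum_(0 <= n < M) (layer_coef (N.+1 + n) * P ^- (l + (N.+1 + n)))%:E)%E =
    EFin \o (fun M => P ^- l * ((lam (N.+1 + M))^-1 - (lam N.+1)^-1)).
  apply/funext => M /=; rewrite sumEFin; congr (_%:E).
  rewrite (eq_bigr (fun n => P ^- l * ((lam (N.+1 + n.+1))^-1 - (lam (N.+1 + n))^-1))); last first.
    by move=> n _; rewrite layer_coef_pow addnS.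
  by rewrite -mulr_sumr telescope_sumr // addn0.
apply: cvg_EFin; first exact: nearW.
apply: cvgM; first exact: cvg_cst.
by rewrite -[X in _ --> X]add0r; apply: cvgB; [exact: cvg_lambdaV|exact: cvg_cst].
Qed.

(** Non-negative terms allow termwise integration, and the resulting series telescopes because
    1/lambda_M tends to 0. *)
Lemma integral_layer_tail N : (0 < N)%N ->
  (\int[mu]_(x in F m) (layer_tail N x)%:E = (P ^- l * - (lam N)^-1)%:E)%E.
Proof.
move=> N0; have mF := @measurable_F p hp m.
have mi k : measurable_fun (F m) (fun x => (layer_coef (N + k) * \1_(B (N + k)) x)%:E).
  apply/measurable_EFinP; apply: measurable_funM; first exact: measurable_cst.
  by apply: measurable_indic; exact: measurable_pcoset.
have pos k x : (0 <= (layer_coef (N + k) * \1_(B (N + k)) x)%:E)%E.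
  by rewrite lee_fin mulr_ge0 ?layer_coef_ge0 ?ltn_addr // indicE.
transitivity (\int[mu]_(x in F m) \sum_(n <oo) (layer_coef (N + n) * \1_(B (N + n)) x)%:E)%E.
  apply: ge0_ae_eq_integral => //.
  - by apply/measurable_EFinP; exact: measurable_layer_tail.
  - exact: ge0_emeasurable_sum.
  - by move=> x _; rewrite lee_fin layer_tail_ge0.
  - by move=> x _; exact: nneseries_ge0.
  by apply: ae_neq_point => x _ xy; exact: layer_tail_series.
rewrite integral_nneseries // -series_tail //; apply: eq_eseriesr => n _.
by rewrite integral_indic_pole_ball ?ltn_addr // layer_coef_ge0 // ltn_addr.
Qed.

Lemma integrable_layer_tail N : (0 < N)%N -> mu.-integrable (F m) (EFin \o layer_tail N).
Proof.
move=> N0; apply/integrableP; split; first by apply/measurable_EFinP; exact: measurable_layer_tail.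
rewrite (eq_integral (fun x => (layer_tail N x)%:E)) ?integral_layer_tail ?ltry //.
by move=> x _; rewrite gee0_abs // lee_fin layer_tail_ge0.
Qed.

(** The series is at most C times [contact x], and a square is a sum of consecutive odd numbers.
    This bounds the square by a combination of indicators of balls, whose integrals are known. *)
Lemma layer_series_sqr x : ((layer_series x ^+ 2)%:E <= \sum_(n <oo) (layer_coef_max ^+ 2 *
  (2 * n + 1)%:R * \1_(B n.+1) x)%:E)%E.
Proof.
have p0 := p_gt0 R hp; have p1 := p_gt1 R hp.
have C0 := layer_coef_max_ge0.
have pos z n : (0 <= (layer_coef_max ^+ 2 * (2 * n + 1)%:R * \1_(B n.+1) z)%:E)%E.
  by rewrite lee_fin; apply: mulr_ge0; [rewrite mulr_ge0 ?sqr_ge0|rewrite indicE].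
have [->|xy] := eqVneq x y.
  by rewrite /layer_series eqxx expr0n; apply: nneseries_ge0 => n _ _; exact: pos.
apply: le_trans (nneseries_lim_ge (contact x) (fun n _ _ => pos x n)).
rewrite sumEFin lee_fin /layer_series (negPf xy).
have h : \sum_(1 <= k < (contact x).+1) layer_coef k <= layer_coef_max * (contact x)%:R.
  rewrite big_add1 /= big_mkord; apply: (@le_trans _ _ (\sum_(i < contact x) layer_coef_max)).
    by apply: ler_sum => i _; exact: layer_coef_bound.
  by rewrite sumr_const card_ord mulr_natr.
have h0 : 0 <= \sum_(1 <= k < (contact x).+1) layer_coef k.
  by rewrite big_add1 /= big_mkord sumr_ge0 // => i _; exact: layer_coef_ge0.
apply: (@le_trans _ _ ((layer_coef_max * (contact x)%:R) ^+ 2)); first by apply: lerXn2r;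
  [exact: h0|exact: mulr_ge0|exact: h].
rewrite exprMn; set M := contact x.
rewrite (eq_big_nat _ _ (F2 := fun n => layer_coef_max ^+ 2 * (2 * n + 1)%:R)); last first.
  by move=> n /andP[_ nM]; rewrite indic_pole_ball // nM mulr1.
rewrite -mulr_sumr ler_wpM2l ?sqr_ge0 // -natr_sum -natrX ler_nat.
apply/eq_leq; elim: M => [|M IHM]; first by rewrite big_geq.
by rewrite big_nat_recr //= -IHM; ring.
Qed.

(** The worst case is p = 2, where the partial sums are 3 - (2n + 3) / 2^n. *)
Lemma odd_geometric_le3 n : \sum_(0 <= k < n) (2 * k + 1)%:R * P ^- k.+1 <= 3 :> R.
Proof.
have p0 := p_gt0 R hp; have p2 := p_ge2 R hp.
apply: (@le_trans _ _ (\sum_(0 <= k < n) (2 * k + 1)%:R * 2 ^- k.+1)).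
  apply: ler_sum => k _; rewrite ler_wpM2l // lef_pV2 ?posrE ?exprn_gt0 //.
  by rewrite lerXn2r // ?nnegrE ?ltW.
have -> : \sum_(0 <= k < n) (2 * k + 1)%:R * 2 ^- k.+1 = 3 - (2 * n + 3)%:R * 2 ^- n :> R.
  elim: n => [|n IHn]; first by rewrite big_geq // muln0 add0n expr0 invr1 mulr1 subrr.
  rewrite big_nat_recr //= IHn exprS !natrD !natrM; field.
  by rewrite expf_neq0.
by rewrite lerBlDr lerDl mulr_ge0 // invr_ge0 exprn_ge0.
Qed.

Lemma L2F_layer_series : L2F mu m (fun x => (layer_series x)%:C).
Proof.
have mF := @measurable_F p hp m; have p0 := p_gt0 R hp; have p1 := p_gt1 R hp.
have mW : measurable_fun (F m) layer_series.
  by rewrite (_ : layer_series = layer_tail 1); [exact: measurable_layer_tail|apply/funext => x;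
    rewrite layer_tail1].
split; first by split => //=; exact: measurable_cst.
have C0 := layer_coef_max_ge0.
pose S n x := layer_coef_max ^+ 2 * (2 * n + 1)%:R * \1_(B n.+1) x.
have c0 n : 0 <= layer_coef_max ^+ 2 * (2 * n + 1)%:R by rewrite mulr_ge0 ?sqr_ge0.
have S0 n x : (0 <= (S n x)%:E)%E by rewrite lee_fin mulr_ge0 // indicE.
have mS n : measurable_fun (F m) (fun x => (S n x)%:E).
  apply/measurable_EFinP; apply: measurable_funM; first exact: measurable_cst.
  by apply: measurable_indic; exact: measurable_pcoset.
have mSS : measurable_fun (F m) (fun x => (\sum_(n <oo)
  (S n x)%:E)%E) by exact: ge0_emeasurable_sum.
(* The weight 1/|x|_p is at most p^m on F. *)
apply: (@le_lt_trans _ _ (\int[mu]_(x in F m) ((P ^+ m)%:E * \sum_(n <oo) (S n x)%:E))%E).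
  apply: ge0_le_integral => //.
  - move=> x Fx; rewrite lee_fin divr_ge0 ?sqr_normC ?addr_ge0 ?sqr_ge0 //.
    by have /andP[/ltW] := F_pabs_le1 R Fx.
  - apply/measurable_EFinP;
    rewrite (_ : (fun x => _) = fun x => layer_series x * layer_series x * (pabs R x)^-1).
      apply: measurable_funM; first exact: measurable_funM.
      have := cmeasurable_level hmu (ltn0Sn 0) (level_comp (fun r : R => (r^-1)%:C) (pabs_level
        (m := m) (hp := hp) R (ltn0Sn 0))).
      by case.
    by apply/funext => x; rewrite sqr_normC /= expr0n addr0.
  - exact: emeasurable_funM.
  move=> x Fx; rewrite sqr_normC /= expr0n addr0 mulrC EFinM.
  have /andP[x0 _] := F_pabs_le1 R Fx.
  apply: lee_pmul; rewrite ?lee_fin ?invr_ge0 ?(ltW x0) ?sqr_ge0 //; last exact: layer_series_sqr.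
  have /F_psphere[k kx] := Fx; rewrite (pabs_psphere R kx) -exprnN invrK.
  by rewrite ler_weXn2l ?ltW // ltnW.
rewrite ge0_integralZl_EFin //; last by move=> x _; exact: nneseries_ge0.
rewrite integral_nneseries //.
apply: (@le_lt_trans _ _ ((P ^+ m)%:E * (layer_coef_max ^+ 2 * 3)%:E)%E);
  last by rewrite -EFinM ltry.
apply: lee_wpmul2l; first by rewrite lee_fin exprn_ge0 // ltW.
apply: lime_le; first by apply: is_cvg_nneseries => n _ _; exact: integral_ge0.
apply: nearW => M.
rewrite (eq_bigr (fun n => (layer_coef_max ^+ 2 * (2 * n + 1)%:R * P ^- (l + n.+1))%:E));
  last first.
  by move=> n _; rewrite integral_indic_pole_ball.
rewrite sumEFin lee_fin.
apply: (@le_trans _ _ (layer_coef_max ^+ 2 * \sum_(0 <= k < M) (2 * k + 1)%:R * P ^- k.+1)).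
  rewrite mulr_sumr; apply: ler_sum => n _; rewrite mulrA ler_wpM2l //.
  by rewrite lef_pV2 ?posrE ?exprn_gt0 // ler_weXn2l ?ltW // leq_addl.
by rewrite ler_wpM2l ?sqr_ge0 // odd_geometric_le3.
Qed.

End GreenFunction.

(** * Pairing the layer series with the listed functions *)

Section GreenPairing.
Variables (R : realType) (p : nat) (hp : prime p).
Variables (mu : {measure set (Qp hp) -> \bar R}) (hmu : is_haar mu) (m : nat).
Local Notation K := (Qp hp).
Local Notation Z := (padic_int hp).
Local Notation P := (p%:R : R).
Local Notation fn := (K -> R[i]).
Local Notation cells := (cells p m).
Local Notation unitsZp := (unitsZp p).
Local Notation level := (@level p hp m).
Local Notation pball := (@pball p hp m).
Local Notation rep := (@rep p hp m).
Local Notation lift := (zlift hp).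
Local Notation iota := (@FracField.tofrac (padic_int hp) : padic_int hp -> Qp hp).
Variables (l : 'I_m) (y : K).
Hypothesis hy : psphere (l : nat)%:Z y.
Local Notation lam n := (lambda R p m n l).
Local Notation B k := (pcoset (y, l + k)%N).
Local Notation layer_series := (@layer_series R p hp m l y).
Local Notation layer_sum := (@layer_sum R p hp m l y).
Local Notation layer_tail := (@layer_tail R p hp m l y).
Local Notation layer_coef := (@layer_coef R p m l).

Lemma pball_pole N (c : cells N) : (0 < N)%N -> pball c y -> pball c = B N.
Proof.
move=> N0 cy; have [e] := psphere_uniq hy (ball_psphere N0 cy).
by rewrite /pball (pcoset_eq cy) /= -e.
Qed.

(** The tail lives on [B N], where f equals f(y) and |x|_p = p^-l, so only the integral of the tail
    remains. *)
Lemma Fint_layer_tail N (f : fn) : (0 < N)%N -> level N f ->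
  Fint mu m (fun x => (layer_tail N x)%:C * f x) = (- (lam N)^-1)%:C * f y.
Proof.
move=> N0 fN; have mF := @measurable_F p hp m; have p0 := p_neq0 R hp.
have [c cy] := (F_ball m y N0).1 (pole_in_F hy).
have -> : Fint mu m (fun x => (layer_tail N x)%:C * f x) =
    cintegral mu (F m) (fun x => (layer_tail N x)%:C * (f y * (P ^+ l)%:C)).
  apply: eq_cintegral => x /set_mem Fx.
  have [BNx|nB] := pselect (B N x); last first.
    rewrite /layer_tail; case: eqP => [->|_]; first by rewrite !mul0r.
    by rewrite (layer_seriesE R N0 nB) subrr !mul0r.
  rewrite (pabs_psphere R (pole_ball_sphere hy N0 BNx)) -exprnN -mulrA.
  move: BNx; rewrite -(pball_pole N0 cy) => cx; rewrite (fN c x cx) (fN c y cy).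
  by rewrite fmorphV invrK.
rewrite cintegralZ //; last first.
  by split; [exact: integrable_layer_tail|exact: integrable0].
rewrite cintegral_real /Rintegral (integral_layer_tail hmu hy N0) /=.
by rewrite [f y * _]mulrC mulrA -rmorphM /= mulrAC mulVf ?mul1r // expf_neq0.
Qed.

Lemma Fint_layer_series N (f : fn) : (0 < N)%N -> level N f ->
  Fint mu m (fun x => (layer_series x)%:C * f x) =
  (P ^- N)%:C * (\sum_(1 <= k < N) (layer_coef k)%:C * \sum_(c : cells N) (\1_(B k)
    (rep c))%:C * f (rep c))
  + (- (lam N)^-1)%:C * f y.
Proof.
move=> N0 fN; have mF := @measurable_F p hp m.
have lW : level N (fun x => (layer_sum N x)%:C) by exact: (level_comp (real_complex R)
  (level_layer_sum R hy N0)).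
have lP : level N (fun x => ((pabs R x)%:C)^-1).
  exact: (level_comp (fun r : R => (r%:C)^-1) (pabs_level R N0)).
have mf := cmeasurable_level hmu N0 fN; have mP := cmeasurable_level hmu N0 lP.
have mWN := cmeasurable_level hmu N0 lW.
have mT : cmeasurable (F m) (fun x => (layer_tail N x)%:C).
  by split; [exact: (measurable_layer_tail hmu hy N0)|exact: measurable_cst].
have [mW _] := L2F_layer_series hmu hy.
have -> : Fint mu m (fun x => (layer_series x)%:C * f x) =
  Fint mu m (fun x => (layer_sum N x)%:C * f x + (layer_tail N x)%:C * f x).
  apply: eq_ae_cintegral => //.
  - by apply: cmeasurableM => //; exact: cmeasurableM.
  - by apply: cmeasurableM => //; apply: cmeasurableD; exact: cmeasurableM.
  (* The splitting can fail at the pole, where [layer_series] and [layer_tail] are set to 0 but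
     [layer_sum] may not be 0; a point is a null set. *)
  exists [set y]; split; [exact: (measurable_point l y)|exact: (mu_point0 hmu l y)|].
  move=> x /= /not_implyP[Fx h]; apply: contrapT => /eqP xy; apply: h.
  by rewrite /layer_tail (negPf xy) -mulrDl -rmorphD /= subrKC.
rewrite /Fint.
under eq_cintegral do rewrite mulrDl.
rewrite cintegralD //.
- rewrite -![cintegral _ _ _]/(Fint _ _ _) Fint_layer_tail //; congr (_ + _).
  rewrite -[LHS]/(Fint mu m (fun x => (layer_sum N x)%:C * f x)) (Fint_level hmu N0 lW fN).
  congr (_ * _).
  under eq_bigr => c _ do rewrite /layer_sum rmorph_sum mulr_suml.
  rewrite exchange_big /=; apply: eq_bigr => k _; rewrite mulr_sumr.
  by apply: eq_bigr => c _; rewrite rmorphM /= mulrA.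
- have L : level N (fun x => (layer_sum N x)%:C * f x / (pabs R x)%:C).
    exact: (level_comp2 (fun a b => a * b) (level_comp2 (fun a b => a * b) lW fN) lP).
  exact: (cintegral_level1 hmu N0 L).1.
- under eq_fun do rewrite -mulrA.
  apply: (cintegrable_level N0); last exact: (level_comp2 (fun a b => a * b) fN lP).
  by split; [exact: integrable_layer_tail|exact: integrable0].
Qed.

Lemma pcoset_scale k (u v : K) :
  pcoset (p%:R ^+ l * u, (l + k)%N) (p%:R ^+ l * v) <-> pcoset (u, k) v.
Proof.
have p0 : p%:R ^+ l != 0 :> K by rewrite expf_neq0 // qp_p_neq0.
split=> /pcosetP[z vE]; apply/pcosetP; exists z; last by rewrite vE exprD mulrDr mulrA.
by apply: (mulfI p0); rewrite vE exprD mulrDr mulrA.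
Qed.

Lemma Fint_layer_series_phi0 (Q : 'M[R]_m) (k : 'I_m) :
  Fint mu m (fun x => (layer_series x)%:C * phi0 Q k x) = (- (lam 1)^-1 * Q l k)%:C.
Proof.
rewrite (Fint_layer_series (ltn0Sn 0) (phi0_level Q k (ltn0Sn 0))) big_geq // mulr0 add0r.
by rewrite (phi0E Q k hy) rmorphM.
Qed.

(** At the level of the conductor the finite part drops out, since chi sums to 0 over each [B k]
    with k < n; the tail alone gives -1/lambda_n. *)
Lemma Fint_layer_series_phichi (chi : fn) n (j : 'I_m) :
  (0 < n)%N -> is_character chi -> has_conductor chi n ->
  (lam n)%:C * Fint mu m (fun x => (layer_series x)%:C * phichi chi j x) = - phichi chi j y.
Proof.
move=> n0 hchi hn; have tr := conductor_trivial n0 hn.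
have fn := phichi_level hchi n0 j tr; rewrite (Fint_layer_series n0 fn).
have L0 : lam n != 0 by rewrite lt_eqF // lambda_lt0.
rewrite big_nat big1 ?mulr0 ?add0r => [|k /andP[k0 kn]].
  by rewrite mulrA -rmorphM /= mulrN mulfV // rmorphN mulNr mul1r.
have [[l' b] cy] := (F_ball m y n0).1 (pole_in_F hy).
have ll' : l = l' by apply: val_inj; have [] := psphere_uniq hy (ball_psphere n0 cy).
subst l'.
have hB (j' : 'I_m) (a : unitsZp n) : \1_(B k) (rep (j',
  a)) = ((j' == l) && cong k (lift b) (lift a))%:R :> R.
  have [u [uu yE ub]] : exists u, [/\ u \is a GRing.unit,
    y = p%:R ^+ l * iota u & unit_class n u = b].
    by move: cy => /(pballP _ _ n0)[u [uu yE ub]]; exists u.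
  have e : cong k (lift b) (lift a) = cong k u (lift a).
    have := cong_lift n0 uu; rewrite ub => /(cong_le (ltnW kn)) h.
    by rewrite /cong; move: h => /eqP ->.
  rewrite indicE; congr (_%:R); congr nat_of_bool; rewrite e.
  apply/idP/idP => [/set_mem Bx|/andP[/eqP -> ak]].
    have := pole_ball_sphere hy k0 Bx => /(psphere_uniq (rep_psphere hp (j',
      a) n0))[/val_inj] /= jl.
    move: Bx; rewrite jl eqxx yE => /pcoset_scale h; exact/cong_pcoset.
  by apply/mem_set; rewrite yE; apply/pcoset_scale; exact/cong_pcoset.
rewrite (_ : \sum_c _ = 0) ?mulr0 //.
rewrite -(pair_bigA _ (fun j' a => (\1_(B k) (rep (j', a)))%:C * phichi chi j (rep (j', a)))) /=.
rewrite (bigD1 l) //= [X in _ + X]big1 ?addr0; last first.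
  by move=> j' jl; rewrite big1 // => a _; rewrite hB (negPf jl) mul0r.
have [lj|lj] := eqVneq l j; last first.
  by rewrite big1 // => a _; rewrite phichi_rep // (negPf lj) mulr0.
rewrite (eq_bigr (fun a => if cong k (lift b) (lift a) then chiX chi a else 0)); last first.
  move=> a _; rewrite hB eqxx /= phichi_rep // -lj eqxx.
  by case: cong; rewrite ?mul1r ?mul0r.
rewrite -big_mkcond (reindex_inj (mulIg b)) /= (eq_bigl (fun g => principal_units hp k g));
  last first.
  by move=> g; rewrite principal_unitsE ?mulgK // ltnW.
under eq_bigr do rewrite chiXM //.
by rewrite -mulr_suml (chi_principal_units_sum0 hchi n0 hn) // mul0r.
Qed.

End GreenPairing.

(** * Construction and uniqueness of the Green function *)

Section GreenConstruction.
Variables (R : realType) (p : nat) (hp : prime p).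
Variables (mu : {measure set (Qp hp) -> \bar R}) (hmu : is_haar mu) (m : nat) (hm : (0 < m)%N).
Local Notation K := (Qp hp).
Local Notation Z := (padic_int hp).
Local Notation P := (p%:R : R).
Local Notation fn := (K -> R[i]).
Local Notation level := (@level p hp m).
Local Notation rep := (@rep p hp m).
Variables (Q : 'M[R]_m) (lam0 : 'rV[R]_m).
Hypothesis Qorth : Q^T *m Q = 1%:M.
Hypothesis Qdiag : invmx Q *m Rmx R p m *m Q = diag_mx lam0.
Hypothesis lam00 : lam0 0 (Ordinal hm) = 0.
Hypothesis Q0 : forall k : 'I_m, Q k (Ordinal hm) = (Num.sqrt (m%:R : R))^-1.
Local Notation V := (Fvol R p m).

Lemma Fint_span (I : finType) (u f : fn) (k : I -> R[i]) (e : I -> fn) N : (0 < N)%N ->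
  cintegrable mu (F m) u -> level N f -> (forall i, level N (e i)) ->
  (forall x, F m x -> f x = \sum_i k i * e i x) ->
  Fint mu m (fun x => u x * f x) = \sum_i k i * Fint mu m (fun x => u x * e i x).
Proof.
move=> N0 ui fN eN fE; rewrite (Fint_avg N0 ui fN).
under [RHS]eq_bigr => i _ do rewrite (Fint_avg N0 ui (eN i)) mulrCA.
rewrite -mulr_sumr; congr (_ * _).
under [RHS]eq_bigr => i _ do rewrite mulr_sumr.
rewrite exchange_big /=; apply: eq_bigr => c _; rewrite (fE _ (F_rep hp c N0)) mulr_sumr.
by apply: eq_bigr => i _; rewrite mulrCA.
Qed.

Lemma Fint_subl (u v f : fn) N : (0 < N)%N -> cintegrable mu (F m) u -> cintegrable mu (F m) v ->
  level N f ->
  Fint mu m (fun x => (1 * u x + -1 * v x) * f x) =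
  Fint mu m (fun x => u x * f x) - Fint mu m (fun x => v x * f x).
Proof.
move=> N0 ui vi fN; have mF := @measurable_F p hp m.
have lP : level N (fun x => f x / (pabs R x)%:C).
  exact: (level_comp2 (fun a b => a / b%:C) fN (pabs_level R N0)).
have h (w : fn) : (fun x => w x * f x / (pabs R x)%:C) = (fun x => w x * (f x / (pabs R x)%:C)).
  by apply/funext => x; rewrite mulrA.
rewrite /Fint !h -[- cintegral _ _ _]mulrN1 -cintegralZ //; last exact: cintegrable_level lP.
rewrite -cintegralD //; last 2 first.
- exact: cintegrable_level lP.
- by apply: cintegrableZ => //; exact: cintegrable_level lP.
by apply: eq_cintegral => x _; ring.
Qed.

Lemma Fint1 (f : fn) : Fint mu m f = Fint mu m (fun x => 1 * f x).
Proof. by apply: eq_Fint => x _; rewrite mul1r. Qed.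

Lemma Fint_spheres (f : fn) (h : 'I_m -> R[i]) :
  (forall (j : 'I_m) x, psphere (j : nat)%:Z x -> f x = h j) ->
  Fint mu m f = (1 - P^-1)%:C * \sum_j h j.
Proof.
move=> fh; have N1 := ltn0Sn 0.
have fN : level 1 f by move=> c x cx; rewrite !(fh c.1) //;
  [exact: rep_psphere|exact: ball_psphere cx].
have L1 : level 1 (fun=> 1 : R[i]) by [].
rewrite Fint1 (Fint_level hmu N1 L1 fN) -(unitsZp_density R hp N1).
rewrite -(pair_bigA _ (fun j a => 1 * f (rep (j, a)))) /=.
rewrite rmorphM /= -mulrA; congr (_ * _); rewrite mulr_sumr; apply: eq_bigr => j _.
rewrite (eq_bigr (fun=> h j)) => [|a _]; last by rewrite mul1r (fh j) //;
  exact: (rep_psphere hp (j, a)).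
by rewrite sumr_const rmorph_nat mulr_natl.
Qed.

Lemma Fint_spheres_phichi (u : fn) (h : 'I_m -> R[i]) chi n (j : 'I_m) :
  (forall (j : 'I_m) x, psphere (j : nat)%:Z x -> u x = h j) ->
  (0 < n)%N -> is_character chi -> has_conductor chi n ->
  Fint mu m (fun x => u x * phichi chi j x) = 0.
Proof.
move=> uh n0 hchi hn; have tr := conductor_trivial n0 hn.
have uN : level n u by move=> c x cx; rewrite !(uh c.1) //;
  [exact: rep_psphere|exact: ball_psphere cx].
rewrite (Fint_level hmu n0 uN (phichi_level hchi n0 j tr)).
rewrite -(pair_bigA _ (fun i a => u (rep (i, a)) * phichi chi j (rep (i,
  a)))) /= big1 ?mulr0 // => i _.
under eq_bigr => a _ do rewrite phichi_rep // (uh i _ (rep_psphere hp (i, a) n0)).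
by rewrite -mulr_sumr; case: eqP => _; rewrite ?(chi_sum0 hchi n0 hn) ?big1 ?mulr0.
Qed.

Lemma sum_Q_col (k : 'I_m) : \sum_j Q j k = (k == Ordinal hm)%:R * Num.sqrt m%:R.
Proof.
have s0 : Num.sqrt (m%:R : R) != 0 by rewrite gt_eqF // sqrtr_gt0 ltr0n.
have := Q_col_orth Qorth k (Ordinal hm).
under eq_bigr do rewrite Q0.
by rewrite -mulr_suml => <-; rewrite mulfVK.
Qed.

Section FixedPole.
Variables (l : 'I_m) (y : K).
Hypothesis hy : psphere (l : nat)%:Z y.
Local Notation lam n := (lambda R p m n l).
Local Notation layer_series := (@layer_series R p hp m l y).
Local Notation layer_sum := (@layer_sum R p hp m l y).
Local Notation layer_coef := (@layer_coef R p m l).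
Local Notation contact := (@contact p hp m l y).

(** The coefficient of the Dirac mass at y along phi_0^k, whose squared norm is 1 - 1/p, divided by
    the eigenvalue. *)
Definition green_coef (k : 'I_m) : R := Q l k / ((1 - P^-1) * lam0 0 k).
(* Makes the part of the Green function that depends on the distance to the pole
   orthogonal to the functions [phi0 Q k]. *)
Definition green_const : R := - ((1 - P^-1) * lam 1)^-1.

Definition green_radial_at (j : 'I_m) : R[i] :=
  \sum_(k < m | (0 < k)%N) (green_coef k)%:C * (Q j k)%:C + (green_const * (j == l)%:R)%:C.

Definition green_radial (x : K) : R[i] :=
  \sum_(k < m | (0 < k)%N) (green_coef k)%:C * phi0 Q k x
  + (green_const * \1_(psphere (l : nat)%:Z) x)%:C.

(* Written as a linear combination to match [L2F_lin] and [Fint_subl]. *)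
Definition green (x : K) : R[i] := 1 * green_radial x + -1 * (layer_series x)%:C.

Lemma green_radialE (j : 'I_m) x : psphere (j : nat)%:Z x -> green_radial x = green_radial_at j.
Proof.
move=> jx; rewrite /green_radial /green_radial_at (indic_psphere R l jx); congr (_ + _).
by apply: eq_bigr => k _; rewrite (phi0E Q k jx).
Qed.

Lemma level_radial N : (0 < N)%N -> level N green_radial.
Proof.
move=> N0 c x cx; rewrite (green_radialE (ball_psphere N0 cx)).
by rewrite (green_radialE (rep_psphere hp c N0)).
Qed.

Lemma L2F_green : L2F mu m green.
Proof. by apply: L2F_lin => //;
  [exact: (level_L2F hmu (ltn0Sn 0) (level_radial (ltn0Sn 0)))|exact: L2F_layer_series]. Qed.

Lemma green_near x : F m x -> x != y -> \forall z \near x, green z = green x.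
Proof.
move=> Fx xy; have h1 := level_locally_constant (ltn0Sn 0) (level_radial (ltn0Sn 0)) Fx.
by apply: filterS2 h1 (layer_series_near R hy Fx xy) => z /= h1 h2; rewrite /green h1 h2.
Qed.

Lemma Fint_green (f : fn) N : (0 < N)%N -> level N f ->
  Fint mu m (fun x => green x * f x) =
  Fint mu m (fun x => green_radial x * f x) - Fint mu m (fun x => (layer_series x)%:C * f x).
Proof.
move=> N0 fN; apply: (Fint_subl N0 _ _ fN).
  exact: (cintegral_level1 hmu (ltn0Sn 0) (level_radial (ltn0Sn 0))).1.
exact: (L2F_cintegrable hmu (L2F_layer_series hmu hy)).
Qed.

Lemma one_sub_pV_neq0 : 1 - P^-1 != 0.
Proof. by rewrite gt_eqF // subr_gt0 invf_lt1 ?p_gt1 ?p_gt0. Qed.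

Lemma ord_pos (k : 'I_m) : (0 < k)%N = (k != Ordinal hm).
Proof. by rewrite lt0n -val_eqE. Qed.

Lemma Fint_green_phi0 (k : 'I_m) :
  Fint mu m (fun x => green x * phi0 Q k x) = if (0 < k)%N then (Q l k / lam0 0 k)%:C else 0.
Proof.
rewrite (Fint_green (ltn0Sn 0) (phi0_level Q k (ltn0Sn 0))) (Fint_layer_series_phi0 hmu hy).
rewrite (Fint_spheres (h := fun j => green_radial_at j * (Q j k)%:C)); last first.
  by move=> j x jx; rewrite (green_radialE jx) (phi0E Q k jx).
have -> : \sum_j green_radial_at j * (Q j k)%:C =
  ((if (0 < k)%N then green_coef k else 0) + green_const * Q l k)%:C.
  rewrite rmorphD /= -[X in _ = X + _](_ : \sum_(a < m | (0 < a)%N) (green_coef a *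
    (a == k)%:R)%:C = _); last first.
    case: ifP => k0.
      rewrite (bigD1 k) //= eqxx mulr1 big1 ?addr0 // => a /andP[_ ak].
      by rewrite (negPf ak) mulr0.
    by rewrite big1 // => a a0; case: eqP => [e|_]; [rewrite e k0 in a0|rewrite mulr0].
  under eq_bigr do rewrite /green_radial_at mulrDl.
  rewrite big_split /=; congr (_ + _).
    under eq_bigr do rewrite mulr_suml.
    rewrite exchange_big /=; apply: eq_bigr => a _.
    rewrite -[in RHS](Q_col_orth Qorth) [in RHS]rmorphM /= real_complex_sum mulr_sumr.
    by apply: eq_bigr => j _; rewrite -mulrA -rmorphM.
  rewrite (bigD1 l) //= eqxx mulr1 -rmorphM /= big1 ?addr0 // => j jl.
  by rewrite (negPf jl) mulr0 mul0r.
have L0 : lam 1 != 0 by rewrite lt_eqF // lambda_lt0.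
rewrite -rmorphM -rmorphB /= mulrDr /green_const.
have -> : (1 - P^-1) * (- ((1 - P^-1) * lam 1)^-1 * Q l k) = - (lam 1)^-1 * Q l k.
  by rewrite invfM mulrA mulrN mulrA mulfV ?one_sub_pV_neq0 // mul1r.
rewrite addrK; case: ifP => k0; last by rewrite mulr0.
by rewrite /green_coef invfM mulrCA [_ * (_ / _)]mulrA mulfV ?one_sub_pV_neq0 // mul1r.
Qed.

(** The term 1/V removes the constant component of the Dirac mass: it makes the right side vanish on
    phi_0^0, and every other listed function has mean 0. *)
Lemma green_listed (nu : R) (f : fn) : listed Q lam0 nu%:C f ->
  nu%:C * Fint mu m (fun x => green x * f x) = f y - (V^-1)%:C * Fint mu m f.
Proof.
case=> [[k [[->] ->]]|[n [j [chi [n0 hchi hn [->] ->]]]]].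
  rewrite Fint_green_phi0 (phi0E Q k hy).
  rewrite (Fint_spheres (f := phi0 Q k) (h := fun j => (Q j k)%:C)); last first.
    by move=> j x jx; rewrite (phi0E Q k jx).
  rewrite -real_complex_sum sum_Q_col ord_pos.
  have [->|k0] := eqVneq k (Ordinal hm); last first.
    rewrite -rmorphM /= mulrCA mulfV ?mulr1; first by rewrite mul0r !mulr0 subr0.
    exact: (lam0_neq0 hp Qorth Qdiag Q0 k0).
  rewrite mulr0 mul1r Q0 -!rmorphM -rmorphB /=; apply/esym.
  rewrite (_ : _ - _ = 0) //; apply/eqP; rewrite subr_eq0; apply/eqP.
  have m0 : (0 : R) < m%:R by rewrite ltr0n.
  have s0 : Num.sqrt (m%:R : R) != 0 by rewrite gt_eqF // sqrtr_gt0.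
  rewrite /Fvol invfM mulrA mulfVK ?one_sub_pV_neq0 // -{2}(sqr_sqrtr (ltW m0)).
  by rewrite expr2 invfM mulfVK.
have tr := conductor_trivial n0 hn; have fN := phichi_level hchi n0 j tr.
rewrite (Fint_green n0 fN) (Fint_spheres_phichi _ green_radialE n0 hchi hn) sub0r mulrN.
have -> : Fint mu m (phichi chi j) = 0.
  by rewrite Fint1; exact: (@Fint_spheres_phichi (fun=> 1) (fun=> 1) chi n j).
rewrite mulr0 subr0.
have [->|jl] := eqVneq j l; first by rewrite (Fint_layer_series_phichi hmu hy) // opprK.
(* Here phi_chi lives on a sphere without the pole, where [layer_series] is 0, so both sides
   vanish. *)
have fy : phichi chi j y = 0 by rewrite /phichi (indic_psphere R j hy) eq_sym (negPf jl) mulr0.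
rewrite fy (@eq_Fint R p hp mu m _ (fun=> 0)); first by rewrite /Fint;
  under eq_cintegral do rewrite mul0r; rewrite cintegral0 mulr0 oppr0.
move=> x /set_mem /F_psphere[i ix].
have [e|il] := eqVneq i j; last first.
  by rewrite /phichi (indic_psphere R j ix) (negPf il) !mulr0.
have nB : ~ pcoset (y, (l + 1)%N) x.
  move=> Bx; have [e'] := psphere_uniq ix (pole_ball_sphere hy (ltn0Sn 0) Bx).
  by move: jl; rewrite -e (val_inj e') eqxx.
by rewrite (layer_seriesE R (ltn0Sn 0) nB) /layer_sum big_geq // mul0r.
Qed.

Lemma green_weak (phi : fn) : locally_constant m phi ->
  Fint mu m (fun x => green x * Dop mu m phi x) = phi y - (V^-1)%:C * Fint mu m phi.
Proof.
move=> /locally_constant_level[N N0 fN].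
have [e [nu [h1 h2 h3 _ h5]]] := level_span hmu Qorth Qdiag N0.
have [k kE] := h5 _ fN; have gi := L2F_cintegrable hmu L2F_green.
have sN : level N (fun x => \sum_c k c * e c x).
  by move=> c x cx; apply: eq_bigr => i _; rewrite (h2 i c x cx).
have DE x : F m x -> Dop mu m phi x = \sum_c (k c * (nu c)%:C) * e c x.
  move=> Fx; rewrite (eq_Dop_level hmu N0 Fx fN sN) => [|c]; last exact: kE (F_rep hp c N0).
  by rewrite (Dop_sum hmu k N0 Fx h2); apply: eq_bigr => c _; rewrite h3 // mulrA.
rewrite (Fint_span N0 gi (level_Dop hmu N0 fN) h2 DE).
rewrite Fint1 (Fint_span N0 (cintegrable_cst hmu m 1) fN h2 kE) (kE _ (pole_in_F hy)).
rewrite mulr_sumr -sumrB; apply: eq_bigr => c _.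
by rewrite -mulrA (green_listed (h1 c)) -Fint1; ring.
Qed.

Lemma green_mean0 : Fint mu m green = 0.
Proof.
have s0 : Num.sqrt (m%:R : R) != 0 by rewrite gt_eqF // sqrtr_gt0 ltr0n.
(* The constant 1 is sqrt m times phi_0^0, written as a one-term sum to fit [Fint_span]; the pairing
   with phi_0^0 is 0. *)
have -> : Fint mu m green = Fint mu m (fun x => green x * (\sum_(i < 1) (Num.sqrt
  (m%:R : R))%:C * phi0 Q (Ordinal hm) x)).
  apply: eq_Fint => x /set_mem/F_psphere[j jx].
  by rewrite big_ord1 (phi0E Q _ jx) Q0 -rmorphM mulfV // mulr1.
have L : level 1 (phi0 Q (Ordinal hm)) := phi0_level Q (Ordinal hm) (ltn0Sn 0).
have L' : level 1 (fun x => \sum_(i < 1) (Num.sqrt (m%:R : R))%:C * phi0 Q (Ordinal hm) x).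
  by move=> c x cx; rewrite !big_ord1 (L c x cx).
have -> := @Fint_span 'I_1 green _ (fun=> _) (fun=> _) 1 isT (L2F_cintegrable hmu L2F_green) L'
  (fun=> L) (fun x _ => erefl).
by rewrite big_ord1 Fint_green_phi0 mulr0.
Qed.

(** Every denominator equals -p lambda_n for the appropriate n; with this, the induction on M is a
    summation by parts. *)
Lemma green_sum M : P ^+ M.+1 / (P ^+ M.+1 + P ^+ M - bdry R p m l)
    - \sum_(1 <= n < M.+1) (P - 1) * P ^+ n / (P ^+ n + P ^+ n.-1 - bdry R p m l) =
  - \sum_(1 <= k < M.+1) layer_coef k - (lam 1)^-1.
Proof.
have p0 := p_neq0 R hp.
have L0 n : lam n.+1 != 0 by rewrite lt_eqF // lambda_lt0.
have LE n : P ^+ n.+1 + P ^+ n - bdry R p m l = - (P * lam n.+1).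
  by rewrite lambdaS // exprS; field.
have LE1 n : (0 < n)%N -> P ^+ n + P ^+ n.-1 - bdry R p m l = - (P * lam n).
  by case: n => // n _; rewrite LE.
rewrite LE (eq_big_nat _ _ (F2 := fun n => - ((P ^+ n - P ^+ n.-1) * (lam n)^-1))); last first.
  case=> // n /andP[n0 _]; rewrite LE1 //= exprS; field.
  by rewrite L0.
elim: M => [|M IHM]; first by rewrite !big_geq // oppr0 addr0 add0r expr1 invrN mulrN invfM mulrA
  mulfV // mul1r.
rewrite big_nat_recr //= [in RHS]big_nat_recr //= /layer_coef.
rewrite opprD addrA; move: IHM; rewrite !exprS => IHM.
set S := \sum_(1 <= _ < M.+1) _ in IHM *; set S' := \sum_(1 <= _ < M.+1) _ in IHM *.
have -> : S' = - (P * P ^+ M / - (P * lam M.+1) - S) - (lam 1)^-1 by rewrite IHM; ring.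
by field; rewrite !L0.
Qed.

(** The discrepancy depends only on l, that is on |y|_p: it is the constant C(|y|_p) for the Green
    function of mean zero. *)
Lemma green_formulaE x M : F m x -> vp x = (l : nat)%:Z -> (0 < M)%N -> pdist R x y = P ^- M ->
  x != y /\ green x = (green_formula p Q lam0 l M + (green_const + (lam 1)^-1))%:C.
Proof.
move=> Fx vx M0 dxy.
have p0 := p_gt0 R hp; have p1 := p_gt1 R hp.
have lx : psphere (l : nat)%:Z x by rewrite -vx; apply: psphere_vp; exact: F_neq0 Fx.
have xy : x != y.
  apply/eqP => xy; move: dxy; rewrite xy /pdist subrr pabs0 mul0r => /esym/eqP.
  by rewrite invr_eq0 expf_eq0 (gt_eqF p0) andbF.
split=> //; have s : psphere (vp (x - y)) (x - y) by apply: psphere_vp; rewrite subr_eq0.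
have vE : vp (x - y) = (l : nat)%:Z + M%:Z.
  move: dxy; rewrite /pdist (pabs_psphere R s) (pabs_psphere R lx) (pabs_psphere R hy) maxxx.
  rewrite invr_expz -expfzDr ?gt_eqF // opprK exprnN => /(ieexprIz p0 (negbT (gt_eqF p1))) h.
  lia.
have cE : contact x = M by rewrite /contact vE; case: leP => h; lia.
rewrite /green (green_radialE lx) /green_radial_at /layer_series
  (negPf xy) cE eqxx mulr1 mul1r mulN1r.
rewrite /green_formula green_sum.
under eq_bigr => k _ do rewrite -rmorphM.
rewrite -rmorph_sum -rmorphD -rmorphB; congr (_%:C) => /=.
rewrite (eq_bigr (fun k : 'I_m => Q l k * Q l k / ((1 - P^-1) * lam0 0 k))); first by ring.
by move=> k _; rewrite /green_coef mulrAC.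
Qed.

Lemma green_unique (g : fn) : L2F mu m g ->
  (forall x, F m x -> x != y -> {for x, continuous (g : K -> R[i]^o)}) ->
  (forall phi, locally_constant m phi ->
     Fint mu m (fun x => g x * Dop mu m phi x) = phi y - (V^-1)%:C * Fint mu m phi) ->
  exists c : R[i], forall x, F m x -> x != y -> g x = green x + c.
Proof.
move=> Lg gc gw; pose w : fn := fun x => 1 * g x + -1 * green x.
have Lw : L2F mu m w by apply: L2F_lin => //; exact: L2F_green.
have gi := L2F_cintegrable hmu Lg; have ui := L2F_cintegrable hmu L2F_green.
have Dw : DL2 mu m w (fun x => 0 * w x).
  split=> //.
    have := L2F_lin hmu 0 0 Lw Lw; congr (L2F _ _ _); apply/funext => x.
    by rewrite mul0r addr0.
  move=> phi lphi; have [N N0 fN] := locally_constant_level lphi.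
  have cN : level N (fun x => Num.conj (phi x)) by exact: level_comp.
  have lc : locally_constant m (fun x => Num.conj (phi x)).
    by move=> x Fx; exact: (level_locally_constant N0 cN Fx).
  rewrite /inner; under [RHS]eq_Fint do rewrite mul0r mul0r.
  rewrite [RHS](_ : _ = 0); last by rewrite /Fint; under eq_cintegral do rewrite mul0r;
    rewrite cintegral0.
  rewrite (@eq_Fint R p hp mu m _ (fun x => (1 * g x + -1 * green x) * Dop mu m
    (fun x => Num.conj (phi x)) x)).
    rewrite (Fint_subl N0 gi ui); last exact: level_Dop cN.
    by rewrite gw // green_weak // subrr.
  by move=> x /set_mem Fx; rewrite (Dop_conj hmu N0 Fx fN).
have [n [c [f [fl wE]]]] := DL2_listed hmu Qorth Qdiag Dw.
(* Each [f i] has eigenvalue 0, so it is phi_0^0, which has the constant value 1/sqrt m on F. *)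
pose k : R[i] := \sum_(i < n) c i * ((Num.sqrt (m%:R : R))^-1)%:C.
have {}wE : eqF mu m w (fun=> k).
  apply: filterS wE => x h Fx; rewrite h //; apply: eq_bigr => i _; congr (_ * _).
  have [j jx] := (F_psphere _ _).1 Fx.
  case: (fl i) => [[a [[a0] ->]]|[n' [a [chi [n0 _ _ [h0] _]]]]].
    rewrite (phi0E Q a jx); have [->|] := eqVneq a (Ordinal hm); first by rewrite Q0.
    by move=> /(lam0_neq0 hp Qorth Qdiag Q0); rewrite -a0 eqxx.
  by have := lambda_lt0 R hp a n0; rewrite -h0 ltxx.
exists k => x Fx xy; apply/eqP; rewrite addrC -subr_eq; apply: contraT => wk.
have wx : w x = g x - green x by rewrite /w mul1r mulN1r.
have e0 : 0 < `|w x - k| by rewrite normr_gt0 subr_eq0 wx.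
have near1 := green_near Fx xy.
have near2 : \forall z \near x, `|g x - g z| < `|w x - k|.
  have := gc x Fx xy; rewrite /continuous_at => /(@cvgrPdist_lt _ (R[i]^o))/(_ _ e0).
  by [].
have near3 : \forall z \near x, F m z.
  by apply: open_nbhs_nbhs; split => //; exact: open_F.
(* Passage from almost everywhere to everywhere: near x the function [green] is constant and g
   continuous, so w(x) different from k would persist on a whole coset, which has positive
   measure. *)
have /nbhs_pcosetP[N hN] : nbhs x [set z | F m z /\ w z <> k].
  near=> z; split; first by near: z.
  move=> wz; have : `|g x - g z| < `|w x - k| by near: z.
  have gz : green z = green x by near: z.
  by rewrite -wz (_ : w x - w z = g x - g z) ?ltxx // /w gz; ring.
have : mu (pcoset (x, N)) = 0%E.
  apply: measure_negligible; first exact: measurable_pcoset.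
  apply: negligibleS wE => z /hN[Fz wz] /= h; exact/wz/h.
by move=> h; have := mu_pcoset_gt0 hmu x N; rewrite h ltxx.
Unshelve. all: by end_near.
Qed.

Lemma green_unique_mean0 (g : fn) (c : R[i]) : L2F mu m g ->
  (forall x, F m x -> x != y -> g x = green x + c) -> Fint mu m g = 0 -> c = 0.
Proof.
move=> Lg gE g0; have gi := L2F_cintegrable hmu Lg; have ui := L2F_cintegrable hmu L2F_green.
pose w : fn := fun x => 1 * g x + -1 * green x; have L1 : level 1 (fun=> 1 : R[i]) by [].
have w0 : Fint mu m w = 0.
  have := Fint_subl (ltn0Sn 0) gi ui L1.
  have e (u : fn) : Fint mu m (fun x => u x * 1) = Fint mu m u by apply: eq_Fint => x _;
    rewrite mulr1.
  by rewrite !e g0 green_mean0 subr0.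
have [mw _] : L2F mu m w by apply: L2F_lin => //; exact: L2F_green.
have mP : cmeasurable (F m) (fun x : K => ((pabs R x)%:C)^-1).
  have L : level 1 (fun x : K => ((pabs R x)%:C)^-1).
    exact: (level_comp (fun r : R => (r%:C)^-1) (pabs_level R (ltn0Sn 0))).
  exact: (cmeasurable_level hmu (ltn0Sn 0) L).
have wc : Fint mu m w = Fint mu m (fun=> c).
  apply: eq_ae_cintegral => //.
  - exact: cmeasurableM.
  - by apply: cmeasurableM => //; split; exact: measurable_cst.
  exists [set y]; split; [exact: (measurable_point l y)|exact: (mu_point0 hmu l y)|].
  move=> x /= /not_implyP[Fx h]; apply: contrapT => /eqP xy; apply: h.
  by rewrite /w gE //; congr (_ / _); ring.
move: w0; rewrite wc (Fint_spheres (h := fun=> c)) // sumr_const card_ord => /eqP.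
rewrite mulf_eq0 fmorph_eq0 (negPf one_sub_pV_neq0) /= mulrn_eq0 -[m == 0]/(m == 0)%N eqn0Ngt hm /=.
by move=> /eqP.
Qed.

End FixedPole.
End GreenConstruction.

(** * Eigenvalues, eigenspaces and Green functions of the theorem *)

Section EigenvaluesAndGreenFunctions.
Variables (R : realType) (p : nat) (hp : prime p).
Variables (mu : {measure set (Qp hp) -> \bar R}) (hmu : is_haar mu) (m : nat) (hm : (0 < m)%N).
Local Notation K := (Qp hp).
Local Notation Z := (padic_int hp).
Local Notation P := (p%:R : R).
Local Notation fn := (K -> R[i]).
Local Notation level := (@level p hp m).
Variables (Q : 'M[R]_m) (lam0 : 'rV[R]_m).
Hypothesis Qorth : Q^T *m Q = 1%:M.
Hypothesis Qdiag : invmx Q *m Rmx R p m *m Q = diag_mx lam0.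

Lemma phi0_neq0 (l : 'I_m) : ~ eqF mu m (phi0 Q l) (fun=> 0).
Proof.
have [k Qk] : exists k, Q k l != 0.
  apply: contrapT => /forallNP h; have := Q_col_orth Qorth l l.
  rewrite eqxx big1 => [/eqP|k _]; first by rewrite eq_sym oner_eq0.
  by have /negP := h k; rewrite negbK => /eqP ->; rewrite mul0r.
have N1 := ltn0Sn 0; have L : level 1 (phi0 Q l) := phi0_level Q l N1.
apply: (@level_eqF0 R p hp mu hmu m 1 _ (k, 1%g) N1 L).
by rewrite (phi0E Q l (rep_psphere hp (k, 1%g) N1)) fmorph_eq0.
Qed.

Lemma phichi_neq0 (chi : fn) n (l : 'I_m) : (0 < n)%N -> is_character chi ->
  has_conductor chi n -> ~ eqF mu m (phichi chi l) (fun=> 0).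
Proof.
move=> n0 hchi hn; have tr := conductor_trivial n0 hn.
apply: (@level_eqF0 R p hp mu hmu m n _ (l, 1%g) n0 (phichi_level hchi n0 l tr)).
by rewrite phichi_rep // eqxx (chiX_mfun n0 hchi tr).1 oner_eq0.
Qed.

Lemma listed_level (lam : R[i]) (f : fn) : listed Q lam0 lam f ->
  exists N, [/\ (0 < N)%N, level N f & forall x, F m x -> Dop mu m f x = lam * f x].
Proof.
case=> [[l [-> ->]]|[n [l [chi [n0 hchi hn -> ->]]]]].
  by exists 1%N; split=> // [|x Fx]; [exact: phi0_level|exact: Dop_phi0].
by exists n; split=> // [|x Fx];
  [exact: (phichi_level hchi n0 l (conductor_trivial n0 hn))|exact: Dop_phichi].
Qed.

Lemma listed_eigenfunction (lam : R[i]) (f : fn) : listed Q lam0 lam f ->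
  (forall x, F m x -> cintegrable mu (F m) (Dkernel f x) /\ Dop mu m f x = lam * f x) /\
  is_eigenfunction mu m lam f.
Proof.
move=> fl; have [N [N0 fN Df]] := listed_level fl; split.
  by move=> x Fx; split; [exact: (Dop_level hmu N0 Fx fN).1|exact: Df].
split; first exact: (level_eigen_DL2 hmu N0 fN).
by case: fl => [[l [_ ->]]|[n [l [chi [n0 hchi hn _ ->]]]]];
  [exact: phi0_neq0|exact: phichi_neq0 hn].
Qed.

Lemma eigenvalueP (lam : R[i]) : is_eigenvalue mu m lam <->
  (exists l : 'I_m, lam = (lam0 0 l)%:C) \/
  (exists (n : nat) (l : 'I_m),
    [/\ (0 < n)%N, (0 < mult p n)%N & lam = (lambda R p m n l)%:C]).
Proof.
split=> [[u [Du nu]]|[[l ->]|[n [l [n0 m0 ->]]]]].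
- have [n [c [f [fl uE]]]] := DL2_listed hmu Qorth Qdiag Du.
  case: n c f fl uE => [|n] c f fl uE.
    by case: nu; apply: filterS uE => x h Fx; rewrite h // big_ord0.
  case: (fl ord0) => [[l [-> _]]|[n' [l [chi [n0 hchi hn -> _]]]]]; first by left; exists l.
  by right; exists n', l; split=> //; exact: mult_gt0 hn.
- by exists (phi0 Q l); apply: (listed_eigenfunction _).2; left; exists l.
have [chi hchi hn] := conductor_char_exists R hp n0 m0.
by exists (phichi chi l); apply: (listed_eigenfunction _).2; right; exists n, l, chi.
Qed.

Lemma eigenspaceP (lam : R[i]) (u : fn) : L2F mu m u ->
  DL2 mu m u (fun x => lam * u x) <->
  exists (N : nat) (c : 'I_N -> R[i]) (f : 'I_N -> fn),
    (forall i, listed Q lam0 lam (f i)) /\ eqF mu m u (fun x => \sum_(i < N) c i * f i x).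
Proof.
move=> Lu; split=> [|[n [c [f [fl uE]]]]]; first exact: DL2_listed.
have [N hN] := choice (fun i => listed_level (fl i)).
pose M := (\max_i N i).+1; have M0 : (0 < M)%N by [].
have fM i : level M (f i).
  have [N0 fN _] := hN i; apply: level_le fN; rewrite N0 /M ltnW // ltnS.
  exact: leq_bigmax.
have sM : level M (fun x => \sum_(i < n) c i * f i x).
  by move=> a x ax; apply: eq_bigr => i _; rewrite (fM i a x ax).
apply: (DL2_of_level hmu Lu M0 sM _ uE) => x Fx; rewrite (Dop_sum hmu c M0 Fx fM) mulr_sumr.
by apply: eq_bigr => i _; have [_ _ ->] := hN i; rewrite // mulrCA.
Qed.

Hypothesis lam00 : lam0 0 (Ordinal hm) = 0.
Hypothesis Q0 : forall k : 'I_m, Q k (Ordinal hm) = (Num.sqrt (m%:R : R))^-1.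

Lemma listed0 (f : fn) : listed Q lam0 0 f -> f = phi0 Q (Ordinal hm).
Proof.
case=> [[l [[h] ->]]|[n [l [chi [n0 _ _ [h] _]]]]].
  have [->//|] := eqVneq l (Ordinal hm).
  by move=> /(lam0_neq0 hp Qorth Qdiag Q0); rewrite -h eqxx.
by have := lambda_lt0 R hp l n0; rewrite -h ltxx.
Qed.

Lemma kernelP (u : fn) : L2F mu m u ->
  DL2 mu m u (fun=> 0) <-> exists c : R[i], eqF mu m u (fun x => c * phi0 Q (Ordinal hm) x).
Proof.
move=> Lu; have -> : (fun=> 0) = (fun x => 0 * u x) by apply/funext => x; rewrite mul0r.
rewrite (eigenspaceP 0 Lu); split=> [[n [c [f [fl uE]]]]|[c uE]].
  exists (\sum_i c i); apply: filterS uE => x h Fx; rewrite h // mulr_suml.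
  by apply: eq_bigr => i _; rewrite (listed0 (fl i)).
exists 1%N, (fun=> c), (fun=> phi0 Q (Ordinal hm)); split.
  by move=> _; left; exists (Ordinal hm); rewrite lam00.
by apply: filterS uE => x h Fx; rewrite h // big_ord1.
Qed.

Lemma integral_FvolE : (\int[mu]_(x in F m) ((pabs R x)^-1)%:E = (Fvol R p m)%:E)%E.
Proof.
have L : level 1 (fun x : K => ((pabs R x)^-1)%:C).
  exact: (level_comp (fun r : R => (r^-1)%:C) (pabs_level R (ltn0Sn 0))).
have [[gi _] _] := cintegral_level1 hmu (ltn0Sn 0) L.
have -> : (\int[mu]_(x in F m) ((pabs R x)^-1)%:E = (\int[mu]_(x in F m) (pabs R x)^-1)%:E)%E.
  by rewrite /Rintegral fineK //; apply: integrable_fin_num gi; exact: measurable_F.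
congr (_%:E); have := @Fint_spheres R p hp mu hmu m (fun=> 1) (fun=> 1) (fun _ _ _ => erefl).
have -> : Fint mu m (fun=> 1) = cintegral mu (F m) (fun x => ((pabs R x)^-1)%:C).
  by apply: eq_cintegral => x _; rewrite fmorphV mul1r.
rewrite cintegral_real sumr_const card_ord -[1 *+ m]/(m%:R) -(rmorph_nat
  (real_complex R)) -rmorphM /=.
by move=> [->]; rewrite /Fvol mulrC.
Qed.

Lemma green_exists : exists G : K -> K -> R[i],
  is_green mu m G /\ forall y, F m y -> Fint mu m (G^~ y) = 0.
Proof.
have [g hg] : exists g : K -> fn, forall y, F m y -> exists l : 'I_m,
    psphere (l : nat)%:Z y /\ g y = @green R p hp m Q lam0 l y.
  suff H y : exists g : fn, F m y -> exists l : 'I_m,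
      psphere (l : nat)%:Z y /\ g = @green R p hp m Q lam0 l y by have [g] := choice H; exists g.
  have [/F_psphere[l hy]|nF] := pselect (F m y); last by exists (fun=> 0).
  by exists (@green R p hp m Q lam0 l y) => _; exists l.
exists (fun x y => g y x); split=> y Fy; have [l [hy gE]] := hg y Fy; rewrite /= gE.
  split; [exact: L2F_green|move=> x Fx xy|by move=> phi; exact: green_weak].
  by apply: cvg_near_cst; [exact: nbhs_filter|exact: (green_near Q lam0 hy Fx xy)].
exact: green_mean0.
Qed.

(** The equation leaves one free constant for each pole, so the correction is a function of y;
    prescribing the mean of G(., y) makes it a function of |y|_p. *)
Lemma green_formula_upto G : is_green mu m G ->
  exists c : K -> R[i], forall (x y : K) (l : 'I_m) (M : nat),
    F m x -> F m y -> vp x = (l : nat)%:Z -> vp y = (l : nat)%:Z ->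
    (0 < M)%N -> pdist R x y = P ^- M ->
    G x y = (green_formula p Q lam0 l M)%:C + c y.
Proof.
move=> hG; suff [c hc] : exists c : K -> R[i], forall y (x : K) (l : 'I_m) (M : nat),
    F m x -> F m y -> vp x = (l : nat)%:Z -> vp y = (l : nat)%:Z ->
    (0 < M)%N -> pdist R x y = P ^- M -> G x y = (green_formula p Q lam0 l M)%:C + c y.
  by exists c => x y; exact: hc.
suff H y : exists cy : R[i], forall (x : K) (l : 'I_m) (M : nat),
    F m x -> F m y -> vp x = (l : nat)%:Z -> vp y = (l : nat)%:Z ->
    (0 < M)%N -> pdist R x y = P ^- M -> G x y = (green_formula p Q lam0 l M)%:C + cy.
  by have [c] := choice H; exists c.
have [/F_psphere[l' hy]|nF] := pselect (F m y); last by exists 0.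
have [Lg gc gw] := hG y (pole_in_F hy).
have [c0 hc0] := green_unique hmu Qorth Qdiag Q0 hy Lg gc gw.
eexists => x l M Fx _ vx vy M0 dxy.
have ll : l = l' by apply: val_inj;
  have [] : (l : nat)%:Z = (l' : nat)%:Z by rewrite -vy (vp_psphere hy).
rewrite ll in vx *; have [xy gE] := green_formulaE hm Q lam0 hy Fx vx M0 dxy.
by rewrite hc0 // gE rmorphD /= -addrA.
Qed.

Lemma green_formula_mean0 G : is_green mu m G -> (forall y, F m y -> Fint mu m (G^~ y) = 0) ->
  exists C : R -> R[i], forall (x y : K) (l : 'I_m) (M : nat),
    F m x -> F m y -> vp x = (l : nat)%:Z -> vp y = (l : nat)%:Z ->
    (0 < M)%N -> pdist R x y = P ^- M ->
    G x y = (green_formula p Q lam0 l M)%:C + C (pabs R y).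
Proof.
(* The sum selects the index l with |y|_p = p^-l, which is unique because powers of p are
   distinct. *)
move=> hG G0; exists (fun r => \sum_(l < m)
  if r == P ^- l then (green_const R p l + (lambda R p m 1 l)^-1)%:C else 0).
move=> x y l M Fx Fy vx vy M0 dxy.
have hy : psphere (l : nat)%:Z y by rewrite -vy; apply: psphere_vp; exact: F_neq0 Fy.
have [Lg gc gw] := hG y Fy.
have [c0 hc0] := green_unique hmu Qorth Qdiag Q0 hy Lg gc gw.
have c00 := green_unique_mean0 hmu Qorth Q0 hy Lg hc0 (G0 y Fy).
have [xy gE] := green_formulaE hm Q lam0 hy Fx vx M0 dxy.
rewrite hc0 // gE c00 addr0 rmorphD /=; congr (_ + _).
rewrite (pabs_psphere R hy) -exprnN (bigD1 l) //= eqxx big1 ?addr0 // => j jl.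
case: eqP => // /invr_inj /(ieexprIn (p_gt0 R hp) (negbT (gt_eqF (p_gt1 R hp)))) /val_inj e.
by rewrite e eqxx in jl.
Qed.

End EigenvaluesAndGreenFunctions.

Theorem theorem1p3 (R : realType) (p : nat) (hp : prime p)
  (mu : {measure set (Qp hp) -> \bar R}) (hmu : is_haar mu)
  (m : nat) (hm : (0 < m)%N)
  (Q : 'M[R]_m) (lam0 : 'rV[R]_m)
  (Q_orthogonal : Q^T *m Q = 1%:M)
  (Q_diagonalizes : invmx Q *m Rmx R p m *m Q = diag_mx lam0)
  (lam0_0 : lam0 0 (Ordinal hm) = 0)
  (Q_col0 : forall k : 'I_m, Q k (Ordinal hm) = (Num.sqrt (m%:R : R))^-1) :
  (* the listed functions satisfy D u = lam u on F, with an absolutely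
     convergent integral at every point, and are eigenfunctions on L^2 *)
  [/\ (forall l : 'I_m,
         (forall x, F m x ->
            cintegrable mu (F m) (Dkernel (phi0 Q l) x) /\
            Dop mu m (phi0 Q l) x = (lam0 0 l)%:C * phi0 Q l x) /\
         is_eigenfunction mu m (lam0 0 l)%:C (phi0 Q l)),
      (forall (n : nat) (l : 'I_m) (chi : Qp hp -> R[i]),
         (0 < n)%N -> is_character chi -> has_conductor chi n ->
         (forall x, F m x ->
            cintegrable mu (F m) (Dkernel (phichi chi l) x) /\
            Dop mu m (phichi chi l) x =
              (lambda R p m n l)%:C * phichi chi l x) /\
         is_eigenfunction mu m (lambda R p m n l)%:C (phichi chi l)),
  (* there are no other eigenvalues *)
      (forall lam : R[i],
         is_eigenvalue mu m lam <->
         (exists l : 'I_m, lam = (lam0 0 l)%:C) \/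
         (exists (n : nat) (l : 'I_m),
            [/\ (0 < n)%N, (0 < mult p n)%N & lam = (lambda R p m n l)%:C])) &
  (* and every eigenspace is spanned by the listed eigenfunctions *)
      (forall (lam : R[i]) (u : Qp hp -> R[i]), L2F mu m u ->
         DL2 mu m u (fun x => lam * u x) <->
         exists (N : nat) (c : 'I_N -> R[i]) (f : 'I_N -> (Qp hp -> R[i])),
           (forall i, listed Q lam0 lam (f i)) /\
           eqF mu m u (fun x => \sum_(i < N) c i * f i x))] /\
  (forall u : Qp hp -> R[i], L2F mu m u ->
     DL2 mu m u (fun=> 0) <->
     exists c : R[i], eqF mu m u (fun x => c * phi0 Q (Ordinal hm) x)) /\
  (forall (n : nat) (l : 'I_m), (0 < n)%N ->
     [set phichi chi l | chi in
        [set chi : Qp hp -> R[i] | is_character chi /\ has_conductor chi n]]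
     #= `I_(mult p n)) /\
  (\int[mu]_(x in F m) ((pabs R x)^-1)%:E = (Fvol R p m)%:E)%E /\
  (exists G : Qp hp -> Qp hp -> R[i],
     is_green mu m G /\ forall y, F m y -> Fint mu m (G^~ y) = 0) /\
  (forall G : Qp hp -> Qp hp -> R[i], is_green mu m G ->
     exists c : Qp hp -> R[i],
       forall (x y : Qp hp) (l : 'I_m) (M : nat),
         F m x -> F m y -> vp x = (l : nat)%:Z -> vp y = (l : nat)%:Z ->
         (0 < M)%N -> pdist R x y = p%:R ^- M ->
         G x y = (green_formula p Q lam0 l M)%:C + c y) /\
  (forall G : Qp hp -> Qp hp -> R[i], is_green mu m G ->
     (forall y, F m y -> Fint mu m (G^~ y) = 0) ->
     exists C : R -> R[i],
       forall (x y : Qp hp) (l : 'I_m) (M : nat),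
         F m x -> F m y -> vp x = (l : nat)%:Z -> vp y = (l : nat)%:Z ->
         (0 < M)%N -> pdist R x y = p%:R ^- M ->
         G x y = (green_formula p Q lam0 l M)%:C + C (pabs R y)).
Proof.
have Qo := Q_orthogonal; have Qd := Q_diagonalizes.
split; [split|split; [|split; [|split; [|split; [|split]]]]].
- by move=> l; apply: (listed_eigenfunction hmu Qo Qd); left; exists l.
- by move=> n l chi n0 hchi hn; apply: (listed_eigenfunction hmu Qo Qd); right; exists n, l, chi.
- exact: (eigenvalueP hmu Qo Qd).
- exact: (eigenspaceP hmu Qo Qd).
- exact: (kernelP hmu Qo Qd lam0_0 Q_col0).
- by move=> n l n0; exact: card_phichi.
- exact: (integral_FvolE hmu m).
- exact: (green_exists hmu Qo Qd Q_col0).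
- exact: (green_formula_upto hmu Qo Qd Q_col0).
exact: (green_formula_mean0 hmu Qo Qd Q_col0).
Qed.
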